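(* Let $\alpha\in(0,n)$, $0<s<\frac{n}{\alpha}$, and $q\in[1,s)$. There exists a constant $B>0$ such that $$\int_{\mathbb{R}^n}(I_\alpha f)^q\,d\mathrm{cap}_{\alpha,s}\le B\,\|f\|^q_{\dot{\widetilde{O}}^{\alpha,s}_q}$$ holds for all nonnegative functions $f\in\dot{\widetilde{O}}^{\alpha,s}_q$. Consequently, there exists a constant $A>0$ such that $$\int_{\mathbb{R}^n}(I_\alpha f)^q\,d\mathrm{cap}_{\alpha,s}\le A\int_{\mathbb{R}^n}f^s(I_\alpha f)^{q-s}\,dx$$ holds for all nonnegative functions $f\in\dot{\widetilde{O}}^{\alpha,s}_q$.
   Context: Here $n\ge1$ is an integer. For $0<\alpha<n$ the Riesz potential is $I_\alpha f(x)=\gamma(n,\alpha)\int_{\mathbb{R}^n}|x-y|^{\alpha-n}f(y)\,dy$, with $\gamma(n,\alpha)=\Gamma(\frac{n-\alpha}{2})/[\pi^{n/2}2^\alpha\Gamma(\frac{\alpha}{2})]$. The Riesz capacity of $E\subset\mathbb{R}^n$ is $\mathrm{cap}_{\alpha,s}(E)=\inf\{\|f\|_{L^s(\mathbb{R}^n)}^s: f\ge0,\ I_\alpha f\ge1\text{ on }E\}$. ''q.e.'' means except on a set of zero $\mathrm{cap}_{\alpha,s}$-capacity. For a q.e. defined $g$ with values in $[0,\infty]$, $\int_{\mathbb{R}^n}g\,d\mathrm{cap}_{\alpha,s}=\int_0^\infty\mathrm{cap}_{\alpha,s}(\{g>t\})\,dt$, and $\|u\|_{L^q(\mathrm{cap}_{\alpha,s})}=(\int|u|^q\,d\mathrm{cap}_{\alpha,s})^{1/q}$.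 A weight is a nonnegative locally integrable function on $\mathbb{R}^n$. For $1\le q<s$, $\dot{\widetilde{O}}^{\alpha,s}_q$ is the space of measurable functions $g$ on $\mathbb{R}^n$ with finite quasi-norm $$\|g\|_{\dot{\widetilde{O}}^{\alpha,s}_q}=\inf_w\Big(\int_{\mathbb{R}^n}|g|^sw^{q-s}\,dx\Big)^{1/s},$$ the infimum being over all q.e. defined weights $w$ with $\|w\|_{L^q(\mathrm{cap}_{\alpha,s})}\le1$; the integral is understood as $\int_{\{g\ne0\}}|g|^sw^{q-s}\,dx$. Conventions: $\frac1\infty=0$, and $f^s(I_\alpha f)^{q-s}$ is taken to be $0$ where $f=0$. *)

(* Defs.v *)
From HB Require Import structures.
From mathcomp Require Import all_boot all_order all_algebra.
From mathcomp Require Import all_classical all_reals all_analysis.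
From mathcomp Require Import measurable_realfun.

Set Implicit Arguments.
Unset Strict Implicit.
Unset Printing Implicit Defensive.

Import Order.TTheory GRing.Theory Num.Theory.

Local Open Scope classical_set_scope.
Local Open Scope ring_scope.

Definition cons_pair (R : realType) (n : nat) (p : measurableTypeR R * n.-tuple (measurableTypeR R)) :
  n.+1.-tuple (measurableTypeR R) := [tuple of p.1 :: p.2].

Lemma measurable_cons_pair (R : realType) (n : nat) :
  measurable_fun [set: _] (@cons_pair R n).
Proof. exact: measurable_cons. Qed.

Section cons_measure.
Local Open Scope ereal_scope.
Context (R : realType) (n : nat).
Variable mu : {sigma_finite_measure set (n.-tuple (measurableTypeR R)) -> \bar R}.

Definition cons_measure : set (n.+1.-tuple (measurableTypeR R)) -> \bar R :=
  pushforward (@lebesgue_measure R \x mu) (@cons_pair R n).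

Let cons_measure0 : cons_measure set0 = 0.
Proof. by rewrite /cons_measure /pushforward preimage_set0 measure0. Qed.

Let cons_measure_ge0 A : 0 <= cons_measure A.
Proof.
have mc := @measurable_cons_pair R n.
exact: (measure_ge0 (pushforward (@lebesgue_measure R \x mu) _)).
Qed.

Let cons_measure_sigma_additive : semi_sigma_additive cons_measure.
Proof.
have mc := @measurable_cons_pair R n.
exact: (@measure_semi_sigma_additive _ _ _ (pushforward _ _)).
Qed.

HB.instance Definition _ := isMeasure.Build _ _ _ cons_measure
  cons_measure0 cons_measure_ge0 cons_measure_sigma_additive.

Let cons_measure_sigma_finite : sigma_finite [set: _] cons_measure.
Proof.
have /sigma_finiteP[F [FT ndF Foo]] := sigma_finiteT (@lebesgue_measure R).
have /sigma_finiteP[G [GT ndG Goo]] := sigma_finiteT mu.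
pose split (t : n.+1.-tuple (measurableTypeR R)) :=
  (thead t : measurableTypeR R, [tuple of behead t]).
have msplit : measurable_fun [set: _] split.
  by apply/measurable_fun_pair => /=;
    [exact: measurable_tnth|exact: measurable_behead].
exists (fun k => split @^-1` (F k `*` G k)).
  apply/esym; rewrite -subTset => t _.
  have [i _ Fi] : (\bigcup_k F k) (split t).1 by rewrite -FT.
  have [j _ Gj] : (\bigcup_k G k) (split t).2 by rewrite -GT.
  exists (maxn i j) => //; split.
    by move: Fi; exact/subsetPset/ndF/leq_maxl.
  by move: Gj; exact/subsetPset/ndG/leq_maxr.
move=> k; have [mF Fk] := Foo k; have [mG Gk] := Goo k; split.
  by rewrite -[X in measurable X]setTI; apply: msplit => //; exact: measurableX.
rewrite /cons_measure /pushforward -comp_preimage.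
rewrite (_ : split \o _ = id) ?preimage_id; last first.
  by apply/funext => -[x t]; congr pair; exact: val_inj.
by rewrite product_measure1E// lte_mul_pinfty// ge0_fin_numE.
Qed.

HB.instance Definition _ := Measure_isSigmaFinite.Build _ _ _ cons_measure
  cons_measure_sigma_finite.

End cons_measure.

Fixpoint borel_lebesgue (R : realType) (n : nat) :
    {sigma_finite_measure set (n.-tuple (measurableTypeR R)) -> \bar R} :=
  if n is m.+1 then cons_measure (borel_lebesgue R m) else \d_[tuple].

Lemma borel_lebesgue_box (R : realType) (n : nat)
    (A : 'I_n -> set (measurableTypeR R)) :
  (forall i, measurable (A i)) ->
  borel_lebesgue R n [set t | forall i, A i (tnth t i)] =
  (\prod_(i < n) lebesgue_measure (A i))%E.
Proof.
elim: n A => [|n IHn] A mA.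
  by rewrite big_ord0 /= diracE mem_set// => -[].
rewrite big_ord_recl -IHn//= -product_measure1E//; last first.
  rewrite (_ : [set _ | _] = \bigcap_(i in [set: 'I_n])
    ((fun t : n.-tuple (measurableTypeR R) => tnth t i)
       @^-1` A (lift ord0 i))); last first.
    by apply/seteqP; split=> t /= h i; [move=> _; exact: h|exact: (h i I)].
  apply: fin_bigcap_measurable => // i _.
  by rewrite -[X in measurable X]setTI; exact: measurable_tnth.
rewrite /cons_measure /pushforward; congr (product_measure1 _ _ _).
apply/seteqP; split=> -[x t] /=.
  move=> h; split=> [|i]; first by have := h ord0; rewrite tnth0.
  by have := h (lift ord0 i); rewrite tnthS.
move=> [xA tA] i; case: (unliftP ord0 i) => [j ->|->].
  by rewrite tnthS.
by rewrite tnth0.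
Qed.

(* n-tuples carry the Borel sigma-algebra; Rspace carries the Lebesgue
   measurable sets, as the Caratheodory completion of borel_lebesgue. *)
Definition Rspace (R : realType) (n : nat) : measurableType _ :=
  caratheodory_type (borel_lebesgue R n)^*%mu.

Definition lebesgue_Rn (R : realType) (n : nat) :
    {measure set (Rspace R n) -> \bar R} :=
  @completed_measure_extension _ _ _ (borel_lebesgue R n).

Section definitions.
Local Open Scope ereal_scope.
Context (R : realType) (n : nat).
Local Notation Rn := (Rspace R n).
Local Notation mu := (lebesgue_Rn R n).
Implicit Types (x y : Rn) (f g w : Rn -> \bar R) (D E : set Rn).

Definition coord x (i : 'I_n) : R := tnth x i.

Definition eucl_dist x y : R :=
  Num.sqrt (\sum_(i < n) (coord x i - coord y i) ^+ 2)%R.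

(* The library power `^ on \bar R does not invert at 0 and +oo when the exponent
   is negative (0 `^ r = 0 and +oo `^ r = +oo for r < 0), whereas here
   0 to a negative power is +oo and +oo to a negative power is 0. *)
Definition epow (a : \bar R) (r : R) : \bar R :=
  if (r < 0)%R then (a `^ (- r))^-1 else a `^ r.

Definition Gamma (a : R) : R :=
  (\int[lebesgue_measure]_(t in `]0%R, +oo[) (t `^ (a - 1) * expR (- t)))%R.

Definition riesz_const (alpha : R) : R :=
  (Gamma ((n%:R - alpha) / 2) /
   (pi `^ (n%:R / 2) * 2 `^ alpha * Gamma (alpha / 2)))%R.

Definition riesz (alpha : R) f x : \bar R :=
  (riesz_const alpha)%:E *
  \int[mu]_y (epow (eucl_dist x y)%:E (alpha - n%:R) * f y).

Definition cap (alpha s : R) E : \bar R :=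
  ereal_inf [set 'N[mu]_s%:E[f] `^ s | f in
    [set f | [/\ measurable_fun [set: Rn] f, forall x, 0 <= f x &
                 forall x, E x -> 1 <= riesz alpha f x]]].

(* A function defined only quasi-everywhere is a total function together with
   the set D off which its values are disregarded; quasi_full says that the
   complement of D has zero capacity. *)
Definition quasi_full (alpha s : R) D : Prop := cap alpha s (~` D) = 0.

Definition choquet_integral (alpha s : R) D g : \bar R :=
  \int[lebesgue_measure]_(t in `]0%R, +oo[)
    cap alpha s (D `&` [set x | t%:E < g x]).

Definition Lq_cap_norm (alpha s q : R) D g : \bar R :=
  choquet_integral alpha s D (fun x => `|g x| `^ q) `^ q^-1.

Definition weight D w : Prop :=
  (forall x, D x -> 0 <= w x) /\
  (forall c r, mu.-integrable (D `&` [set x | (eucl_dist c x <= r)%R]) w).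

Definition tildeO_norm (alpha s q : R) g : \bar R :=
  ereal_inf [set (\int[mu]_(x in Dw.1 `&` [set x | g x != 0])
                    (`|g x| `^ s * epow (Dw.2 x) (q - s))) `^ s^-1
            | Dw in [set Dw : set Rn * (Rn -> \bar R) |
                [/\ quasi_full alpha s Dw.1, weight Dw.1 Dw.2 &
                    Lq_cap_norm alpha s q Dw.1 Dw.2 <= 1]]].

Definition tildeO (alpha s q : R) : set (Rn -> \bar R) :=
  [set g | measurable_fun [set: Rn] g /\ tildeO_norm alpha s q g < +oo].

End definitions.

(* Main.v *)
(* Let near_j(x) be the union of the dyadic cell of side 2^j containing x and of
   its neighbours, and avg_j f(x) the normalised integral of f over it.  Up to
   constants, I_alpha f is the dyadic potential sum_j 2^(j alpha) avg_j f, and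
   the Choquet integral of g is sum_k 2^k cap {g > 2^k}.  It is therefore enough
   to find, for each k, one test function psi_k for {I f > 2^(k/q)} such that
   sum_k 2^k ||psi_k||_s^s is bounded.

   Put omega = w^q and f = g omega^(1/q - 1/s), so that ||g||_s^s is the integral
   in the quasi-norm, and let h_k be nearly optimal for {omega > 2^k}.  If h is a
   test function for E, then {M 1_E > t} has a test function whose norm is that
   of h up to a factor t^-tau with tau < 1; summing over levels, the h_k yield
   test functions for the level sets of Omega = M(omega^(1+delta))^(1/(1+delta)).
   By Hoelder, avg_j f <= G Omega_j^(1/q - 1/s), where G is a maximal function of
   g.  Where Omega <= 2^k and I f > 2^(k/q), look at the generations j at which
   the tails of the series defining I f pass from 2^((k-1)/q) to 2^(k/q): they
   form a layer, on which min(2^(-j alpha), 2^(-k/q) avg_j f) is a test function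
   phi_k, and sum_k 2^k phi_k^s <= C G^s pointwise, since the layers of distinct
   levels are separated.

   The second inequality follows by taking a multiple of the dyadic potential of
   f as the weight w. *)
From HB Require Import structures.
From mathcomp Require Import all_boot all_order all_algebra.
From mathcomp Require Import all_classical all_reals all_analysis.
From mathcomp Require Import measurable_realfun.
From mathcomp Require Import ring lra zify.
Require Import Defs.

Set Implicit Arguments.
Unset Strict Implicit.
Unset Printing Implicit Defensive.

Import Order.TTheory GRing.Theory Num.Theory.

Local Open Scope classical_set_scope.
Local Open Scope ring_scope.

(** * Powers and sums indexed by the integers *)

(** The weight is known only through the capacities of its level sets, and its averages may exceed
    its value at a point, so these sets must be replaced by those of a maximal function without
    losing the weighted sum of capacities. The exponent t < 1 in [capacity_maximal_indicator]
    permits this: with eta = 1 + delta and (1 + 2 delta) t < 1 the double sum over levels still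
    converges geometrically. Conversely, delta > 0 serves the Hoelder step. The exponent r conjugate
    to eta / (1/q - 1/s) is then smaller than s even for q = 1, where eta = 1 would give r = s, and
    M(g^r)^(1/r) is bounded on L^s. The cap V^(-aj) in the layer functions, with a = alpha/n, has
    two roles. That value on one cell of generation j already produces potential 1, so capping loses
    nothing. And when a higher level K occurs over the same point, a segment of the series of size
    comparable to 2^(K/q) has to fit between the two layers, which makes V^(-aj) small at the lower
    level. *)

HB.lock Definition pw (R : realType) (b t : R) (j : int) : R :=
  b `^ (t * j%:~R).

Section int_powers.
Context {R : realType}.
Implicit Types (b t u x : R) (i j k : int).

Lemma pwE b t j : pw b t j = b `^ (t * j%:~R). Proof. by rewrite unlock. Qed.

Lemma pw_ge0 b t j : 0 <= pw b t j. Proof. by rewrite pwE powR_ge0. Qed.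

Lemma pw_gt0 b t j : 0 < b -> 0 < pw b t j.
Proof. by move=> b0; rewrite pwE powR_gt0. Qed.

Lemma pw_neq0 b t j : 0 < b -> pw b t j != 0.
Proof. by move=> b0; rewrite gt_eqF ?pw_gt0. Qed.

Lemma pw0 b t : pw b t 0 = 1. Proof. by rewrite !pwE mulr0 powRr0. Qed.

Lemma pwD b t i j : 0 < b -> pw b t (i + j) = pw b t i * pw b t j.
Proof.
move=> b0; rewrite !pwE intrD mulrDr powRD//.
by rewrite (gt_eqF b0) implybT.
Qed.

Lemma pwN b t j : pw b t (- j) = (pw b t j)^-1.
Proof. by rewrite !pwE intrN mulrN powRN. Qed.

Lemma pwB b t i j : 0 < b -> pw b t (i - j) = pw b t i / pw b t j.
Proof. by move=> b0; rewrite pwD// pwN. Qed.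

Lemma pwDt b t u j : 0 < b -> pw b (t + u) j = pw b t j * pw b u j.
Proof.
move=> b0; rewrite !pwE mulrDl powRD//.
by rewrite (gt_eqF b0) implybT.
Qed.

Lemma pwNt b t j : pw b (- t) j = (pw b t j)^-1.
Proof. by rewrite !pwE mulNr powRN. Qed.

Lemma pw_powR b t u j : pw b t j `^ u = pw b (t * u) j.
Proof. by rewrite !pwE -powRrM mulrAC. Qed.

Lemma pwS b t j : 0 < b -> pw b t (j + 1) = pw b t j * b `^ t.
Proof. by move=> b0; rewrite pwD// (pwE _ _ 1) mulr1. Qed.

Lemma ler_pw b t i j : 1 <= b -> 0 <= t -> i <= j -> pw b t i <= pw b t j.
Proof.
by move=> b1 t0 ij; rewrite !pwE ler_powR// ler_wpM2l// ler_int.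
Qed.

Lemma powR_gt1 b t : 1 < b -> 0 < t -> 1 < b `^ t.
Proof.
move=> b1 t0; have -> : 1 = 1 `^ t :> R by rewrite powR1.
by apply: gt0_ltr_powR => //; rewrite nnegrE ltW// (lt_trans ltr01).
Qed.

Lemma ltr_pw b t i j : 1 < b -> 0 < t -> i < j -> pw b t i < pw b t j.
Proof.
move=> b1 t0 ij; have b0 : 0 < b by rewrite (lt_trans ltr01).
have le1 : 1 <= pw b t (j - i - 1).
  by rewrite -(pw0 b t) ler_pw ?(ltW b1) ?(ltW t0)//; lia.
have -> : j = i + 1 + (j - i - 1) by ring.
rewrite pwD// pwS//; move: (pw _ _ (_ - _)) le1 => p le1;
  apply: (@lt_le_trans _ _ (pw b t i * b `^ t)).
  by rewrite ltr_pMr ?pw_gt0// powR_gt1.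
by rewrite ler_peMr// mulr_ge0 ?pw_ge0 ?powR_ge0.
Qed.

Lemma pw_unbounded b t x : 1 < b -> 0 < t -> exists j : nat, x < pw b t j.
Proof.
move=> b1 t0; have b0 : 0 < b by rewrite (lt_trans ltr01).
have bt1 := powR_gt1 b1 t0.
have c0 : 0 < b `^ t - 1 by rewrite subr_gt0.
have [N hN] : exists N : nat, x < N%:R * (b `^ t - 1).
  exists (Num.truncn (x / (b `^ t - 1))).+1; rewrite -ltr_pdivrMr//.
  exact: truncnS_gt.
exists N; apply: (lt_le_trans hN).
elim: {hN} N => [|N IH]; first by rewrite mul0r pw_ge0.
rewrite -addn1 PoszD pwS// natrD mulrDl mul1r.
have : 1 <= pw b t N by rewrite -(pw0 b t) ler_pw// ltW.
move: IH bt1; set a := b `^ t; set p := pw _ _ _; set c := _ * _ => *.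
have : 0 <= (p - 1) * (a - 1) by rewrite mulr_ge0; lra.
lra.
Qed.

Lemma pw_small b t x : 1 < b -> 0 < t -> 0 < x -> exists j : nat, pw b t (-
  j%:Z) < x.
Proof.
move=> b1 t0 x0; have [j xj] := pw_unbounded x^-1 b1 t0.
exists j; rewrite pwN -[X in _ < X]invrK ltf_pV2// posrE ?invr_gt0//.
by rewrite pw_gt0// (lt_trans ltr01).
Qed.

(** Picks the last generation at which an average is large, and the highest level whose layer is
    nonempty. *)
Lemma int_max_exists (P : int -> Prop) j0 K :
  P j0 -> (forall j, P j -> j <= K) ->
  exists2 j, P j & forall i, P i -> i <= j.
Proof.
move=> Pj0 PK.
have exm : exists m : nat, `[< P (K - m%:Z) >].
  exists `|K - j0|%N; apply/asboolP.
  have := PK _ Pj0 => h.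
  by have -> : K - `|K - j0|%N%:Z = j0 by lia.
exists (K - (ex_minn exm)%:Z).
  by case: ex_minnP => m /asboolP.
case: ex_minnP => m /asboolP Pm mmin i Pi.
have iK := PK _ Pi.
have : (m <= `|K - i|)%N.
  apply: mmin; apply/asboolP.
  by have -> : K - `|K - i|%N%:Z = i by lia.
lia.
Qed.

(* The level of a positive number; the bounds are strict on the left to match
   the superlevel sets [x > b^(tk)]. *)
Lemma pw_level b t x : 1 < b -> 0 < t -> 0 < x ->
  exists j, pw b t j < x <= pw b t (j + 1).
Proof.
move=> b1 t0 x0.
have [i ix] := pw_small b1 t0 x0; have [K xK] := pw_unbounded x b1 t0.
have [|j jx jmax] := @int_max_exists (fun j => pw b t j < x) _ K ix.
  move=> j jx; rewrite leNgt; apply/negP => Kj.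
  have := ltr_pw b1 t0 Kj; lra.
exists j; rewrite jx/= leNgt; apply/negP => /jmax; lia.
Qed.

End int_powers.

Section zsum.
Context {R : realType}.
Local Open Scope ereal_scope.
Implicit Types (F G : int -> \bar R).

(** An unordered sum, so that indices can be shifted, reflected and exchanged freely; [zsumE] turns
    it into a series for the results on limits. *)
Definition zsum F : \bar R := \esum_(j in [set: int]) F j.

Lemma zsum_ge0 F : (forall j, 0 <= F j) -> 0 <= zsum F.
Proof. by move=> F0; apply: esum_ge0. Qed.

Lemma le_zsum F G : (forall j, F j <= G j) -> zsum F <= zsum G.
Proof. by move=> FG; apply: le_esum. Qed.

Lemma eq_zsum F G : (forall j, F j = G j) -> zsum F = zsum G.
Proof. by move=> FG; apply: eq_esum. Qed.

Lemma zsumD F G : (forall j, 0 <= F j) -> (forall j, 0 <= G j) ->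
  zsum (fun j => F j + G j) = zsum F + zsum G.
Proof. by move=> F0 G0; apply: esumD. Qed.

Lemma zsum_ge F j : (forall j, 0 <= F j) -> F j <= zsum F.
Proof.
move=> F0; apply: esum_ge; exists [set j]; last by rewrite fsbig_set1.
by split.
Qed.

Definition int_of_nat (n : nat) : int := if odd n then Negz n./2 else Posz n./2.

Lemma int_of_nat_bij : set_bij [set: nat] [set: int] int_of_nat.
Proof.
split => //.
  move=> m n _ _; rewrite /int_of_nat => e.
  rewrite -(odd_double_half m) -(odd_double_half n).
  by move: e; do 2 case: odd => //=; case=> ->.
case=> n _.
  by exists n.*2 => //; rewrite /int_of_nat odd_double doubleK.
exists n.*2.+1 => //.
by rewrite /int_of_nat /= odd_double/= uphalf_double.
Qed.

Lemma zsumE F : (forall j, 0 <= F j) ->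
  zsum F = \sum_(n <oo) F (int_of_nat n).
Proof.
move=> F0; rewrite nneseries_esumT//.
exact: reindex_esum int_of_nat_bij.
Qed.

(** The factor may be +oo; both sides are then 0 or +oo, according to whether all terms vanish. *)
Lemma zsumZl F (c : \bar R) : 0 <= c -> (forall j, 0 <= F j) ->
  zsum (fun j => c * F j) = c * zsum F.
Proof.
move=> c0 F0; case: c c0 => [c||]// c0.
  rewrite !zsumE//; last by move=> j; rewrite mule_ge0.
  by rewrite nneseriesZl.
have [F00|/existsNP[j /eqP Fj0]] := pselect (forall j, F j = 0).
  rewrite /zsum [in RHS]esum1// mule0 esum1// => j _.
  by rewrite F00 mule0.
have Fj : 0 < F j by rewrite lt0e Fj0 F0.
rewrite [RHS]gt0_mulye; last exact: lt_le_trans Fj (zsum_ge _ _).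
apply/eqP; rewrite -leye_eq.
apply: le_trans (@zsum_ge (fun j => +oo * F j) j _); first by rewrite gt0_mulye.
by move=> i; rewrite mule_ge0.
Qed.

Lemma zsum_zsum (F : int -> int -> \bar R) : (forall i j, 0 <= F i j) ->
  zsum (fun i => zsum (F i)) = zsum (fun j => zsum (fun i => F i j)).
Proof.
move=> F0; rewrite zsumE; last by move=> i; exact: zsum_ge0.
rewrite (eq_eseriesr (g := fun i => \sum_(k <oo) F (int_of_nat i) (int_of_nat
  k))); last first.
  by move=> i _; rewrite zsumE.
rewrite nneseries_interchange//.
rewrite [RHS]zsumE; last by move=> i; exact: zsum_ge0.
by apply: eq_eseriesr => k _; rewrite zsumE.
Qed.

Lemma zsum_reindex F (e e' : int -> int) : cancel e e' -> cancel e' e ->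
  zsum F = zsum (F \o e).
Proof.
move=> ee' e'e; apply: reindex_esum; split => //.
  by move=> i j _ _; exact: can_inj ee' _ _.
by move=> j _; exists (e' j).
Qed.

Lemma zsum_shift F m : zsum F = zsum (fun j => F (j + m)%R).
Proof.
by apply: (@zsum_reindex F (fun j => j + m)%R (fun j => j - m)%R) => j;
  rewrite /=; ring.
Qed.

Lemma zsum_opp F : zsum F = zsum (fun j => F (- j)%R).
Proof. by apply: (@zsum_reindex F (fun j => - j)%R (fun j => - j)%R) => j;
  rewrite opprK. Qed.

Lemma zsum_ub F B : (forall j, 0 <= F j) ->
  (forall K, zsum (fun j => if (j <= K)%R then F j else 0) <= B) -> zsum F <= B.
Proof.
move=> F0 FB; apply: ge_ereal_sup => _ [X [finX _] <-].
(* The sum of the absolute values bounds every element of the finite index set. *)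
pose K := (\sum_(j <- finmap.enum_fset (fset_set X)) `|j|%N)%N.
apply: le_trans (FB K%:Z); apply: esum_ge; exists X => //.
rewrite !fsbig_finite//=.
rewrite big_seq_cond [leRHS]big_seq_cond lee_sum// => j.
rewrite andbT => jX.
have -> : (j <= K%:Z)%R; last by [].
have : (`|j| <= K)%N; last by lia.
by rewrite /K (big_rem j)//= leq_addr.
Qed.

Lemma zsum_ub_ge F B : (forall j, 0 <= F j) ->
  (forall K, zsum (fun j => if (K <= j)%R then F j else 0) <= B) -> zsum F <= B.
Proof.
move=> F0 FB; rewrite zsum_opp; apply: zsum_ub => // K.
apply: le_trans (FB (- K)%R); rewrite [leRHS]zsum_opp; apply: le_zsum => j.
by have -> : (j <= K)%R = (- K <= - j)%R by lia.
Qed.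

Lemma zsum_leE F K : (forall j, 0 <= F j) ->
  zsum (fun j => if (j <= K)%R then F j else 0) = \sum_(m <oo) F (K - m%:Z)%R.
Proof.
move=> F0; rewrite nneseries_esumT// /zsum.
have -> : \esum_(i in [set: nat]) F (K - i%:Z)%R =
    \esum_(j in (fun i : nat => (K - i%:Z)%R) @` [set: nat]) F j.
  by rewrite esum_image// => i j _ _; lia.
rewrite [RHS]esum_mkcond; apply: eq_esum => j _.
case: ifPn => jK; case: ifPn => //; rewrite ?inE ?notin_setE.
  by move=> /(_ _)[]; exists `|K - j|%N => //=; lia.
by move=> [i _ ij]; lia.
Qed.

End zsum.

Section geometric.
Context {R : realType}.
Local Open Scope ereal_scope.
Implicit Types (b t : R) (F : int -> \bar R).

Definition geo b t : R := ((1 - b `^ (- t))^-1)%R.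

Lemma geo_gt0 b t : (1 < b)%R -> (0 < t)%R -> (0 < geo b t)%R.
Proof.
move=> b1 t0; rewrite invr_gt0 subr_gt0 powRN invf_lt1 ?powR_gt1//.
by rewrite (lt_trans ltr01) ?powR_gt1.
Qed.

Lemma zsum_geo_le b t K : (1 < b)%R -> (0 < t)%R ->
  zsum (fun j => if (j <= K)%R then (pw b t j)%:E else 0) <=
  (geo b t * pw b t K)%:E.
Proof.
move=> b1 t0; have b0 : (0 < b)%R by rewrite (lt_trans ltr01).
rewrite zsum_leE; last by move=> j; rewrite lee_fin pw_ge0.
apply: lime_le; first by apply: is_cvg_nneseries => n _ _;
  rewrite lee_fin pw_ge0.
apply: nearW => n; rewrite sumEFin lee_fin.
have rE m : pw b t (K - m%:Z) = (pw b t K * (b `^ (- t)) ^+ m)%R.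
  rewrite pwB// powRN; congr (_ * _)%R.
  by rewrite !pwE exprVn -powR_mulrn ?powR_ge0// -powRrM.
under eq_bigr do rewrite rE.
have r0 : (0 < b `^ (- t))%R by rewrite powR_gt0.
rewrite mulrC; apply: geometric_le_lim => //; first exact: pw_ge0.
by rewrite gtr0_norm// powRN invf_lt1 ?powR_gt1// (lt_trans ltr01) ?powR_gt1.
Qed.

Lemma zsum_geo_ge b t K : (1 < b)%R -> (0 < t)%R ->
  zsum (fun j => if (K <= j)%R then (pw b (- t) j)%:E else 0) <=
  (geo b t * pw b (- t) K)%:E.
Proof.
move=> b1 t0; rewrite zsum_opp.
rewrite (_ : pw b (- t) K = pw b t (- K)); last by rewrite pwN pwNt.
apply: le_trans (zsum_geo_le _ b1 t0).
apply: le_zsum => j; have -> : (K <= - j)%R = (j <= - K)%R by lia.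
by case: ifP => // _; rewrite pwN pwNt invrK.
Qed.

Lemma le_zsum_geo_le F (c : \bar R) b t K : (1 < b)%R -> (0 < t)%R ->
  0 <= c -> (forall j, (j <= K)%R -> F j <= c * (pw b t j)%:E) ->
  zsum (fun j => if (j <= K)%R then F j else 0) <= c * (geo b t * pw b t K)%:E.
Proof.
move=> b1 t0 c0 Fc; apply: le_trans (lee_wpmul2l c0 (zsum_geo_le K b1 t0)).
rewrite -zsumZl//; last by move=> j; case: ifP; rewrite ?lee_fin ?pw_ge0.
by apply: le_zsum => j; case: ifPn => [/Fc//|_]; rewrite mule0.
Qed.

Lemma le_zsum_geo_ge F (c : \bar R) b t K : (1 < b)%R -> (0 < t)%R ->
  0 <= c -> (forall j, (K <= j)%R -> F j <= c * (pw b (- t) j)%:E) ->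
  zsum (fun j => if (K <= j)%R then F j else 0) <=
  c * (geo b t * pw b (- t) K)%:E.
Proof.
move=> b1 t0 c0 Fc; apply: le_trans (lee_wpmul2l c0 (zsum_geo_ge K b1 t0)).
rewrite -zsumZl//; last by move=> j; case: ifP; rewrite ?lee_fin ?pw_ge0.
by apply: le_zsum => j; case: ifPn => [/Fc//|_]; rewrite mule0.
Qed.

End geometric.

Section zsum_integral.
Local Open Scope ereal_scope.
Context d (T : measurableType d) {R : realType} (mu : {measure set T -> \bar
  R}).

Lemma emeasurable_fun_zsum (F : int -> T -> \bar R) :
  (forall j, measurable_fun setT (F j)) -> (forall j x, 0 <= F j x) ->
  measurable_fun setT (fun x => zsum (F ^~ x)).
Proof.
move=> mF F0.
rewrite (_ : (fun x => _) = fun x => \sum_(n <oo) F (int_of_nat n) x).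
  exact: ge0_emeasurable_sum.
by apply/funext => x; rewrite zsumE.
Qed.

Lemma integral_zsum (D : set T) (F : int -> T -> \bar R) : measurable D ->
  (forall j, measurable_fun setT (F j)) -> (forall j x, 0 <= F j x) ->
  \int[mu]_(x in D) zsum (F ^~ x) = zsum (fun j => \int[mu]_(x in D) F j x).
Proof.
move=> mD mF F0; rewrite [RHS]zsumE; last by move=> j; exact: integral_ge0.
rewrite -integral_nneseries//; last first.
  by move=> n; exact: measurable_funS (mF _).
by apply: eq_integral => x _; rewrite zsumE.
Qed.

End zsum_integral.

(** * Powers of extended reals and their dyadic levels *)

Section ereal_powers.
Context {R : realType}.
Local Open Scope ereal_scope.
Implicit Types (x y : \bar R) (r p b : R) (k : int).

Lemma le_poweR r x y : (0 <= r)%R -> 0 <= x -> x <= y -> x `^ r <= y `^ r.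
Proof.
move=> r0 x0 xy; apply: gt0_ler_poweR => //.
  by rewrite in_itv/= x0 leey.
by rewrite in_itv/= (le_trans x0 xy) leey.
Qed.

Lemma poweRK r x : r != 0%R -> 0 <= x -> (x `^ r) `^ r^-1 = x.
Proof. by move=> r0 x0; rewrite -poweRrM divff// poweRe1. Qed.

Lemma poweRVK r x : r != 0%R -> 0 <= x -> (x `^ r^-1) `^ r = x.
Proof. by move=> r0 x0; rewrite -poweRrM mulVf// poweRe1. Qed.

Lemma poweR_ler r x y : (0 < r)%R -> 0 <= x -> 0 <= y ->
  (x `^ r <= y `^ r) = (x <= y).
Proof.
move=> r0 x0 y0; apply/idP/idP => [|xy]; last by rewrite le_poweR// ltW.
move=> /(le_poweR (r := r^-1)); rewrite !poweRK ?gt_eqF//; apply.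
  by rewrite invr_ge0 ltW.
exact: poweR_ge0.
Qed.

Lemma poweR_pw b t k r : (pw b t k)%:E `^ r = (pw b (t * r) k)%:E.
Proof. by rewrite poweR_EFin pw_powR. Qed.

Lemma poweRDp x r p : (0 < r)%R -> (0 < p)%R ->
  x `^ (r + p) = x `^ r * x `^ p.
Proof.
by move=> r0 p0; apply/poweRD/add_neq0_poweRD_def; rewrite gt_eqF// addr_gt0.
Qed.

Lemma pw_ub_eqy (t : R) x : (0 < t)%R -> (forall k, (pw 2 t k)%:E <= x) -> x =
  +oo.
Proof.
move=> t0; case: x => [x||] h //.
  have [j] := @pw_unbounded _ 2 t x (ltr1n _ 2) t0.
  by have := h j; rewrite lee_fin => + /lt_le_trans => /[swap] /[apply];
    rewrite ltxx.
by have := h 0%Z; rewrite leeNy_eq.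
Qed.

Lemma ereal_level x : 0 < x -> x < +oo ->
  exists k, (pw 2 1 k)%:E < x <= (pw 2 1 (k + 1))%:E.
Proof.
case: x => [x||]//; rewrite lte_fin => x0 _.
have [k] := @pw_level _ 2 1 x (ltr1n _ 2) ltr01 x0.
by exists k; rewrite lte_fin lee_fin.
Qed.

(** The single level with 2^k < x <= 2^(k+1) suffices; for x = +oo every level is present and the
    terms are unbounded. *)
Lemma poweR_le_zsum x p : (0 < p)%R -> 0 <= x ->
  x `^ p <= zsum (fun k => if (pw 2 1 k)%:E < x then (pw 2 p (k + 1))%:E else
    0).
Proof.
move=> p0 x0.
have F0 k : 0 <= (if (pw 2 1 k)%:E < x then (pw 2 p (k + 1))%:E else 0).
  by case: ifP; rewrite ?lee_fin ?pw_ge0.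
have [->|xN0] := eqVneq x 0; first by rewrite poweR0r ?gt_eqF//;
  apply: zsum_ge0 => k; rewrite lte_fin ltNge pw_ge0.
have {}x0 : 0 < x by rewrite lt0e xN0.
have [xy|xy] := eqVneq x +oo.
  rewrite {1}xy poweRyr ?gt_eqF// leye_eq; apply/eqP.
  apply: (pw_ub_eqy p0) => k.
  apply: le_trans (zsum_ge (k - 1) F0).
  by rewrite xy ltry subrK.
have [|k /andP[kx xk]] := ereal_level x0; first by rewrite ltey.
apply: le_trans (zsum_ge k F0); rewrite kx.
apply: le_trans (le_poweR (ltW p0) (ltW x0) xk) _.
by rewrite poweR_pw mul1r.
Qed.

(** The levels below x form a geometric sum dominated by the largest one. *)
Lemma zsum_le_poweR x p : (0 < p)%R -> 0 <= x ->
  zsum (fun k => if (pw 2 1 k)%:E < x then (pw 2 p k)%:E else 0) <=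
  (geo 2 p)%:E * x `^ p.
Proof.
move=> p0 x0; have g0 : (0 < geo 2 p)%R by rewrite geo_gt0// ltr1n.
have [->|xN0] := eqVneq x 0.
  rewrite poweR0r ?gt_eqF// mule0 /zsum esum1// => k _.
  by rewrite lte_fin ltNge pw_ge0.
have {}x0 : 0 < x by rewrite lt0e xN0.
have [->|xy] := eqVneq x +oo.
  by rewrite poweRyr ?gt_eqF// gt0_muley ?leey// lte_fin.
have [|j /andP[jx xj]] := ereal_level x0; first by rewrite ltey.
apply: (@le_trans _ _ (geo 2 p * pw 2 p j)%:E); last first.
  rewrite EFinM lee_wpmul2l ?lee_fin ?(ltW g0)//.
  apply: le_trans (le_poweR (ltW p0) _ (ltW jx));
    last by rewrite lee_fin pw_ge0.
  by rewrite poweR_pw mul1r.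
apply: le_trans (zsum_geo_le j (ltr1n _ 2) p0); apply: le_zsum => k.
case: ifPn => kx; last by case: ifP; rewrite ?lee_fin ?pw_ge0.
rewrite ifT// leNgt; apply/negP => jk.
have := lt_le_trans kx xj; rewrite lte_fin ltNge => /negP; apply.
by rewrite ler_pw ?ler1n//; lia.
Qed.

Lemma zsum_unique (F : int -> \bar R) j :
  0 <= F j -> (forall i, i <> j -> F i = 0) -> zsum F = F j.
Proof.
move=> F0 Fj; rewrite -[RHS](@esum_set1 _ _ j F)// esum_mkcond.
apply: eq_esum => i _; case: ifPn => //.
by rewrite notin_setE/= => /Fj.
Qed.

End ereal_powers.

(** * Nonnegative integrals and Tonelli's theorem over a symmetric relation *)

Section nonneg_integrals.
Local Open Scope ereal_scope.
Context d (T : measurableType d) {R : realType} (mu : {measure set T -> \bar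
  R}).
Implicit Types (f g : T -> \bar R) (A B : set T).

Lemma integral_indicE A f :
  \int[mu]_(x in A) f x = \int[mu]_x ((\1_A x)%:E * f x).
Proof.
rewrite integral_mkcond; apply: eq_integral => x _.
by rewrite patchE indicE; case: (x \in A); rewrite ?mul1e ?mul0e.
Qed.

Lemma measurable_set_gt f c : measurable_fun setT f -> measurable [set x | c < f
  x].
Proof.
by move=> mf; rewrite -[X in measurable X]setTI; exact: emeasurable_fun_o_infty.
Qed.

Lemma measurable_set_ge f c : measurable_fun setT f -> measurable [set x | c <=
  f x].
Proof.
by move=> mf; rewrite -[X in measurable X]setTI; exact: emeasurable_fun_c_infty.
Qed.

Lemma measurable_set_le f c : measurable_fun setT f -> measurable [set x | f x
  <= c].
Proof.
by move=> mf; rewrite -[X in measurable X]setTI; exact: emeasurable_fun_infty_c.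
Qed.

Lemma measurable_fun_gtP f :
  (forall c : R, measurable [set x | c%:E < f x]) -> measurable_fun setT f.
Proof.
move=> mf; apply: (measurability _ (ErealGenOInfty.measurableE R)).
by move=> _ [_ [c ->] <-]; rewrite setTI preimage_itvoy.
Qed.

Lemma measurable_indic_mule A f : measurable A -> measurable_fun setT f ->
  measurable_fun setT (fun x => (\1_A x)%:E * f x).
Proof.
move=> mA mf; apply: emeasurable_funM => //.
exact/measurable_EFinP/measurable_indic.
Qed.

Lemma le_integral f g : (forall x, 0 <= f x) -> (forall x, f x <= g x) ->
  measurable_fun setT f -> measurable_fun setT g ->
  \int[mu]_x f x <= \int[mu]_x g x.
Proof. by move=> f0 fg mf mg; apply: ge0_le_integral. Qed.

Lemma markov_ge f (c : R) : measurable_fun setT f -> (forall x, 0 <= f x) ->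
  (0 <= c)%R -> c%:E * mu [set x | c%:E <= f x] <= \int[mu]_x f x.
Proof.
move=> mf f0 c0; have mA : measurable [set x | c%:E <= f x] by exact:
  measurable_set_ge.
rewrite -(setIT [set x | _]) -integral_indic// -ge0_integralZl//.
- apply: le_integral => //.
  + by move=> x; rewrite mule_ge0 ?lee_fin.
  + move=> x; rewrite indicE; case: (boolP (x \in _)) => [|_].
      by rewrite inE/= mule1.
    by rewrite mule0.
  + exact/measurable_funeM/measurable_EFinP/measurable_indic.
- exact/measurable_EFinP/measurable_indic.
Qed.

Lemma ereal_sup_int (F : int -> \bar R) c :
  (c < ereal_sup (range F)) <-> exists j, c < F j.
Proof.
split=> [/ereal_sup_gt[_ [j _ <-] cF]|[j cF]]; first by exists j.
by apply: lt_le_trans cF _; apply: ereal_sup_ubound; exists j.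
Qed.

Lemma measurable_ereal_sup_int (F : int -> T -> \bar R) :
  (forall j, measurable_fun setT (F j)) ->
  measurable_fun setT (fun x => ereal_sup (range (F ^~ x))).
Proof.
move=> mF; apply: measurable_fun_gtP => c.
rewrite (_ : [set x | _] = \bigcup_j [set x | c%:E < F j x]).
  apply: countable_bigcupT_measurable; first exact: countableP.
  by move=> j; exact: measurable_set_gt.
apply/seteqP; split => x /=.
  by move=> /ereal_sup_int[j]; exists j.
by move=> [j _ ?]; apply/ereal_sup_int; exists j.
Qed.

End nonneg_integrals.

Section symmetric_relation.
Local Open Scope ereal_scope.
Context d (T : measurableType d) {R : realType}
  (mu : {sigma_finite_measure set T -> \bar R}).
Variable E : T -> set T.
Hypothesis mE : measurable [set xy : T * T | E xy.1 xy.2].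
Hypothesis symE : forall x y, E x y -> E y x.
Implicit Types (f g : T -> \bar R).

Lemma measurable_rel x : measurable (E x).
Proof.
have := measurable_xsection x mE.
by congr measurable; apply/seteqP; split => y; rewrite /xsection/= inE.
Qed.

Let indE x y : \1_[set xy : T * T | E xy.1 xy.2] (x, y) = \1_(E x) y :> R.
Proof. by rewrite !indicE; congr (nat_of_bool _)%:R; apply/idP/idP;
  rewrite !inE. Qed.

Let indC x y : \1_(E x) y = \1_(E y) x :> R.
Proof.
rewrite !indicE; congr (nat_of_bool _)%:R.
by apply/idP/idP; rewrite !inE; exact: symE.
Qed.

Let measurable_kernel f : measurable_fun setT f ->
  measurable_fun setT
    (fun xy : T * T => (\1_[set xy : T * T | E xy.1 xy.2] xy)%:E * f xy.2).
Proof.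
move=> mf; apply: emeasurable_funM; last exact: measurableT_comp.
exact/measurable_EFinP/measurable_indic.
Qed.

Lemma measurable_fun_integral_rel f : measurable_fun setT f ->
  (forall x, 0 <= f x) ->
  measurable_fun setT (fun x => \int[mu]_(y in E x) f y).
Proof.
move=> mf f0.
have := measurable_fun_fubini_tonelli_F (m2 := mu) _ (measurable_kernel mf).
rewrite /fubini_F /= => /(_ _)/=.
have h0 : forall x : T * T, 0 <= (\1_[set xy : T * T | E xy.1 xy.2] x)%:E * f
  x.2.
  by move=> x; rewrite mule_ge0// lee_fin.
move=> /(_ h0); congr measurable_fun; apply/funext => x.
rewrite /fubini_F [RHS]integral_indicE; apply: eq_integral => y _ /=.
by rewrite indE.
Qed.

(** Tonelli for the kernel given by the indicator of the relation, which symmetry makes invariant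
    under exchange of the variables. *)
Lemma integral_rel_sym f g : measurable_fun setT f -> measurable_fun setT g ->
  (forall x, 0 <= f x) -> (forall x, 0 <= g x) ->
  \int[mu]_x (g x * \int[mu]_(y in E x) f y) =
  \int[mu]_y (f y * \int[mu]_(x in E y) g x).
Proof.
move=> mf mg f0 g0.
pose h (xy : T * T) :=
  g xy.1 * ((\1_[set xy : T * T | E xy.1 xy.2] xy)%:E * f xy.2).
have mh : measurable_fun setT h.
  apply: emeasurable_funM; first exact: measurableT_comp.
  exact: measurable_kernel.
have h0 xy : 0 <= h xy by rewrite !mule_ge0// lee_fin.
transitivity (\int[mu]_x \int[mu]_y h (x, y)).
  apply: eq_integral => x _; rewrite [in LHS]integral_indicE -ge0_integralZl//.
  - exact/measurable_indic_mule/mf/measurable_rel.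
  - by move=> y _; rewrite mule_ge0// lee_fin.
rewrite fubini_tonelli//.
apply: eq_integral => y _; rewrite [in RHS]integral_indicE -ge0_integralZl//.
- apply: eq_integral => x _; rewrite /h indE indC.
  by rewrite muleCA [RHS]muleCA; congr (_ * _); rewrite muleC.
- exact/measurable_indic_mule/mg/measurable_rel.
- by move=> x _; rewrite mule_ge0// lee_fin.
Qed.

End symmetric_relation.

(** * Dyadic averages, potentials and maximal functions *)

(* [same j x] is the cell of generation [j] that contains [x] (side [2^j],
   measure [V^j] with [V = 2^n]) and [near j x] is the union of that cell and
   its neighbours. *)
Record dyadic_grid d (T : measurableType d) (R : realType)
    (mu : set T -> \bar R) (V K : R) (same near : int -> T -> set T) : Prop := {
  grid_V : 1 < V ;
  grid_K : 1 <= K ;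
  measurable_same_rel : forall j, measurable [set xy : T * T | same j xy.1 xy.2]
    ;
  measurable_near_rel : forall j, measurable [set xy : T * T | near j xy.1 xy.2]
    ;
  same_refl : forall j x, same j x x ;
  same_sym : forall j x y, same j x y -> same j y x ;
  same_trans : forall j x y z, same j x y -> same j y z -> same j x z ;
  same_up : forall i j x y, i <= j -> same i x y -> same j x y ;
  near_sym : forall j x y, near j x y -> near j y x ;
  same_near : forall j x y, same j x y -> near j x y ;
  near_same : forall j x y z, near j x y -> same j y z -> near j x z ;
  near_comp : forall j x y z, near j x y -> near j y z -> near (j + 1) x z ;
  mu_same : forall j x, mu (same j x) = (pw V 1 j)%:E ;
  mu_near : forall j x, (mu (near j x) <= (K * pw V 1 j)%:E)%E }.

Section averages.
Local Open Scope ereal_scope.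
Context d (T : measurableType d) (R : realType)
  (mu : {sigma_finite_measure set T -> \bar R}) (V K : R)
  (same near : int -> T -> set T) (G : dyadic_grid mu V K same near).
Implicit Types (f g : T -> \bar R) (i j : int) (a : R).

Lemma grid_V0 : (0 < V)%R. Proof. exact: lt_trans ltr01 (grid_V G). Qed.

Lemma grid_K0 : (0 < K)%R. Proof. exact: lt_le_trans ltr01 (grid_K G). Qed.

Let V0 := grid_V0.
Let V1 := ltW (grid_V G).
Let K0 := grid_K0.

Lemma near_refl j x : near j x x.
Proof. exact/(same_near G)/(same_refl G). Qed.

Lemma near_up i j x y : (i <= j)%R -> near i x y -> near j x y.
Proof.
move=> ij xy; have -> : j = (i + `|j - i|%N%:Z)%R by lia.
elim: `|j - i|%N => [|n IH]; first by rewrite addr0.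
have -> : (i + n.+1%:Z = i + n%:Z + 1)%R by lia.
exact: (near_comp G IH (near_refl _ _)).
Qed.

Lemma same_nearE j x y : same j x y -> near j x = near j y.
Proof.
have h u v : same j u v -> near j u `<=` near j v.
  by move=> uv z uz; apply/(near_sym G); exact: near_same G _ _ _ _ (near_sym G
    uz) uv.
by move=> xy; apply/seteqP; split; apply: h => //; exact: (same_sym G).
Qed.

Lemma same_sameE j x y : same j x y -> same j x = same j y.
Proof.
by move=> xy; apply/seteqP; split => z;
  apply: (same_trans G) => //; exact: (same_sym G).
Qed.

Lemma measurable_near j x : measurable (near j x).
Proof. exact: measurable_rel (measurable_near_rel G j) x. Qed.

Lemma measurable_same j x : measurable (same j x).
Proof. exact: measurable_rel (measurable_same_rel G j) x. Qed.

(** Normalised by the measure of one cell rather than by that of the union [near j x], whence the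
    factor K in upper bounds. *)
Definition avg j f x : \bar R :=
  (pw V (-1) j)%:E * \int[mu]_(y in near j x) f y.

Definition cavg j f x : \bar R :=
  (pw V (-1) j)%:E * \int[mu]_(y in same j x) f y.

Definition maxf f x : \bar R := ereal_sup (range (fun j => avg j f x)).

Definition pot a f x : \bar R := zsum (fun j => (pw V a j)%:E * avg j f x).

Section nonneg.
Variable f : T -> \bar R.
Hypothesis (mf : measurable_fun setT f) (f0 : forall x, 0 <= f x).

Lemma avg_ge0 j x : 0 <= avg j f x.
Proof. by rewrite mule_ge0 ?lee_fin ?pw_ge0// integral_ge0. Qed.

Lemma cavg_ge0 j x : 0 <= cavg j f x.
Proof. by rewrite mule_ge0 ?lee_fin ?pw_ge0// integral_ge0. Qed.

Lemma maxf_ge0 x : 0 <= maxf f x.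
Proof.
by apply: le_trans (avg_ge0 0%Z x) _; apply: ereal_sup_ubound; exists 0%Z.
Qed.

Lemma avg_le_maxf j x : avg j f x <= maxf f x.
Proof. by apply: ereal_sup_ubound; exists j. Qed.

Lemma pot_ge0 a x : 0 <= pot a f x.
Proof. by apply: zsum_ge0 => j; rewrite mule_ge0 ?lee_fin ?pw_ge0 ?avg_ge0. Qed.

Lemma measurable_avg j : measurable_fun setT (avg j f).
Proof.
apply: measurable_funeM; apply: measurable_fun_integral_rel => //.
exact: measurable_near_rel G j.
Qed.

Lemma measurable_cavg j : measurable_fun setT (cavg j f).
Proof.
apply: measurable_funeM; apply: measurable_fun_integral_rel => //.
exact: measurable_same_rel G j.
Qed.

Lemma measurable_maxf : measurable_fun setT (maxf f).
Proof. by apply: measurable_ereal_sup_int => j; exact: measurable_avg. Qed.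

Lemma measurable_pot a : measurable_fun setT (pot a f).
Proof.
apply: emeasurable_fun_zsum => j; first exact/measurable_funeM/measurable_avg.
by move=> x; rewrite mule_ge0 ?lee_fin ?pw_ge0 ?avg_ge0.
Qed.

Lemma avg_same j x y : same j x y -> avg j f x = avg j f y.
Proof. by move=> /same_nearE xy; rewrite /avg xy. Qed.

Lemma cavg_same j x y : same j x y -> cavg j f x = cavg j f y.
Proof. by move=> /same_sameE xy; rewrite /cavg xy. Qed.

(** [near_comp] puts [near j x] inside [near (j + 1) y]; V is the change of normalisation. *)
Lemma le_avg_near j x y : near j x y -> avg j f x <= V%:E * avg (j + 1) f y.
Proof.
move=> xy; rewrite /avg muleA -EFinM pwS// powRN powRr1 ?(ltW V0)//.
rewrite mulrCA divff ?gt_eqF// mulr1.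
rewrite lee_wpmul2l ?lee_fin ?pw_ge0//.
apply: ge0_subset_integral => //; try exact: measurable_near.
  exact: measurable_funS mf.
by move=> z xz; exact: near_comp G _ _ _ _ (near_sym G xy) xz.
Qed.

(** The cell of generation i around y lies in [near j x], and its measure is the fraction V^(i-j) of
    that of a cell of generation j. *)
Lemma avg_ge_subcell i j x y (c : \bar R) : (i <= j)%R -> near j x y -> 0 <= c
  ->
  (forall z, same i y z -> c <= f z) -> c * (pw V 1 (i - j))%:E <= avg j f x.
Proof.
move=> ij xy c0 cf.
have -> : c * (pw V 1 (i - j))%:E =
    (pw V (-1) j)%:E * \int[mu]_(z in same i y) c.
  rewrite integral_cst; last exact: measurable_same.
  rewrite [X in _ * (_ * X)](mu_same G).
  by rewrite muleCA -EFinM pwB// mulrC -pwNt.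
rewrite lee_wpmul2l ?lee_fin ?pw_ge0//.
apply: le_trans (_ : \int[mu]_(z in same i y) f z <= _).
  apply: ge0_le_integral => //; first exact: measurable_same.
  exact: measurable_funS mf.
apply: ge0_subset_integral => //.
- exact: measurable_same.
- exact: measurable_near.
- exact: measurable_funS mf.
- by move=> z yz; apply: near_same G _ _ _ _ xy _;
    exact: same_up G _ _ _ _ ij yz.
Qed.

Lemma avg_ge_cell j x (c : \bar R) : 0 <= c -> (forall y, same j x y -> c <= f
  y) ->
  c <= avg j f x.
Proof.
move=> c0 cf; rewrite -[leLHS]mule1 -(pw0 V 1) -(subrr j).
by apply: (@avg_ge_subcell _ _ _ x) => //; exact: near_refl.
Qed.

Lemma avg_le_const j x (c : R) : (0 <= c)%R ->
  (forall y, near j x y -> f y <= c%:E) -> avg j f x <= (K * c)%:E.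
Proof.
move=> c0 fc.
apply: le_trans (_ : (pw V (-1) j)%:E * \int[mu]_(y in near j x) c%:E <= _).
  rewrite lee_wpmul2l ?lee_fin ?pw_ge0//.
  apply: ge0_le_integral => //; first exact: measurable_near.
  exact: measurable_funS mf.
rewrite integral_cst; last exact: measurable_near.
apply: le_trans (_ : (pw V (-1) j)%:E * (c%:E * (K * pw V 1 j)%:E) <= _).
  by rewrite !lee_wpmul2l ?lee_fin ?pw_ge0// (mu_near G).
rewrite -!EFinM lee_fin pwNt [leLHS](_ : _ = (K * c * ((pw V 1 j)^-1 * pw V 1
  j))%R).
  by rewrite mulVf ?mulr1// pw_neq0.
by ring.
Qed.

End nonneg.

Lemma le_avg f g j x : measurable_fun setT f -> measurable_fun setT g ->
  (forall y, 0 <= f y) -> (forall y, near j x y -> f y <= g y) ->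
  avg j f x <= avg j g x.
Proof.
move=> mf mg f0 fg; rewrite lee_wpmul2l ?lee_fin ?pw_ge0//.
apply: ge0_le_integral => //.
- exact: measurable_near.
- exact: measurable_funS mf.
- exact: measurable_funS mg.
Qed.

Lemma avgD f g j x : measurable_fun setT f -> measurable_fun setT g ->
  (forall y, 0 <= f y) -> (forall y, 0 <= g y) ->
  avg j (fun y => f y + g y) x = avg j f x + avg j g x.
Proof.
move=> mf mg f0 g0; rewrite /avg ge0_integralD//.
- by rewrite ge0_muleDr// integral_ge0.
- exact: measurable_near.
- exact: measurable_funS mf.
- exact: measurable_funS mg.
Qed.

Lemma avgZl (c : R) f j x : measurable_fun setT f -> (forall y, 0 <= f y) ->
  (0 <= c)%R -> avg j (fun y => c%:E * f y) x = c%:E * avg j f x.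
Proof.
move=> mf f0 c0; rewrite /avg ge0_integralZl//.
- by rewrite muleCA.
- exact: measurable_near.
- exact: measurable_funS mf.
Qed.

Lemma le_pot a f g x : measurable_fun setT f -> measurable_fun setT g ->
  (forall y, 0 <= f y) -> (forall y, f y <= g y) -> pot a f x <= pot a g x.
Proof.
move=> mf mg f0 fg; apply: le_zsum => j.
by rewrite lee_wpmul2l ?lee_fin ?pw_ge0// le_avg.
Qed.

Lemma potZl a (c : R) f x : measurable_fun setT f -> (forall y, 0 <= f y) ->
  (0 <= c)%R -> pot a (fun y => c%:E * f y) x = c%:E * pot a f x.
Proof.
move=> mf f0 c0; rewrite -zsumZl ?lee_fin//.
  by apply: eq_zsum => j; rewrite avgZl// muleCA.
by move=> j; rewrite mule_ge0 ?lee_fin ?pw_ge0 ?avg_ge0.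
Qed.

Lemma pot_ge_level a f j x : (forall y, 0 <= f y) ->
  (pw V a j)%:E * avg j f x <= pot a f x.
Proof.
move=> f0; apply: (zsum_ge (F := fun j => (pw V a j)%:E * avg j f x)) => i.
by rewrite mule_ge0 ?lee_fin ?pw_ge0 ?avg_ge0.
Qed.

Section weak_type.
Variable f : T -> \bar R.
Hypothesis (mf : measurable_fun setT f) (f0 : forall x, 0 <= f x).

(** [cavg j f] is the conditional expectation of f on the cells of generation j. Tonelli replaces an
    enumeration of the cells. *)
Lemma integral_cavg j (S : set T) : measurable S ->
  (forall x y, S x -> same j x y -> S y) ->
  \int[mu]_(x in S) cavg j f x = \int[mu]_(x in S) f x.
Proof.
move=> mS satS.
have mI : measurable_fun setT (EFin \o \1_S : T -> \bar R).
  exact/measurable_EFinP/measurable_indic.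
have mC := measurable_fun_integral_rel mu (measurable_same_rel G j) mf f0.
have c0 x : 0 <= \int[mu]_(y in same j x) f y by exact: integral_ge0.
rewrite /cavg ge0_integralZl ?lee_fin ?pw_ge0//; last exact: measurable_funS mC.
rewrite integral_indicE.
rewrite (integral_rel_sym mu (measurable_same_rel G j) (@same_sym _ _ _ _ _ _ _
  _ G j) mf mI)//; last first.
  by move=> x; rewrite lee_fin.
rewrite -ge0_integralZl//; last 3 first.
- apply: emeasurable_funM => //.
  apply: measurable_fun_integral_rel => //; first exact: measurable_same_rel G
    j.
  by move=> x; rewrite lee_fin.
- by move=> x _; rewrite mule_ge0// integral_ge0// => y _; rewrite lee_fin.
- by rewrite lee_fin pw_ge0.
rewrite [RHS]integral_indicE; apply: eq_integral => y _.
rewrite integral_indic//; last exact: measurable_same.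
rewrite muleCA [RHS]muleC; congr (_ * _).
rewrite indicE; have [yS|yS] := boolP (y \in S).
  rewrite (_ : S `&` same j y = same j y).
    by rewrite [X in _ * X](mu_same G) -EFinM pwNt mulVf// pw_neq0.
  apply/seteqP; split => [z []//|z yz]; split => //.
  by apply: satS yz; rewrite inE in yS.
rewrite (_ : S `&` same j y = set0) ?measure0 ?mule0//.
apply/seteqP; split => // z [Sz yz]; move: yS; rewrite notin_setE; apply.
by apply: satS Sz _; exact: (same_sym G).
Qed.

(** Since [near j x] is a union of cells, f and its conditional expectation have the same average
    there; cell averages of at most c would keep it at most K c. *)
Lemma avg_gt_cavg j x (c : R) : (0 <= c)%R -> (K * c)%:E < avg j f x ->
  exists2 y, near j x y & c%:E < cavg j f y.
Proof.
move=> c0; apply: contraPP => h; apply/negP; rewrite -leNgt.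
have -> : avg j f x = avg j (cavg j f) x.
  rewrite /avg [in RHS]integral_cavg//; first exact: measurable_near.
  by move=> y z xy yz; exact: near_same G _ _ _ _ xy yz.
apply: avg_le_const => //; first exact: measurable_cavg.
  by move=> y; exact: cavg_ge0.
by move=> y xy; rewrite leNgt; apply/negP => cy; apply: h; exists y.
Qed.

(** A covering argument with the maximal cells of average above c: they are disjoint, and the set
    where [maxf f] exceeds K c is covered by their neighbourhoods. *)
Lemma maximal_weak_type (c : R) : (0 < c)%R ->
  c%:E * mu [set x | (K * c)%:E < maxf f x] <= K%:E * \int[mu]_x f x.
Proof.
move=> c0.
have K1 : 0 <= K%:E by rewrite lee_fin ltW.
have [foo|foo] := eqVneq (\int[mu]_x f x) +oo.
  by rewrite foo gt0_muley ?leey// lte_fin.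
have {foo}fI : \int[mu]_x f x < +oo by rewrite ltey.
have If0 : 0 <= \int[mu]_x f x by exact: integral_ge0.
(* The union of the cells of generation j that are last, in order of growing generation, to have
   average above c. These sets are disjoint for distinct j. *)
pose A j := [set x | c%:E < cavg j f x /\
                     forall i, (j < i)%R -> cavg i f x <= c%:E].
have mA j : measurable (A j).
  rewrite (_ : A j = [set x | c%:E < cavg j f x] `&`
      ~` (\bigcup_i (if (j < i)%R then [set x | c%:E < cavg i f x] else set0))).
    apply: measurableI; first exact/measurable_set_gt/measurable_cavg.
    apply/measurableC/countable_bigcupT_measurable; first exact: countableP.
    by move=> i; case: ifP => // _; exact/measurable_set_gt/measurable_cavg.
  apply/seteqP; split => x /= [cj ci]; split => //.
    move=> [i _]; case: ifPn => // ji /=; rewrite ltNge => /negP; apply.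
    exact: ci.
  move=> i ji; rewrite leNgt; apply/negP => h; apply: ci.
  by exists i => //; rewrite ji.
have satA j x y : A j x -> same j x y -> A j y.
  move=> [cj ci] xy; split; first by rewrite -(cavg_same f xy).
  move=> i ji; have iy : same i x y by exact: same_up G _ _ _ _ (ltW ji) xy.
  by rewrite -(cavg_same f iy); exact: ci.
(* The points with a cell of [A j] in their neighbourhood. Expressing this through the measure lets
   Markov's inequality and Tonelli give mu (B j) <= K mu (A j) without counting cells. *)
pose B j := [set x | (pw V 1 j)%:E <= \int[mu]_(y in near j x) (\1_(A j) y)%:E].
have mI j : measurable_fun setT (fun x => (\1_(A j) x)%:E : \bar R).
  exact/measurable_EFinP/measurable_indic.
have mNI j : measurable_fun setT
    (fun x => \int[mu]_(y in near j x) (\1_(A j) y)%:E).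
  by apply: measurable_fun_integral_rel => //; exact: measurable_near_rel G j.
have mB j : measurable (B j) by exact: measurable_set_ge.
have muA j : c%:E * mu (A j) <= \int[mu]_(x in A j) f x.
  rewrite -(integral_cavg (mA j) (satA j)) -integral_cst//.
  apply: ge0_le_integral => //.
  - by move=> x _; rewrite lee_fin ltW.
  - by apply: measurable_funS (measurable_cavg mf f0 j).
  - by move=> x [/ltW].
have muB j : mu (B j) <= K%:E * mu (A j).
  have Vj : (0 < pw V 1 j)%R by rewrite pw_gt0.
  rewrite -(@lee_pmul2l _ (pw V 1 j)%:E)//.
  apply: le_trans (markov_ge mu (mNI j) _ (ltW Vj)) _.
    by move=> x; apply: integral_ge0 => y _; rewrite lee_fin.
  have -> : \int[mu]_x \int[mu]_(y in near j x) (\1_(A j) y)%:E =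
      \int[mu]_y ((\1_(A j) y)%:E * mu (near j y)).
    transitivity (\int[mu]_x (1 * \int[mu]_(y in near j x) (\1_(A j) y)%:E)).
      by apply: eq_integral => x _; rewrite mul1e.
    rewrite (@integral_rel_sym _ _ _ mu (near j) (measurable_near_rel G j)
      (@near_sym _ _ _ _ _ _ _ _ G j) (fun x => (\1_(A j) x)%:E) (cst 1))//=.
    apply: eq_integral => y _; congr (_ * _).
    by rewrite integral_cst ?mul1e//; exact: measurable_near.
  apply: le_trans (_ : \int[mu]_y ((\1_(A j) y)%:E * (K * pw V 1 j)%:E) <= _).
    apply: le_integral.
    - by move=> y; rewrite mule_ge0// lee_fin.
    - by move=> y; rewrite lee_wpmul2l ?lee_fin// (mu_near G).
    - apply: emeasurable_funM => //.
      have := measurable_fun_integral_rel mu (measurable_near_rel G j)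
        (@measurable_cst _ _ T (\bar R) setT 1) (fun=> lee01).
      congr measurable_fun; apply/funext => y.
      by rewrite integral_cst ?mul1e//; exact: measurable_near.
    - exact: emeasurable_funM.
  rewrite ge0_integralZr// ?lee_fin ?mulr_ge0 ?pw_ge0 ?(ltW K0)//.
  by rewrite integral_indic// setIT muleC EFinM -muleA muleCA.
have sub : [set x | (K * c)%:E < maxf f x] `<=` \bigcup_j B j.
  move=> x /=; rewrite ereal_sup_int => -[j /(avg_gt_cavg (ltW c0))[y xy cy]].
  (* From generation N on, cell averages are below c because the integral is finite; this makes a
     last generation with average above c exist. *)
  have [N fN] : exists N : nat, (pw V (-1) N)%:E * \int[mu]_x f x < c%:E.
    have [r Ir] : exists r : R, \int[mu]_x f x = r%:E.
      by exists (fine (\int[mu]_x f x)); rewrite fineK// ge0_fin_numE.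
    have r0 : (0 <= r)%R by rewrite -lee_fin -Ir.
    have [|N hN] := @pw_small _ V 1 (c / (r + 1)) (grid_V G) ltr01.
      by rewrite divr_gt0// ltr_pwDr.
    exists N; rewrite Ir -EFinM lte_fin.
    move: hN; rewrite pwN -pwNt ltr_pdivlMr ?ltr_pwDr// => hN.
    by apply: le_lt_trans hN; rewrite ler_wpM2l ?lerDl ?pw_ge0.
  have [|i cyi imax] := @int_max_exists (fun i => c%:E < cavg i f y) j N cy.
    move=> i ci; rewrite leNgt; apply/negP => Ni.
    have := lt_le_trans ci (_ : _ <= (pw V (-1) N)%:E * \int[mu]_x f x).
    rewrite ltNge (ltW fN) => h; apply: notF; apply: h.
    apply: lee_pmul; rewrite ?lee_fin ?pw_ge0 ?integral_ge0//.
      by rewrite !pwNt lef_pV2 ?posrE ?pw_gt0// ler_pw// ltW.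
    by apply: ge0_subset_integral => //; exact: measurable_same.
  exists i => //=; rewrite /B/=.
  have xyi : near i x y by apply: near_up xy; exact: imax.
  have Ay : A i y.
    by split => // k ik; rewrite leNgt; apply/negP => /imax; rewrite leNgt ik.
  rewrite integral_indic//; last exact: measurable_near.
  rewrite -[leLHS](mu_same G i y); apply: le_measure; rewrite ?inE.
  - exact: measurable_same.
  - by apply: measurableI => //; exact: measurable_near.
  - move=> z yz; split; first exact: satA Ay yz.
    exact: near_same G _ _ _ _ xyi yz.
have le1 : mu [set x | (K * c)%:E < maxf f x] <= zsum (fun j => mu (B j)).
  rewrite zsumE//; apply: measure_sigma_subadditive => //.
    exact/measurable_set_gt/measurable_maxf.
  move=> x /sub[j _ Bj].
  have [_ _ /(_ j I)[k _ kj]] := int_of_nat_bij.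
  by exists k => //; rewrite kj.
apply: le_trans (lee_wpmul2l _ le1) _; first by rewrite lee_fin ltW.
rewrite -zsumZl ?lee_fin ?(ltW c0)//.
apply: le_trans (_ : zsum (fun j => K%:E * \int[mu]_(x in A j) f x) <= _).
  apply: le_zsum => j; apply: le_trans (lee_wpmul2l K1 (muA j)).
  by rewrite muleCA lee_wpmul2l// lee_fin ltW.
rewrite zsumZl//; last by move=> j; exact: integral_ge0.
rewrite lee_wpmul2l//.
under eq_zsum do rewrite integral_indicE.
rewrite -integral_zsum//; last 2 first.
- by move=> j; exact: measurable_indic_mule.
- by move=> j x; rewrite mule_ge0// lee_fin.
apply: le_integral => //.
- by move=> x; apply: zsum_ge0 => j; rewrite mule_ge0// lee_fin.
- move=> x; have [[j Aj]|nA] := pselect (exists j, A j x).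
    rewrite (@zsum_unique _ _ j).
    + by rewrite indicE mem_set// mul1e.
    + by rewrite mule_ge0// lee_fin.
    + move=> i ij; rewrite indicE memNset ?mul0e// => Ai.
      case: Aj Ai => cj Aj [ci Ai].
      have [ji|ij'|//] := ltgtP i j.
        by have := Ai _ ji; rewrite leNgt cj.
      by have := Aj _ ij'; rewrite leNgt ci.
  rewrite /zsum esum1// => j _; rewrite indicE memNset ?mul0e// => Aj.
  by apply: nA; exists j.
- apply: emeasurable_fun_zsum; first by move=> j; exact: measurable_indic_mule.
  by move=> j x; rewrite mule_ge0// lee_fin.
Qed.

End weak_type.

End averages.

(** * The strong type inequality for the dyadic maximal function *)

Section maximal.
Local Open Scope ereal_scope.
Context d (T : measurableType d) (R : realType)
  (mu : {sigma_finite_measure set T -> \bar R}) (V K : R)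
  (same near : int -> T -> set T) (G : dyadic_grid mu V K same near).
Implicit Types (f g h : T -> \bar R) (i j k : int) (a s p : R).

Local Notation avg := (avg mu V near).
Local Notation maxf := (maxf mu V near).

Let K0 : (0 < K)%R := grid_K0 G.

Lemma measurable_fun_poweR f p : measurable_fun setT f ->
  measurable_fun setT (fun x => f x `^ p).
Proof. by move=> mf; exact: measurableT_comp (measurable_poweR p) mf. Qed.

(** The part of f below c adds at most K c to any average; this is the second of the two summands K
    c in 2 K c. *)
Lemma maximal_truncated_weak_type f (c : R) : measurable_fun setT f ->
  (forall x, 0 <= f x) -> (0 < c)%R ->
  c%:E * mu [set x | (2 * K * c)%:E < maxf f x] <=
  K%:E * \int[mu]_(x in [set x | c%:E < f x]) f x.
Proof.
move=> mf f0 c0.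
pose f1 (x : T) := (\1_[set x : T | (c%:E < f x)%E] x)%:E * f x.
have mA : measurable [set x | c%:E < f x] by exact: measurable_set_gt.
have mf1 : measurable_fun setT f1 by exact: measurable_indic_mule.
have f10 x : 0 <= f1 x by rewrite mule_ge0// lee_fin.
rewrite integral_indicE; apply: le_trans (maximal_weak_type G mf1 f10 c0).
rewrite lee_wpmul2l ?lee_fin ?(ltW c0)// le_measure ?inE//.
- exact/measurable_set_gt/(measurable_maxf G).
- exact/measurable_set_gt/(measurable_maxf G).
move=> x /=; rewrite !ereal_sup_int => -[j cj]; exists j.
rewrite ltNge; apply/negP => cj'; move: cj; rewrite ltNge => /negP; apply.
apply: le_trans (_ : avg j (fun y => f1 y + c%:E) x <= _).
  apply: (le_avg G) => //; first exact: emeasurable_funD.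
  move=> y _; rewrite /f1 indicE; case: (boolP (y \in _)).
    by rewrite mul1e leeDl// lee_fin ltW.
  by rewrite notin_setE/= mul0e add0e leNgt => /negP.
rewrite (avgD G)//; last by move=> y; rewrite lee_fin ltW.
rewrite (_ : (2 * K * c)%:E = (K * c)%:E + (K * c)%:E); last first.
  by rewrite -EFinD; congr (_%:E); ring.
apply: leeD => //.
by apply: (avg_le_const G) => //; [move=> _; rewrite lee_fin ltW|exact: ltW].
Qed.

(** Marcinkiewicz interpolation in dyadic form: the truncated weak type is summed over the levels
    2^k, and for p > 1 the levels below f(x) add up to a multiple of f(x)^(p-1). *)
Lemma maximal_strong_type p : (1 < p)%R -> exists2 C : R, (0 < C)%R &
  forall f, measurable_fun setT f -> (forall x, 0 <= f x) ->
    \int[mu]_x maxf f x `^ p <= C%:E * \int[mu]_x f x `^ p.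
Proof.
move=> p1; have p0 : (0 < p)%R by exact: lt_trans p1.
have p10 : (0 < p - 1)%R by rewrite subr_gt0.
have g0 : (0 < geo 2 (p - 1))%R by rewrite geo_gt0 ?ltr1n.
have K20 : (0 < 2 * K)%R by rewrite mulr_gt0.
pose C := ((2 * K) `^ p * (K * 2 `^ p * geo 2 (p - 1)))%R.
exists C; first by rewrite !mulr_gt0 ?powR_gt0.
move=> f mf f0; have mM := measurable_maxf G mf f0.
have M0 := maxf_ge0 mu V near f0.
pose N (x : T) := ((2 * K)^-1)%:E * maxf f x.
have N0 x : 0 <= N x by rewrite mule_ge0// lee_fin invr_ge0 ltW.
have mN : measurable_fun setT N by exact: measurable_funeM.
have MN x : maxf f x = (2 * K)%:E * N x.
  by rewrite muleA -EFinM divff ?mul1e// gt_eqF.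
rewrite (eq_integral (fun x => ((2 * K) `^ p)%:E * N x `^ p)); last first.
  by move=> x _; rewrite MN poweRM ?lee_fin ?(ltW K20).
rewrite ge0_integralZl//; last 3 first.
- exact: measurable_fun_poweR.
- by move=> x _; exact: poweR_ge0.
- by rewrite lee_fin powR_ge0.
rewrite /C EFinM -muleA lee_wpmul2l ?lee_fin ?powR_ge0//.
pose F k (x : T) := (pw 2 p (k + 1))%:E * (\1_[set x : T | ((pw 2 1 k)%:E < N
  x)%E] x)%:E.
have mNk k : measurable [set x | (pw 2 1 k)%:E < N x] by exact:
  measurable_set_gt.
have mF k : measurable_fun setT (F k).
  exact/measurable_funeM/measurable_EFinP/measurable_indic.
have F0 k x : 0 <= F k x by rewrite mule_ge0// lee_fin ?pw_ge0.
apply: le_trans (_ : \int[mu]_x zsum (F ^~ x) <= _).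
  apply: le_integral.
  - by move=> x; exact: poweR_ge0.
  - move=> x; apply: le_trans (poweR_le_zsum p0 (N0 x)) _.
    apply: le_zsum => k; rewrite /F indicE; case: ifPn => h.
      by rewrite mem_set// mule1.
    by rewrite memNset ?mule0//; exact/negP.
  - exact: measurable_fun_poweR.
  - exact: emeasurable_fun_zsum.
rewrite integral_zsum//.
have mfk k : measurable [set x | (pw 2 1 k)%:E < f x] by exact:
  measurable_set_gt.
pose H k (x : T) := (pw 2 (p - 1) k)%:E * ((\1_[set x : T | ((pw 2 1 k)%:E < f
  x)%E] x)%:E * f x).
have mH k : measurable_fun setT (H k) by
  exact/measurable_funeM/measurable_indic_mule.
have H0 k x : 0 <= H k x by rewrite mule_ge0 ?lee_fin ?pw_ge0// mule_ge0//
  lee_fin.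
apply: le_trans (_ : (K * 2 `^ p)%:E * zsum (fun k => \int[mu]_x H k x) <= _).
  rewrite -zsumZl ?lee_fin ?mulr_ge0 ?powR_ge0 ?(ltW K0)//; last first.
    by move=> k; exact: integral_ge0.
  apply: le_zsum => k.
  rewrite /F ge0_integralZl ?lee_fin ?pw_ge0//; last first.
    exact/measurable_EFinP/measurable_indic.
  rewrite integral_indic// setIT.
  rewrite /H ge0_integralZl ?lee_fin ?pw_ge0//; last 2 first.
  - exact: measurable_indic_mule.
  - by move=> x _; rewrite mule_ge0// lee_fin.
  have pk : (0 < pw 2 1 k :> R)%R by rewrite pw_gt0.
  have := maximal_truncated_weak_type mf f0 pk.
  rewrite (_ : [set x | (2 * K * pw 2 1 k)%:E < maxf f x] =
               [set x | (pw 2 1 k)%:E < N x]); last first.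
    apply/seteqP; split => x /=; rewrite MN EFinM lte_pmul2l ?lte_fin//.
  rewrite -integral_indicE => h.
  rewrite pwS// (_ : pw 2 p k = pw 2 (p - 1) k * pw 2 1 k)%R; last first.
    by rewrite -pwDt// subrK.
  rewrite [X in X * _](_ : _ = (2 `^ p * pw 2 (p - 1) k)%:E * (pw 2 1 k)%:E);
    last first.
    by rewrite -EFinM; congr (_%:E); ring.
  rewrite -muleA; apply: le_trans (lee_wpmul2l _ h) _.
    by rewrite lee_fin mulr_ge0 ?powR_ge0 ?pw_ge0.
  rewrite !muleA -!EFinM [X in X%:E * _ <= _](_ : _ = K * 2 `^ p * pw 2 (p - 1)
    k)%R//.
  by ring.
rewrite [in leRHS]EFinM -muleA lee_wpmul2l ?lee_fin ?mulr_ge0 ?powR_ge0 ?(ltW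
  K0)//.
rewrite -integral_zsum//.
rewrite -ge0_integralZl ?lee_fin ?(ltW g0)//; last 2 first.
- exact: measurable_fun_poweR.
- by move=> x _; exact: poweR_ge0.
apply: le_integral.
- by move=> x; exact: zsum_ge0.
- move=> x.
  have -> : f x `^ p = f x `^ (p - 1) * f x.
    by rewrite -[X in _ * X]poweRe1// -poweRDp// subrK.
  rewrite muleA; apply: le_trans (lee_wpmul2r (f0 x) (zsum_le_poweR p10 (f0
    x))).
  rewrite muleC -zsumZl//; last by move=> k; case: ifP;
    rewrite ?lee_fin ?pw_ge0.
  apply: le_zsum => k; rewrite /H indicE; case: ifPn => h.
    by rewrite mem_set// mul1e muleC.
  by rewrite memNset ?mul0e ?mule0//; exact/negP.
- exact: emeasurable_fun_zsum.
- exact/measurable_funeM/measurable_fun_poweR.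
Qed.

(** Turns a lower bound on one cell, of measure V^j, into an estimate by the global L^s norm. It is
    applied to maximal functions, which dominate an average on the whole cell. *)
Lemma cell_le_integral f s j x (c : \bar R) : (0 <= s)%R ->
  measurable_fun setT f -> (forall y, 0 <= f y) -> 0 <= c ->
  (forall y, same j x y -> c <= f y) ->
  c `^ s <= (pw V (-1) j)%:E * \int[mu]_y f y `^ s.
Proof.
move=> s0 mf f0 c0 cf.
have mfs := measurable_fun_poweR s mf.
apply: le_trans (avg_ge_cell G (f := fun y => f y `^ s) (j := j) (x :=
  x) _ _ _ _) _ => //.
- by move=> y; exact: poweR_ge0.
- exact: poweR_ge0.
- by move=> y xy; rewrite le_poweR// cf.
rewrite lee_wpmul2l ?lee_fin ?pw_ge0//.
apply: ge0_subset_integral => //; first exact: (measurable_near G).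
by move=> y _; exact: poweR_ge0.
Qed.

End maximal.

(** * Test functions for level sets of maximal functions *)

Section capacity_of_maximal.
Local Open Scope ereal_scope.
Context d (T : measurableType d) (R : realType)
  (mu : {sigma_finite_measure set T -> \bar R}) (V K : R)
  (same near : int -> T -> set T) (G : dyadic_grid mu V K same near).
Implicit Types (f g h : T -> \bar R) (i j k : int) (a s p : R).

Local Notation avg := (avg mu V near).
Local Notation maxf := (maxf mu V near).
Local Notation pot := (pot mu V near).

Let V0 : (0 < V)%R := grid_V0 G.
Let V1 : (1 < V)%R := grid_V G.

Lemma poweR_max_le (x y : \bar R) s : 0 <= x -> 0 <= y ->
  (maxe x y) `^ s <= x `^ s + y `^ s.
Proof.
by move=> x0 y0; rewrite maxEle; case: ifP => _;
  rewrite ?leeDl ?leeDr// poweR_ge0.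
Qed.

Lemma zsum_split (F : int -> \bar R) j : (forall i, 0 <= F i) ->
  zsum F = zsum (fun i => if (i <= j - 1)%R then F i else 0) +
           zsum (fun i => if (j <= i)%R then F i else 0).
Proof.
move=> F0; rewrite -zsumD; last 2 first.
- by move=> i; case: ifP.
- by move=> i; case: ifP.
apply: eq_zsum => i; case: ifPn; case: ifPn; rewrite ?adde0 ?add0e//; lia.
Qed.

Lemma half_le_or (x y : \bar R) : 1 <= x + y -> (2^-1)%:E <= x \/ (2^-1)%:E <=
  y.
Proof.
move=> xy; have [?|x2] := leP (2^-1)%:E x; first by left.
right; rewrite leNgt; apply/negP => y2; move: xy; rewrite leNgt => /negP; apply.
by rewrite (_ : 1 = (2^-1)%:E + (2^-1)%:E) ?lteD// -EFinD; congr (_%:E); field.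
Qed.

Variables (a s : R).
Hypotheses (a0 : (0 < a)%R) (s1 : (1 < s)%R) (as1 : (a * s < 1)%R).

Let s0 : (0 < s)%R. Proof. exact: lt_trans s1. Qed.

Let a1 : (a < 1)%R.
Proof. by apply: lt_trans as1; rewrite ltr_pMr. Qed.

(* If all the terms of generation i < j are small compared with
   V^(-aj) V^(a(j-i)/2), their sum is small. *)
Lemma local_part_large (b : int -> \bar R) j : (forall i, 0 <= b i) ->
  (2^-1)%:E <= zsum (fun i => if (i <= j - 1)%R then (pw V a i)%:E * b i else 0)
    ->
  exists i, (i <= j - 1)%R /\
    ((4 * geo V (a / 2))^-1 * (pw V (- a) j * pw V (a / 2) (j - i)))%:E <= b i.
Proof.
move=> b0 half; apply/not_existsP => h.
have a2 : (0 < a / 2)%R by rewrite divr_gt0.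
have g0 : (0 < geo V (a / 2))%R by rewrite geo_gt0.
set c := (4 * geo V (a / 2))^-1%R in h.
have c0 : (0 < c)%R by rewrite invr_gt0 mulr_gt0.
have : zsum (fun i => if (i <= j - 1)%R then (pw V a i)%:E * b i else 0) <=
  (c * pw V (- (a / 2)) j)%:E * (geo V (a / 2) * pw V (a / 2) (j - 1))%:E.
  apply: le_zsum_geo_le => //.
    by rewrite lee_fin mulr_ge0 ?pw_ge0 ?(ltW c0).
  move=> i ij.
  have /not_andP[//|/negP] := h i; rewrite -ltNge => /ltW bi.
  apply: le_trans (lee_wpmul2l _ bi) _; first by rewrite lee_fin pw_ge0.
  rewrite -!EFinM lee_fin pwB// [in leLHS](_ : a = a / 2 + a / 2)%R;
    last by field.
  rewrite pwDt// opprD pwDt// !pwNt.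
  have := pw_neq0 (a / 2) i V0; have := pw_neq0 (a / 2) j V0.
  rewrite (_ : (a / 2 + a / 2) / 2 = a / 2)%R; last by field.
  set u := pw _ _ i; set v := pw _ _ j => v0 u0.
  by rewrite le_eqVlt; apply/orP; left; apply/eqP; field; rewrite u0 v0.
move=> /(le_trans half); rewrite -EFinM lee_fin leNgt => /negP; apply.
have v0 := pw_gt0 (a / 2) j V0.
apply: (@le_lt_trans _ _ (c * pw V (- (a / 2)) j * (geo V (a / 2) * pw V (a / 2)
  j)))%R.
  rewrite ler_wpM2l ?mulr_ge0 ?pw_ge0 ?(ltW c0)// ler_wpM2l ?(ltW g0)//.
  by rewrite ler_pw ?(ltW V1) ?(ltW a2)// gerBl.
rewrite /c pwNt.
rewrite [ltLHS](_ : _ = 4^-1)%R; last by field; rewrite !gt_eqF.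
lra.
Qed.

(** Let the average of the indicator of E over generation j at x exceed l. If at some point of E
    near x the generations from j on give half of the potential of h, a multiple of h works at x.
    Otherwise the finer generations give half at every point of E near x, and H = M h is large
    either on one sizeable cell or on all of E near x. Both cases bound the average of H^r at
    generation j from below by (c V^(-aj))^r l^t0. Hence g2 >= V^(-aj) on the cell of x, which makes
    its potential at least 1. *)
Lemma capacity_maximal_indicator : exists2 t : R, (0 < t < 1)%R &
  exists2 C : R, (0 < C)%R &
  forall (E : set T) h, measurable E -> measurable_fun setT h ->
    (forall x, 0 <= h x) -> (forall x, E x -> 1 <= pot a h x) ->
  forall l : R, (0 < l <= 1)%R ->
  exists g, [/\ measurable_fun setT g, (forall x, 0 <= g x),
    (forall x, l%:E < maxf (fun y => (\1_E y)%:E) x -> 1 <= pot a g x) &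
    \int[mu]_x g x `^ s <= (C * l `^ (- t))%:E * \int[mu]_x h x `^ s].
Proof.
(* The gain a / 4 is the rate a / 2 of [local_part_large] times the exponent 1/2 of the threshold
   l^(1/2) that separates sizeable cells from small ones. *)
pose t0 : R := (1 - a / 4)%R.
have a1' := a1; have a0' := a0; have s1' := s1.
have t00 : (0 < t0)%R by rewrite /t0; lra.
(* Strictly between max(1, t0 s) and s: r > t0 s gives t = t0 s / r < 1, and r < s makes the maximal
   operator bounded on L^(s/r). *)
pose r := ((s + Num.max 1 (t0 * s)) / 2)%R.
have [rs [r1 tsr]] : (r < s)%R /\ (1 < r)%R /\ (t0 * s < r)%R.
  have t0s : (t0 * s < s)%R by rewrite gtr_pMl// /t0; lra.
  have m1 : (1 <= Num.max 1 (t0 * s))%R by rewrite le_max lexx.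
  have m2 : (t0 * s <= Num.max 1 (t0 * s))%R by rewrite le_max lexx orbT.
  have m3 : (Num.max 1 (t0 * s) < s)%R by rewrite gt_max s1 t0s.
  by rewrite /r; split; [|split]; lra.
have r0 : (0 < r)%R by exact: lt_trans r1.
pose t := (t0 * s / r)%R.
have t_gt0 : (0 < t)%R by rewrite divr_gt0// mulr_gt0.
exists t; first by rewrite t_gt0 ltr_pdivrMr// mul1r.
have [C1 C10 HC1] := maximal_strong_type G s1.
have sr1 : (1 < s / r)%R by rewrite ltr_pdivlMr// mul1r.
have [C2 C20 HC2] := maximal_strong_type G sr1.
pose c := ((4 * geo V (a / 2))^-1)%R.
have c0 : (0 < c)%R by rewrite invr_gt0 mulr_gt0// geo_gt0// divr_gt0.
pose D := ((2 * V) `^ s + c `^ (- s) * (C2 * C1))%R.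
exists D; first by rewrite addr_gt0 ?mulr_gt0 ?powR_gt0 ?mulr_gt0.
move=> E h mE mh h0 hE l /andP[l0 l1].
pose H := maxf h.
have mH : measurable_fun setT H by exact: (measurable_maxf G mh h0).
have H0 x : 0 <= H x by exact: maxf_ge0.
pose Hr x := H x `^ r.
have mHr : measurable_fun setT Hr by exact: measurable_fun_poweR.
have Hr0 x : 0 <= Hr x by exact: poweR_ge0.
pose M := maxf Hr.
have mM : measurable_fun setT M by exact: (measurable_maxf G mHr Hr0).
have M0 x : 0 <= M x by exact: maxf_ge0.
(* Cancels the constants of the lower bound [key], leaving e M >= V^(-arj) on the cell. *)
pose e := (l `^ (- t0) * c `^ (- r))%R.
have e0 : (0 < e)%R by rewrite mulr_gt0 ?powR_gt0.
pose g2 x := (e%:E * M x) `^ r^-1.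
have mg2 : measurable_fun setT g2 by
  exact/measurable_fun_poweR/measurable_funeM.
have g20 x : 0 <= g2 x by exact: poweR_ge0.
pose g1 x := (2 * V)%:E * h x.
have mg1 : measurable_fun setT g1 by exact: measurable_funeM.
have V20 : (0 < 2 * V)%R by rewrite mulr_gt0.
have g10 x : 0 <= g1 x by rewrite mule_ge0// lee_fin ltW.
pose g x := maxe (g1 x) (g2 x).
have mg : measurable_fun setT g by exact: measurable_maxe.
have g0 x : 0 <= g x by rewrite le_max g10.
exists g; split => //.
  move=> x; rewrite ereal_sup_int => -[j lj].
  have mI : measurable_fun setT (fun y : T => (\1_E y)%:E : \bar R).
    exact/measurable_EFinP/measurable_indic.
  pose b i y := avg i h y.
  have b0 i y : 0 <= b i y by exact: avg_ge0.
  have F0 y i : 0 <= (pw V a i)%:E * b i y by rewrite mule_ge0 ?lee_fin ?pw_ge0.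
  (* In the far case [le_avg_near] compares each generation i >= j at y with generation i + 1 at x,
     which costs the factor V; the 2 makes up for the half. *)
  have [[y [xy Ey] far]|nofar] := pselect (exists2 y, near j x y /\ E y &
      (2^-1)%:E <= zsum (fun i => if (j <= i)%R then (pw V a i)%:E * b i y else
        0)).
    apply: le_trans (_ : pot a g1 x <= _); last first.
      by apply: (le_pot G) => // z; rewrite /g le_max lexx.
    rewrite (potZl G) ?(ltW V20)// EFinM -muleA.
    rewrite [leLHS](_ : 1 = 2%:E * (2^-1)%:E); last first.
      by rewrite -EFinM divff// pnatr_eq0.
    rewrite lee_wpmul2l ?lee_fin//; apply: le_trans far _.
    have -> : V%:E * pot a h x =
        zsum (fun i => V%:E * ((pw V a (i + 1))%:E * b (i + 1)%R x)).
      rewrite zsumZl ?lee_fin ?(ltW V0)//.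
      by rewrite /pot (zsum_shift _ 1).
    apply: le_zsum => i; case: ifPn => ji; last first.
      by rewrite mule_ge0 ?lee_fin ?(ltW V0)// F0.
    have := le_avg_near G mh h0 (near_sym G (near_up G ji xy)).
    rewrite -/(b i y) -/(b (i + 1)%R x) => hb.
    apply: le_trans (lee_wpmul2l _ hb) _; first by rewrite lee_fin pw_ge0.
    rewrite muleCA lee_wpmul2l ?lee_fin ?(ltW V0)// lee_wpmul2r//.
    by rewrite lee_fin ler_pw ?(ltW V1) ?(ltW a0)// lerDl.
  have loc y : near j x y -> E y -> exists i, (i <= j - 1)%R /\
      (c * (pw V (- a) j * pw V (a / 2) (j - i)))%:E <= b i y.
    move=> xy Ey; apply: local_part_large => //.
    have := hE _ Ey; rewrite /pot (zsum_split j (F0 y)) => /half_le_or[//|far].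
    by exfalso; apply: nofar; exists y.
  have bH i y z : same i y z -> b i y <= H z.
    by move=> yz; rewrite /b (avg_same G h yz) avg_le_maxf.
  have key : (c `^ r * pw V (- a * r) j * l `^ t0)%:E <= avg j Hr x.
    have cj0 : (0 < c * pw V (- a) j)%R by rewrite mulr_gt0 ?pw_gt0.
    (* A cell with V^(i-j) >= l^(1/2), on which H >= c V^(-aj), gives the bound alone, because t0 >=
       1/2. *)
    have [[y [i [xy ij iV biy]]]|nobig] := pselect (exists y i,
        [/\ near j x y, (i <= j - 1)%R, (l `^ 2^-1 <= pw V 1 (i - j))%R &
         (c * (pw V (- a) j * pw V (a / 2) (j - i)))%:E <= b i y]).
      apply: le_trans (avg_ge_subcell G mHr Hr0 (i := i) (j := j)
        (x := x) (y := y) (c := (c * pw V (- a) j)%:E `^ r) _ _ _ _) => //.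
      - rewrite poweR_EFin powRM ?pw_ge0 ?(ltW c0)// pw_powR -EFinM lee_fin.
        rewrite ler_wpM2l ?mulr_ge0 ?powR_ge0 ?pw_ge0//.
        apply: le_trans iV; apply: ger_powR; first by rewrite l0.
        by rewrite /t0; lra.
      - by rewrite (le_trans ij)// gerBl.
      - exact: poweR_ge0.
      - move=> z yz; rewrite le_poweR ?lee_fin ?(ltW cj0) ?(ltW r0)//.
        apply: le_trans (bH _ _ _ yz); apply: le_trans biy.
        rewrite lee_fin mulrA ler_peMr ?(ltW cj0)//.
        rewrite -[leLHS](pw0 V (a / 2)) ler_pw ?(ltW V1) ?divr_ge0 ?(ltW a0)//.
        by rewrite subr_ge0 (le_trans ij)// gerBl.
    (* Now j - i is large at every point of E near x, which raises H there by the factor l^(-a/4);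
       the average of the indicator of E supplies the remaining power l. *)
    have HE y : near j x y -> E y -> (c * pw V (- a) j * l `^ (- (a / 4)))%:E <=
      H y.
      move=> xy Ey; have [i [ij biy]] := loc _ xy Ey.
      apply: le_trans (bH i y y (same_refl G _ _)); apply: le_trans (biy).
      rewrite lee_fin mulrA ler_wpM2l ?(ltW cj0)//.
      have iV : (pw V 1 (i - j) < l `^ 2^-1)%R.
        rewrite ltNge; apply/negP => iV; apply: nobig.
        by exists y, i.
      rewrite -(opprB i j) pwN powRN (_ : a / 4 = 2^-1 * (a / 2))%R;
        last by field.
      have -> : pw V (a / 2) (i - j) = (pw V 1 (i - j) `^ (a / 2))%R.
        by rewrite pw_powR mul1r.
      rewrite (powRrM l).
      rewrite lef_pV2 ?posrE ?powR_gt0 ?pw_gt0//.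
      rewrite ge0_ler_powR ?nnegrE ?pw_ge0 ?powR_ge0 ?(ltW iV)//.
      by rewrite divr_ge0 ?(ltW a0).
    pose u := (c * pw V (- a) j * l `^ (- (a / 4)))%R.
    have u0 : (0 < u)%R by rewrite mulr_gt0 ?powR_gt0.
    apply: le_trans (_ : avg j (fun y => (u `^ r)%:E * (\1_E y)%:E) x <= _);
      last first.
      apply: (le_avg G) => //.
      - exact: measurable_funeM.
      - by move=> y; rewrite -EFinM lee_fin mulr_ge0 ?powR_ge0.
      - move=> y xy; rewrite indicE; case: (boolP (y \in E)) => [|_].
          rewrite inE mule1 -poweR_EFin => Ey.
          by rewrite le_poweR ?lee_fin ?(ltW u0) ?(ltW r0)// HE.
        by rewrite mule0.
    rewrite (avgZl G) ?powR_ge0//.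
    apply: le_trans (lee_wpmul2l _ (ltW lj)); last by rewrite lee_fin powR_ge0.
    rewrite -EFinM lee_fin /u powRM ?mulr_ge0 ?pw_ge0 ?powR_ge0 ?(ltW c0)//.
    rewrite powRM ?pw_ge0 ?(ltW c0)// pw_powR -[leRHS]mulrA.
    rewrite ler_wpM2l ?mulr_ge0 ?powR_ge0 ?pw_ge0//.
    rewrite -powRrM -[X in (_ <= _ * X)%R]powRr1 ?(ltW l0)// -powRD; last first.
      by rewrite (gt_eqF l0) implybT.
    apply: ger_powR; first by rewrite l0.
    by rewrite /t0; nra.
  apply: le_trans (_ : pot a g2 x <= _); last first.
    by apply: (le_pot G) => // z; rewrite /g le_max lexx orbT.
  apply: le_trans (pot_ge_level mu V near a j x g20).
  apply: le_trans (_ : (pw V a j)%:E * (pw V (- a) j)%:E <= _).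
    by rewrite -EFinM pwNt divff ?pw_neq0.
  rewrite lee_wpmul2l ?lee_fin ?pw_ge0//.
  apply: (avg_ge_cell G) => //; first by rewrite lee_fin pw_ge0.
  move=> y xy; rewrite /g2.
  rewrite -(@poweR_ler _ r) ?poweR_ge0 ?lee_fin ?pw_ge0// poweRVK ?gt_eqF//;
    last first.
    by rewrite mule_ge0 ?lee_fin ?(ltW e0).
  rewrite poweR_pw.
  apply: le_trans (_ : e%:E * avg j Hr y <= _); last first.
    by rewrite lee_wpmul2l ?lee_fin ?(ltW e0)// avg_le_maxf.
  rewrite -(avg_same G Hr xy); apply: le_trans (lee_wpmul2l _ key); last first.
    by rewrite lee_fin ltW.
  rewrite -EFinM lee_fin /e !powRN.
  rewrite [leRHS](_ : _ = pw V (- a * r) j)//.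
  by field; rewrite !gt_eqF ?powR_gt0.
apply: le_trans (_ : \int[mu]_x (g1 x `^ s + g2 x `^ s) <= _).
  apply: le_integral.
  - by move=> x; exact: poweR_ge0.
  - by move=> x; exact: poweR_max_le.
  - exact: measurable_fun_poweR.
  - by apply: emeasurable_funD; exact: measurable_fun_poweR.
rewrite ge0_integralD//; last 4 first.
- by move=> x _; exact: poweR_ge0.
- exact: measurable_fun_poweR.
- by move=> x _; exact: poweR_ge0.
- exact: measurable_fun_poweR.
have Ih0 : 0 <= \int[mu]_x h x `^ s by apply: integral_ge0 => x _;
  exact: poweR_ge0.
have lt1 : (1 <= l `^ (- t))%R.
  by rewrite -(powRr0 l) ger_powR ?l0//; lra.
have int1 : \int[mu]_x g1 x `^ s = ((2 * V) `^ s)%:E * \int[mu]_x h x `^ s.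
  rewrite -ge0_integralZl ?lee_fin ?powR_ge0//.
  - by apply: eq_integral => x _; rewrite poweRM ?lee_fin ?(ltW V20).
  - exact: measurable_fun_poweR.
  - by move=> x _; exact: poweR_ge0.
have int2 : \int[mu]_x g2 x `^ s <= (l `^ (- t) * c `^ (- s) * (C2 * C1))%:E *
  \int[mu]_x h x `^ s.
  have -> : \int[mu]_x g2 x `^ s = (e `^ (s / r))%:E * \int[mu]_x M x `^ (s /
    r).
    rewrite -ge0_integralZl ?lee_fin ?powR_ge0//.
    - apply: eq_integral => x _; rewrite /g2 -poweRrM mulrC.
      by rewrite poweRM ?lee_fin ?(ltW e0).
    - exact: measurable_fun_poweR.
    - by move=> x _; exact: poweR_ge0.
  rewrite /e powRM ?powR_ge0// -!powRrM.
  rewrite (_ : - t0 * (s / r) = - t)%R; last by rewrite /t; field;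
    rewrite gt_eqF.
  rewrite (_ : - r * (s / r) = - s)%R; last by field; rewrite gt_eqF.
  rewrite [in leRHS]EFinM -[leRHS]muleA lee_wpmul2l ?lee_fin ?mulr_ge0
    ?powR_ge0//.
  apply: le_trans (HC2 _ mHr Hr0) _.
  rewrite EFinM -muleA lee_wpmul2l ?lee_fin ?(ltW C20)//.
  rewrite (eq_integral (fun x => H x `^ s)); first exact: HC1.
  move=> x _; rewrite /Hr -poweRrM; congr (_ `^ _).
  by field; rewrite gt_eqF.
apply: le_trans (leeD (lexx _) int2) _.
rewrite int1 -ge0_muleDl ?lee_fin ?powR_ge0 ?mulr_ge0 ?powR_ge0 ?(ltW C10) ?(ltW
  C20)//.
rewrite lee_wpmul2r// -EFinD lee_fin /D [leRHS]mulrDl.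
apply: lerD; first by rewrite ler_peMr ?powR_ge0.
by rewrite le_eqVlt; apply/orP; left; apply/eqP; ring.
Qed.

End capacity_of_maximal.

(** * Level sets of the maximal function of a power of the weight *)

Section capacity_of_powers.
Local Open Scope ereal_scope.
Context d (T : measurableType d) (R : realType)
  (mu : {sigma_finite_measure set T -> \bar R}) (V K : R)
  (same near : int -> T -> set T) (G : dyadic_grid mu V K same near).
Implicit Types (f g h : T -> \bar R) (i j k : int) (a s p : R).

Local Notation avg := (avg mu V near).
Local Notation maxf := (maxf mu V near).
Local Notation pot := (pot mu V near).

Let K0 : (0 < K)%R := grid_K0 G.

Lemma avg_zsum (F : int -> T -> \bar R) j x :
  (forall k, measurable_fun setT (F k)) -> (forall k y, 0 <= F k y) ->
  avg j (fun y => zsum (F ^~ y)) x = zsum (fun k => avg j (F k) x).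
Proof.
move=> mF F0; rewrite /avg integral_zsum//; last exact: (measurable_near G).
by rewrite zsumZl ?lee_fin ?pw_ge0// => k; exact: integral_ge0.
Qed.

Lemma poweR_sup_le_zsum (F : int -> \bar R) s : (0 < s)%R -> (forall k, 0 <= F
  k) ->
  (ereal_sup (range F)) `^ s <= zsum (fun k => F k `^ s).
Proof.
move=> s0 F0.
have S0 : 0 <= ereal_sup (range F).
  by apply: le_trans (F0 0%Z) _; apply: ereal_sup_ubound; exists 0%Z.
have Z0 : 0 <= zsum (fun k => F k `^ s) by apply: zsum_ge0 => k;
  exact: poweR_ge0.
rewrite -[leRHS](@poweRVK _ s) ?gt_eqF// poweR_ler ?poweR_ge0//.
apply: ge_ereal_sup => _ [k _ <-].
rewrite -(@poweR_ler _ s) ?poweR_ge0// poweRVK ?gt_eqF//.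
by apply: (zsum_ge (F := fun k => F k `^ s)) => i; exact: poweR_ge0.
Qed.

(** Countable subadditivity of the capacity in terms of test functions: the supremum serves for the
    union of the sets. *)
Lemma integral_sup_poweR (F : int -> T -> \bar R) s : (0 < s)%R ->
  (forall k, measurable_fun setT (F k)) -> (forall k x, 0 <= F k x) ->
  \int[mu]_x (ereal_sup (range (F ^~ x))) `^ s <=
  zsum (fun k => \int[mu]_x F k x `^ s).
Proof.
move=> s0 mF F0; rewrite -(integral_zsum mu measurableT); last 2 first.
- by move=> k; exact: measurable_fun_poweR.
- by move=> k x; exact: poweR_ge0.
apply: le_integral.
- by move=> x; exact: poweR_ge0.
- by move=> x; exact: poweR_sup_le_zsum.
- exact/measurable_fun_poweR/measurable_ereal_sup_int.
- apply: emeasurable_fun_zsum; first by move=> k; exact: measurable_fun_poweR.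
  by move=> k x; exact: poweR_ge0.
Qed.

Variables (a s : R).
Hypotheses (a0 : (0 < a)%R) (s1 : (1 < s)%R) (as1 : (a * s < 1)%R).

Let s0 : (0 < s)%R. Proof. exact: lt_trans s1. Qed.

(** With E_k = {w > 2^k}, w^eta is at most 2^(eta m) plus the sum over k >= m of 2^(eta (k+1))
    1_{E_k}. If M 1_{E_k} <= 2^((eta + de)(m - k)) at x for every k >= m, then M(w^eta) <= C1 2^(eta
    m) there. So where M(w^eta) is larger, some M 1_{E_k} exceeds its threshold, and the supremum
    over k of the corresponding test functions works. *)
Lemma capacity_maximal_power : exists2 eta : R, (1 < eta)%R &
  exists2 C : R, (0 < C)%R &
  forall (w : T -> R) (h : int -> T -> \bar R),
    measurable_fun setT w -> (forall x, 0 <= w x)%R ->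
    (forall k, measurable_fun setT (h k)) -> (forall k x, 0 <= h k x) ->
    (forall k x, (pw 2 1 k < w x)%R -> 1 <= pot a (h k) x) ->
  exists psi : int -> T -> \bar R,
    [/\ forall m, measurable_fun setT (psi m), forall m x, 0 <= psi m x,
     forall m x, (pw 2 eta m)%:E < maxf (fun y => (w y `^ eta)%:E) x ->
       1 <= pot a (psi m) x &
     zsum (fun m => (pw 2 1 m)%:E * \int[mu]_x psi m x `^ s) <=
     C%:E * zsum (fun k => (pw 2 1 k)%:E * \int[mu]_x h k x `^ s)].
Proof.
have [t /andP[t0 t1] [C C0 HC]] := capacity_maximal_indicator G a0 s1 as1.
have t'1 : (1 < t^-1)%R by rewrite invf_gt1.
(* Makes ga = (eta + de) t equal to (1 + t) / 2 < 1. *)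
pose de := ((t^-1 - 1) / 4)%R.
have de0 : (0 < de)%R by rewrite /de; lra.
pose eta := (1 + de)%R.
have eta1 : (1 < eta)%R by rewrite /eta; lra.
have eta0 : (0 < eta)%R by exact: lt_trans eta1.
have tne : t != 0%R by rewrite gt_eqF.
pose ga := ((eta + de) * t)%R.
have gaE : ga = ((1 + t) / 2)%R by rewrite /ga /eta /de; field.
have ga1 : (0 < 1 - ga)%R by rewrite gaE; lra.
have ga0 : (0 < ga)%R by rewrite gaE; lra.
exists eta => //; clearbody eta de.
have gd0 : (0 < geo 2 de)%R by rewrite geo_gt0 ?ltr1n.
pose C1 := (K + 2 `^ eta * geo 2 de)%R.
have C10 : (0 < C1)%R by rewrite addr_gt0 ?mulr_gt0 ?powR_gt0.
(* A shift by m0 levels absorbs the constant C1. *)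
have [m0 m0C] := @pw_unbounded _ 2 eta C1 (ltr1n _ 2) eta0.
have gg0 : (0 < geo 2 (1 - ga))%R by rewrite geo_gt0 ?ltr1n.
pose C2 := (pw 2 1 m0%:Z * (C * geo 2 (1 - ga)))%R.
exists C2; first by rewrite !mulr_gt0 ?pw_gt0.
move=> w h mw w0 mh h0 hw.
pose E k := [set x | (pw 2 1 k < w x)%R].
have mE k : measurable (E k).
  have /measurable_EFinP mw' := mw.
  have := measurable_set_gt (pw 2 1 k)%:E mw'.
  by congr measurable; apply/seteqP; split => x /=; rewrite lte_fin.
pose l (m k : int) : R := pw 2 (eta + de) (m - k).
have l0 m k : (0 < l m k)%R by rewrite pw_gt0.
have /choice[u uP] : forall p : (int * int)%type, exists u : T -> \bar R,
    (p.1 <= p.2)%R ->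
    [/\ measurable_fun setT u, (forall x, 0 <= u x),
    (forall x, (l p.1 p.2)%:E < maxf (fun y => (\1_(E p.2) y)%:E) x ->
      1 <= pot a u x) &
    \int[mu]_x u x `^ s <= (C * l p.1 p.2 `^ (- t))%:E * \int[mu]_x h p.2 x `^
      s].
  move=> -[m k] /=.
  have [mk|mk] := boolP (m <= k)%R; last by exists (cst 0).
  have [|g gP] := HC (E k) (h k) (mE k) (mh k) (h0 k) (hw k) (l m k).
    rewrite l0/= -(pw0 2 (eta + de)) ler_pw ?ler1n ?subr_le0//.
    by rewrite ltW// addr_gt0.
  by exists g.
pose F (m k : int) x := if (m <= k)%R then u (m, k) x else 0.
have mF m k : measurable_fun setT (F m k).
  by rewrite /F; have [mk|//] := boolP (m <= k)%R; have [] := uP (m, k) mk.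
have F0 m k x : 0 <= F m k x.
  by rewrite /F; case: ifPn => // mk; have [] := uP (m, k) mk.
pose psi0 (m : int) x := ereal_sup (range (fun k => F m k x)).
have psi00 m x : 0 <= psi0 m x.
  by apply: le_trans (F0 m 0%Z x) _; apply: ereal_sup_ubound; exists 0%Z.
have mpsi0 m : measurable_fun setT (psi0 m) by exact: measurable_ereal_sup_int.
exists (fun m => psi0 (m - m0%:Z)%R); split => //.
  move=> m' x; have [m ->] : exists m, m' = (m0%:Z + m)%R.
    by exists (m' - m0%:Z)%R; rewrite addrC subrK.
  have -> : (m0%:Z + m - m0%:Z)%R = m by rewrite addrC addKr.
  move=> big.
  have {}big : (C1 * pw 2 eta m)%:E < maxf (fun y => (w y `^ eta)%:E) x.
    apply: le_lt_trans big; rewrite lee_fin pwD// ler_wpM2r ?pw_ge0//.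
    exact: ltW.
  have [k mk kx] : exists2 k, (m <= k)%R &
      (l m k)%:E < maxf (fun y => (\1_(E k) y)%:E) x.
    apply: contrapT => small; move: big; rewrite ereal_sup_int => -[j].
    rewrite ltNge => /negP; apply.
    pose H (k : int) (y : T) : \bar R := if (m <= k)%R then (pw 2 eta (k +
      1))%:E * (\1_(E k) y)%:E else 0.
    have mI k : measurable_fun setT (fun y : T => (\1_(E k) y)%:E : \bar R).
      exact/measurable_EFinP/measurable_indic.
    have mH k : measurable_fun setT (H k).
      by rewrite /H; have [mk|//] := boolP (m <= k)%R; exact: measurable_funeM.
    have H0 k y : 0 <= H k y.
      by rewrite /H; case: ifPn => // mk; rewrite mule_ge0 ?lee_fin ?pw_ge0.
    have mweta : measurable_fun setT (fun y => (w y `^ eta)%:E).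
      apply/measurable_EFinP; exact: measurableT_comp (measurable_powR _) mw.
    have mZ : measurable_fun setT (fun y => zsum (H ^~ y)) by exact:
      emeasurable_fun_zsum.
    apply: le_trans (_ : avg j (fun y => (pw 2 eta m)%:E + zsum (H ^~ y)) x <=
      _).
      apply: (le_avg G) => //.
      - exact: emeasurable_funD.
      - by move=> y; rewrite lee_fin powR_ge0.
      - move=> y _; have [wm|wm] := leP (w y) (pw 2 1 m).
          apply: (@le_trans _ _ (pw 2 eta m)%:E);
            last by rewrite leeDl ?zsum_ge0.
          rewrite lee_fin; apply: (@le_trans _ _ (pw 2 1 m `^ eta)%R).
            by rewrite ge0_ler_powR ?nnegrE ?pw_ge0 ?(ltW eta0).
          by rewrite pw_powR mul1r.
        have wy0 : (0 < w y)%R by apply: le_lt_trans wm; exact: pw_ge0.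
        have [k /andP[kw wk]] := @pw_level _ 2 1 (w y) (ltr1n _ 2) ltr01 wy0.
        have mk : (m <= k)%R.
          rewrite leNgt; apply/negP => km.
          have : (pw 2 1 (k + 1) <= pw 2 1 m :> R)%R.
            by rewrite ler_pw ?ler1n// lezD1.
          by move=> /(le_trans wk); rewrite leNgt wm.
        apply: (@le_trans _ _ (H k y)); last first.
          apply: le_trans (zsum_ge (F := H ^~ y) k (H0 ^~ y)) _.
          by rewrite leeDr// lee_fin pw_ge0.
        rewrite /H mk indicE mem_set// mule1 lee_fin.
        apply: (@le_trans _ _ (pw 2 1 (k + 1) `^ eta)%R).
          by rewrite ge0_ler_powR ?nnegrE ?pw_ge0 ?(ltW eta0).
        by rewrite pw_powR mul1r.
    rewrite (avgD G)//; last first.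
    - by move=> y; exact: zsum_ge0.
    - by move=> y; rewrite lee_fin pw_ge0.
    rewrite /C1 mulrDl EFinD; apply: leeD.
      by apply: (avg_le_const G) => //; [move=> y;
        rewrite lee_fin pw_ge0|exact: pw_ge0].
    rewrite avg_zsum//.
    apply: le_trans (_ : zsum (fun k => if (m <= k)%R then
        ((pw 2 eta (k + 1))%:E * (l m k)%:E) else 0) <= _).
      apply: le_zsum => k; rewrite /H; case: ifPn => mk; last first.
        by rewrite /avg integral0 mule0.
      rewrite (avgZl G) ?pw_ge0//.
      rewrite lee_wpmul2l ?lee_fin ?pw_ge0//.
      apply: le_trans (avg_le_maxf _ _ _ _ _ _) _.
      by rewrite leNgt; apply/negP => kx; apply: small; exists k.
    have cm0 : 0 <= (2 `^ eta * pw 2 eta m * pw 2 de m)%:E :> \bar R.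
      by rewrite lee_fin !mulr_ge0 ?powR_ge0 ?pw_ge0.
    apply: le_trans (le_zsum_geo_ge (b := 2) (t := de) (K :=
      m) _ _ cm0 _) _ => //.
    - by rewrite ltr1n.
    - move=> k mk; rewrite -!EFinM lee_fin /l pwS// pwDt// !pwB// pwNt.
      have := pw_neq0 eta k (ltr0n R 2); have := pw_neq0 de k (ltr0n R 2).
      move=> e1 e2; rewrite le_eqVlt; apply/orP; left; apply/eqP; field.
      by rewrite e1 e2.
    - rewrite -EFinM lee_fin pwNt.
      have e1 := pw_neq0 de m (ltr0n R 2).
      by rewrite le_eqVlt; apply/orP; left; apply/eqP; field.
  have [mu0 u0 upot _] := uP (m, k) mk.
  apply: le_trans (upot _ kx) _.
  apply: (le_pot G) => // y; apply: ereal_sup_ubound.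
  by exists k => //; rewrite /F mk.
pose A k := \int[mu]_x h k x `^ s.
have A0 k : 0 <= A k by apply: integral_ge0 => x _; exact: poweR_ge0.
pose B (m k : int) : \bar R := if (m <= k)%R then (C * pw 2 ga (k - m))%:E * A k
  else 0.
have B0 m k : 0 <= B m k.
  by rewrite /B; case: ifPn => // _; rewrite mule_ge0// lee_fin mulr_ge0 ?pw_ge0
    ?(ltW C0).
have psiB m : \int[mu]_x psi0 m x `^ s <= zsum (B m).
  apply: le_trans (integral_sup_poweR s0 (mF m) (F0 m)) _.
  apply: le_zsum => k; rewrite /F /B; case: ifPn => mk; last first.
    by rewrite poweR0r ?gt_eqF// integral0.
  have [_ _ _] := uP (m, k) mk => /le_trans; apply.
  rewrite /= /l pw_powR /A [X in (C * X)%R](_ : _ = pw 2 ga (k - m))//.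
  by rewrite mulrN -/ga pwNt -pwN opprB.
rewrite (zsum_shift _ m0%:Z).
under eq_zsum => m do rewrite addrK pwD// mulrC EFinM -muleA.
rewrite zsumZl ?lee_fin ?pw_ge0//; last first.
  move=> m; rewrite mule_ge0 ?lee_fin ?pw_ge0// integral_ge0// => x _.
  exact: poweR_ge0.
rewrite /C2 EFinM -muleA lee_wpmul2l ?lee_fin ?pw_ge0//.
apply: (@le_trans _ _ (zsum (fun m => zsum (fun k => (pw 2 1 m)%:E * B m k)))).
  apply: le_zsum => m; rewrite zsumZl ?lee_fin ?pw_ge0//.
  by rewrite lee_wpmul2l ?lee_fin ?pw_ge0.
(* After the exchange, level k collects 2^m 2^(ga (k - m)) over m <= k, which is a multiple of 2^k
   since ga < 1. *)
rewrite zsum_zsum; last by move=> m k; rewrite mule_ge0 ?lee_fin ?pw_ge0.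
rewrite -zsumZl ?lee_fin ?mulr_ge0 ?(ltW C0) ?(ltW gg0)//; last first.
  by move=> k; apply: (mule_ge0 _ (A0 k)); rewrite lee_fin pw_ge0.
apply: le_zsum => k.
apply: (@le_trans _ _ (A k * (C * pw 2 ga k)%:E *
   zsum (fun m => if (m <= k)%R then (pw 2 (1 - ga) m)%:E else 0))).
  rewrite -zsumZl; last 2 first.
  - by rewrite mule_ge0// lee_fin mulr_ge0 ?pw_ge0 ?(ltW C0).
  - by move=> m; case: ifP; rewrite ?lee_fin ?pw_ge0.
  apply: le_zsum => m; rewrite /B; case: ifPn => mk; last by rewrite !mule0.
  rewrite muleA [leLHS]muleC -[leRHS]muleA lee_wpmul2l// -!EFinM lee_fin.
  rewrite pwB// pwDt// pwNt.
  by rewrite le_eqVlt; apply/orP; left; apply/eqP; ring.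
apply: le_trans (lee_wpmul2l _ (zsum_geo_le k (ltr1n _ 2) ga1)) _.
  by rewrite mule_ge0// lee_fin mulr_ge0 ?pw_ge0 ?(ltW C0).
rewrite -/(A k) muleA [leRHS]muleC -[leLHS]muleA lee_wpmul2l// -!EFinM lee_fin.
have e1 := pw_neq0 ga k (ltr0n R 2).
rewrite pwDt// pwNt.
by rewrite le_eqVlt; apply/orP; left; apply/eqP; field.
Qed.

End capacity_of_powers.

(** * Layers of a dyadic potential *)

Section truncation.
Local Open Scope ereal_scope.
Context (R : realType).
Variables (V a q s d : R).
Hypotheses (V1 : (1 < V)%R) (a0 : (0 < a)%R) (q0 : (0 < q)%R) (s0 : (0 < s)%R).
Hypotheses (dE : d = (q^-1 - s^-1)%R) (d0 : (0 < d)%R).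
Variables (b W : int -> \bar R).
Hypotheses (b0 : forall j, 0 <= b j) (W0 : forall j, 0 <= W j).
Hypothesis W_decr : forall i j, (i <= j)%R -> W j <= W i.

Let V0 : (0 < V)%R. Proof. exact: lt_trans V1. Qed.

Let two1 : (1 < 2 :> R)%R. Proof. by rewrite ltr1n. Qed.

Let two0 : (0 < 2 :> R)%R. Proof. by []. Qed.

Definition tail J : \bar R :=
  zsum (fun j => if (J <= j)%R then (pw V a j)%:E * b j else 0).

(* The generations at which the potential passes from 2^((k-1)/q) to 2^(k/q). *)
Definition layer k j : bool :=
  [&& W j <= (pw 2 1 k)%:E, (pw 2 q^-1 (k - 1))%:E < tail j &
      tail (j + 1)%R < (pw 2 q^-1 k)%:E].

Definition layer_val k j : \bar R :=
  if layer k j then mine (pw V (- a) j)%:E ((pw 2 (- q^-1) k)%:E * b j) else 0.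

Definition layer_sup k : \bar R := ereal_sup (range (layer_val k)).

Let F0 j : 0 <= (pw V a j)%:E * b j.
Proof. by rewrite mule_ge0 ?lee_fin ?pw_ge0. Qed.

Lemma tail_decr i j : (i <= j)%R -> tail j <= tail i.
Proof.
move=> ij; apply: le_zsum => k; case: ifPn => jk; last by case: ifP.
by rewrite (le_trans ij jk).
Qed.

Lemma layer_val_ge0 k j : 0 <= layer_val k j.
Proof.
rewrite /layer_val; case: ifP => // _.
by rewrite le_min mule_ge0 ?lee_fin ?pw_ge0.
Qed.

Lemma layer_sup_ge0 k : 0 <= layer_sup k.
Proof.
apply: le_trans (layer_val_ge0 k 0%Z) _.
by apply: ereal_sup_ubound; exists 0%Z.
Qed.

Let ga := geo V a.

Let ga0 : (0 < ga)%R. Proof. exact: geo_gt0. Qed.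

(** The gap between 2^((K-1)/q) and 2^((K-2)/q), in units of 2^(K/q). *)
Let ka : R := (2 `^ (- q^-1) - (2 `^ (- q^-1)) ^+ 2)%R.

Let ka0 : (0 < ka)%R.
Proof.
rewrite subr_gt0 expr2 gtr_pMl ?powR_gt0//.
by rewrite powRN invf_lt1 ?powR_gt1 ?invr_gt0// (lt_trans ltr01) ?powR_gt1
  ?invr_gt0.
Qed.

Let gk0 : (0 <= ga / ka)%R.
Proof. exact: divr_ge0 (ltW ga0) (ltW ka0). Qed.

(** The tail exceeds 2^((K-1)/q) at i and is below 2^((K-2)/q) after j, so the terms of generations
    i to j make up the gap. As W is decreasing, these terms are at most r 2^(dK) V^(am), with a sum
    dominated by V^(aj); hence V^(aj) cannot be small. The exponent is d - 1/q = -1/s. *)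
Lemma layer_scale (r : R) k K j i : (forall m, b m <= r%:E * W m `^ d) ->
  (0 <= r)%R -> (k <= K - 2)%R -> layer k j -> layer K i ->
  (pw V (- a) j <= r * (ga / ka) * pw 2 (- s^-1) K)%R.
Proof.
move=> br r0 kK /and3P[_ _ ujk] /and3P[WK uK _].
have tri : tail i <= tail (j + 1)%R +
    zsum (fun m => if (m <= j)%R then
      (if (i <= m)%R then (pw V a m)%:E * b m else 0) else 0).
  rewrite -zsumD; last 2 first.
  - by move=> m; case: ifP.
  - by move=> m; case: ifP => //; case: ifP.
  apply: le_zsum => m; case: (leP m j) => mj; case: ifP => im //.
  - by case: ifP => _; rewrite ?add0e ?leeDr.
  - by case: ifP => _; rewrite ?adde0.
  - by rewrite lezD1 mj adde0.
  - by rewrite adde0; case: ifP.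
have mid : zsum (fun m => if (m <= j)%R then
      (if (i <= m)%R then (pw V a m)%:E * b m else 0) else 0) <=
    (r * pw 2 d K)%:E * (ga * pw V a j)%:E.
  apply: le_zsum_geo_le => //; first by rewrite lee_fin mulr_ge0 ?pw_ge0.
  move=> m mj; case: ifP => im; last by rewrite mule_ge0// lee_fin ?pw_ge0//
    mulr_ge0 ?pw_ge0.
  rewrite muleC lee_wpmul2r ?lee_fin ?pw_ge0//.
  apply: le_trans (br m) _; rewrite EFinM lee_wpmul2l ?lee_fin//.
  have -> : (pw 2 d K)%:E = (pw 2 1 K)%:E `^ d by rewrite poweR_pw mul1r.
  by rewrite le_poweR ?(ltW d0)//; exact: le_trans (W_decr im) WK.
have lamk : (pw 2 q^-1 k <= pw 2 q^-1 (K - 2) :> R)%R.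
  by rewrite ler_pw ?(ltW two1)// invr_ge0 ltW.
have := lt_le_trans uK (le_trans tri (leeD (ltW ujk) mid)).
rewrite -EFinM -EFinD lte_fin => main.
have {main lamk} : (pw 2 q^-1 (K - 1) < pw 2 q^-1 (K - 2) + r * pw 2 d K * (ga *
  pw V a j))%R.
  by apply: lt_le_trans main _; rewrite lerD2r.
have -> : pw 2 q^-1 (K - 1) = (pw 2 q^-1 K * 2 `^ (- q^-1))%R.
  by rewrite pwB// powRN (pwE _ _ 1) mulr1.
have -> : pw 2 q^-1 (K - 2) = (pw 2 q^-1 K * (2 `^ (- q^-1)) ^+ 2)%R.
  rewrite pwB// (_ : 2 = 1 + 1)%R// pwD// powRN (pwE _ _ 1) mulr1.
  by rewrite expr2 invfM.
rewrite -ltrBlDl -mulrBr -/ka => main.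
have e1 := pw_gt0 a j V0.
have e2 := pw_gt0 q^-1 K two0.
rewrite pwNt -(ler_pM2r e1) mulVf ?gt_eqF// -(ler_pM2r ka0) mul1r.
rewrite -(ler_pM2l e2); apply: le_trans (ltW main) _.
have -> : (pw 2 d K = pw 2 q^-1 K * pw 2 (- s^-1) K)%R by rewrite dE pwDt.
rewrite le_eqVlt; apply/orP; left; apply/eqP; field.
by rewrite gt_eqF.
Qed.

Lemma layer_val_le (r : R) k j : (forall m, b m <= r%:E * W m `^ d) ->
  (0 <= r)%R -> layer_val k j <= (r * pw 2 (- s^-1) k)%:E.
Proof.
move=> br r0; rewrite /layer_val; case: ifP => [/and3P[Wk _ _]|_]; last first.
  by rewrite lee_fin mulr_ge0 ?pw_ge0.
rewrite ge_min; apply/orP; right.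
apply: le_trans (lee_wpmul2l _ (br j)) _; first by rewrite lee_fin pw_ge0.
apply: le_trans (_ : (pw 2 (- q^-1) k)%:E * (r%:E * (pw 2 1 k)%:E `^ d) <= _).
  by rewrite !lee_wpmul2l ?lee_fin ?pw_ge0// le_poweR ?(ltW d0).
rewrite poweR_pw mul1r dE pwDt// !pwNt -!EFinM lee_fin.
have e2 := pw_gt0 q^-1 k two0.
rewrite le_eqVlt; apply/orP; left; apply/eqP; field.
by rewrite !gt_eqF ?pw_gt0.
Qed.

(* Along the chain of cells containing a point, the layers met at level k and
   at a higher level K are separated, and layer_scale then makes the terms of
   the sum decay geometrically below the largest occurring level. *)
Lemma zsum_layer_sup (g : \bar R) : 0 <= g -> (forall j, b j <= g * W j `^ d) ->
  zsum (fun k => (pw 2 1 k)%:E * layer_sup k `^ s) <=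
  ((2 + (ga / ka) `^ s) * geo 2 1)%:E * g `^ s.
Proof.
have C0 : (0 < (2 + (ga / ka) `^ s) * geo 2 1)%R.
  by rewrite mulr_gt0 ?geo_gt0// ltr_wpDr ?powR_ge0.
case: g => [r|_ _|]//; last first.
  by rewrite poweRyr ?gt_eqF// gt0_muley ?lte_fin// leey.
rewrite lee_fin => r0 br.
have sup_le k (c : R) : (0 <= c)%R -> (forall j, layer_val k j <= c%:E) ->
    (pw 2 1 k)%:E * layer_sup k `^ s <= (pw 2 1 k * c `^ s)%:E.
  move=> c0 vc; rewrite EFinM lee_wpmul2l ?lee_fin ?pw_ge0// -poweR_EFin.
  rewrite le_poweR ?(ltW s0) ?layer_sup_ge0//.
  by apply: ge_ereal_sup => _ [j _ <-].
have T0 k : 0 <= (pw 2 1 k)%:E * layer_sup k `^ s.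
  by rewrite mule_ge0 ?lee_fin ?pw_ge0 ?poweR_ge0.
have nolayer k : ~ (exists j, layer k j) -> (pw 2 1 k)%:E * layer_sup k `^ s =
  0.
  move=> nj; have -> : layer_sup k = 0.
    apply/eqP; rewrite eq_le layer_sup_ge0 andbT.
    apply: ge_ereal_sup => _ [j _ <-]; rewrite /layer_val; case: ifPn => // kj.
    by exfalso; apply: nj; exists j.
  by rewrite poweR0r ?gt_eqF// mule0.
(* The restriction to levels at most N makes a highest level K with a nonempty layer exist. *)
apply: zsum_ub => // N.
have [[k [kN [j kj]]]|none] := pselect (exists k, (k <= N)%R /\ exists j, layer
  k j); last first.
  rewrite /zsum esum1; first by rewrite mule_ge0 ?poweR_ge0 ?lee_fin ?(ltW C0).
  move=> k _.
  case: ifPn => // kN; apply: nolayer => kj; apply: none; by exists k.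
have [||K [KN [i Ki]] Kmax] := @int_max_exists
    (fun k => (k <= N)%R /\ exists j, layer k j) k N.
- by split => //; exists j.
- by move=> m [].
apply: le_trans (_ : zsum (fun k => if (k <= K)%R then
    (pw 2 1 k)%:E * layer_sup k `^ s else 0) <= _).
  apply: le_zsum => m; case: ifPn => mN; last by case: ifP.
  case: ifPn => // mK; rewrite nolayer// => mj.
  by have := Kmax m (conj mN mj); rewrite (negbTE mK).
apply: le_trans (le_zsum_geo_le (b := 2) (t := 1) (K := K)
  (c := ((2 + (ga / ka) `^ s) * pw 2 (- 1) K * r `^ s)%:E) two1 ltr01 _ _) _.
- by rewrite lee_fin !mulr_ge0 ?pw_ge0 ?powR_ge0// addr_ge0 ?powR_ge0.
- move=> m mK.
  have pm : (0 <= pw 2 1 m :> R)%R := pw_ge0 _ _ _.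
  (* Levels up to K - 2 are separated from K and use the cap. The levels K - 1 and K use
     [layer_val_le]; there 2^m >= 2^K / 2, which is the summand 2 of the constant. *)
  have [mK2|mK2] := leP m (K - 2)%R.
    have [mj|/nolayer ->] := pselect (exists j, layer m j); last first.
      by rewrite mule_ge0 ?lee_fin ?mulr_ge0 ?pw_ge0 ?powR_ge0// addr_ge0
        ?powR_ge0.
    have c0 : (0 <= r * (ga / ka) * pw 2 (- s^-1) K)%R.
      exact: mulr_ge0 (mulr_ge0 r0 gk0) (pw_ge0 _ _ _).
    apply: le_trans (sup_le m _ c0 _) _.
      move=> l; rewrite /layer_val; case: ifPn => [ml|_];
        last by rewrite lee_fin.
      rewrite ge_min lee_fin; apply/orP; left.
      exact: layer_scale br r0 mK2 ml Ki.
    rewrite -EFinM lee_fin mulrC ler_wpM2r//.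
    rewrite powRM ?pw_ge0//; last exact: mulr_ge0 r0 gk0.
    rewrite powRM//.
    rewrite pw_powR mulNr mulVf ?gt_eqF//.
    rewrite [leLHS](_ : _ = (ga / ka) `^ s * (pw 2 (- 1) K * r `^ s))%R;
      last by ring.
    by rewrite -[leRHS]mulrA ler_wpM2r ?mulr_ge0 ?pw_ge0 ?powR_ge0// lerDr.
  have c0 : (0 <= r * pw 2 (- s^-1) m)%R by rewrite mulr_ge0 ?pw_ge0.
  apply: le_trans (sup_le m _ c0 _) _; first by move=> l; exact: layer_val_le.
  rewrite -EFinM lee_fin powRM ?pw_ge0// pw_powR mulNr mulVf ?gt_eqF// pwNt.
  rewrite mulrCA mulfV ?gt_eqF ?pw_gt0// mulr1.
  rewrite mulrAC ler_peMl ?powR_ge0//.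
  apply: (@le_trans _ _ (2 * (pw 2 (- 1) K * pw 2 1 m)))%R; last first.
    by rewrite -[leRHS]mulrA ler_wpM2r ?mulr_ge0 ?pw_ge0// lerDl powR_ge0.
  rewrite pwNt -ler_pdivrMl// mulr1 mulrC ler_pdivlMr ?pw_gt0//.
  have -> : (2^-1 * pw 2 1 K = pw 2 1 (K - 1) :> R)%R.
    by rewrite pwB// mulrC (pwE _ _ 1) mulr1 powRr1.
  rewrite ler_pw ?(ltW two1)//.
  have : (K - 2 + 1 <= m)%R by rewrite lezD1.
  by rewrite (_ : K - 2 + 1 = K - 1)%R//; ring.
rewrite poweR_EFin -!EFinM lee_fin pwNt.
have e := pw_gt0 1 K two0.
rewrite le_eqVlt; apply/orP; left; apply/eqP; field.
by rewrite gt_eqF.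
Qed.

(** Descending from J, suppose the layer sum stays below 1 - 2^(-1/q). Then the tail stays below
    2^(k/q), so each next generation either has tail at most 2^((k-1)/q) or lies in the layer. In
    the layer the minimum is not the cap, which would contribute 1 to the sum; so V^(aj) b_j is
    accounted for exactly, and the full series remains below 2^(k/q), a contradiction. *)
Lemma layer_sum_ge k J : (forall j, W j <= (pw 2 1 k)%:E) ->
  tail J <= (pw 2 q^-1 (k - 1))%:E ->
  (pw 2 q^-1 k)%:E < zsum (fun j => (pw V a j)%:E * b j) ->
  (1 - 2 `^ (- q^-1))%:E <= zsum (fun j => (pw V a j)%:E * layer_val k j).
Proof.
move=> Wk uJ big; rewrite leNgt; apply/negP => small.
have v0 j : 0 <= (pw V a j)%:E * layer_val k j.
  by rewrite mule_ge0 ?lee_fin ?pw_ge0 ?layer_val_ge0.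
have e1 := pw_gt0 q^-1 k two0.
have lamE : pw 2 q^-1 (k - 1) = (pw 2 q^-1 k * 2 `^ (- q^-1))%R.
  by rewrite pwB// powRN (pwE _ _ 1) mulr1.
pose S j := zsum (fun i => if (j <= i)%R then (pw V a i)%:E * layer_val k i else
  0).
have S0 j : 0 <= S j by apply: zsum_ge0 => i; case: ifP.
have Sle j : S j <= zsum (fun j => (pw V a j)%:E * layer_val k j).
  by apply: le_zsum => i; case: ifP.
have bound (x : \bar R) : x <= zsum (fun j => (pw V a j)%:E * layer_val k j) ->
    (pw 2 q^-1 (k - 1))%:E + (pw 2 q^-1 k)%:E * x < (pw 2 q^-1 k)%:E.
  move=> /le_lt_trans/(_ small) xs.
  have : (pw 2 q^-1 k)%:E * x < (pw 2 q^-1 k)%:E * (1 - 2 `^ (- q^-1))%:E.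
    by rewrite lte_pmul2l.
  rewrite -EFinM => h; apply: lt_le_trans (_ : (pw 2 q^-1 (k - 1))%:E + (pw 2
    q^-1 k * (1 - 2 `^ (- q^-1)))%:E <= _).
    by rewrite lteD2lE.
  by rewrite -EFinD lee_fin lamE mulrBr mulr1 addrC subrK.
have claim n : tail (J - n%:Z)%R <= (pw 2 q^-1 (k - 1))%:E + (pw 2 q^-1 k)%:E *
  S (J - n%:Z)%R.
  elim: n => [|n IH].
    by rewrite subr0 (le_trans uJ)// leeDl// mule_ge0// lee_fin ltW.
  have -> : (J - n.+1%:Z = J - n%:Z - 1)%R by rewrite -addn1 PoszD opprD addrA.
  set i := (J - n%:Z)%R in IH *.
  have [ui|ui] := leP (tail (i - 1)%R) (pw 2 q^-1 (k - 1))%:E.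
    by rewrite (le_trans ui)// leeDl// mule_ge0// lee_fin ltW.
  have lay : layer k (i - 1)%R.
    rewrite /layer Wk ui subrK /=; exact: le_lt_trans IH (bound _ (Sle _)).
  have step (Z : int -> \bar R) : (forall j, 0 <= Z j) ->
      zsum (fun j => if (i - 1 <= j)%R then Z j else 0) =
      Z (i - 1)%R + zsum (fun j => if (i <= j)%R then Z j else 0).
    move=> Z0.
    have -> : Z (i - 1)%R = zsum (fun j => if j == (i - 1)%R then Z j else 0).
      by rewrite (@zsum_unique _ _ (i - 1)%R) ?eqxx// => j /eqP/negbTE ->.
    rewrite -zsumD; last 2 first.
    - by move=> j; case: ifP.
    - by move=> j; case: ifP.
    apply: eq_zsum => j; case: (eqVneq j (i - 1)%R) => [->|ji].
      by rewrite lexx (_ : (i <= i - 1)%R = false) ?adde0//; apply/negbTE;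
        rewrite -ltNge gtrBl.
    rewrite add0e (_ : (i - 1 <= j)%R = (i <= j)%R)//.
    by rewrite le_eqVlt eq_sym (negbTE ji)/= -lezD1 subrK.
  have vi : (pw V a (i - 1))%:E * b (i - 1)%R <=
      (pw 2 q^-1 k)%:E * ((pw V a (i - 1))%:E * layer_val k (i - 1)%R).
    have : (pw V a (i - 1))%:E * layer_val k (i - 1)%R < 1.
      apply: le_lt_trans (zsum_ge (F := fun j => (pw V a j)%:E * layer_val k j)
        (i - 1)%R v0) _.
      by apply: lt_trans small _; rewrite lte_fin gtrBl powR_gt0.
    rewrite /layer_val lay minEle; case: ifP => _.
      by rewrite -EFinM pwNt divff ?gt_eqF ?pw_gt0// ltxx.
    move=> _; rewrite pwNt muleCA [X in _ <= _ * X]muleA -EFinM.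
    by rewrite mulfV ?gt_eqF// mul1e.
  rewrite {1}/tail /S !step// ge0_muleDr//; last first.
    by apply: zsum_ge0 => j; case: ifP.
  apply: le_trans (leeD vi IH) _.
  by rewrite -/(S i) addeCA.
move: big; apply/negP; rewrite -leNgt.
apply: le_trans (_ : (pw 2 q^-1 (k - 1))%:E + (pw 2 q^-1 k)%:E *
   zsum (fun j => (pw V a j)%:E * layer_val k j) <= _); last exact/ltW/bound.
apply: zsum_ub_ge => // i.
have [iJ|Ji] := leP i J.
  have := claim `|J - i|%N.
  have -> : (J - `|J - i|%N%:Z)%R = i by rewrite gez0_abs ?subr_ge0// opprB
    addrC subrK.
  move=> /le_trans; apply; rewrite leeD2l// lee_wpmul2l ?lee_fin ?(ltW e1)//.
apply: le_trans (tail_decr (ltW Ji)) _; apply: (le_trans uJ).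
by rewrite leeDl// mule_ge0 ?lee_fin ?(ltW e1)// zsum_ge0.
Qed.

End truncation.

(** * Layers as test functions: the weighted inequality for the dyadic potential *)

Section dyadic_capacitary_inequality.
Local Open Scope ereal_scope.
Context d (T : measurableType d) (R : realType)
  (mu : {sigma_finite_measure set T -> \bar R}) (V K : R)
  (same near : int -> T -> set T) (G : dyadic_grid mu V K same near).
Implicit Types (f g h : T -> \bar R) (i j k : int) (a s p : R).

Local Notation avg := (avg mu V near).
Local Notation maxf := (maxf mu V near).
Local Notation pot := (pot mu V near).

Let V0 : (0 < V)%R := grid_V0 G.
Let V1 : (1 < V)%R := grid_V G.

(** Hoelder on the whole space for u and v times the indicator of the neighbourhood; the normalising
    factors match because the exponents are conjugate. *)
Lemma avg_hoelder (u v : T -> R) p p' j x :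
  measurable_fun setT u -> measurable_fun setT v ->
  (forall y, 0 <= u y)%R -> (forall y, 0 <= v y)%R ->
  (0 < p)%R -> (0 < p')%R -> (p^-1 + p'^-1 = 1)%R ->
  avg j (fun y => (u y * v y)%:E) x <=
  (avg j (fun y => (u y `^ p)%:E) x) `^ p^-1 *
  (avg j (fun y => (v y `^ p')%:E) x) `^ p'^-1.
Proof.
move=> mu' mv u0 v0 p0 p'0 pp'.
have mP := measurable_near G j x.
have trunc (f : T -> R) r : measurable_fun setT f -> (forall y, 0 <= f y)%R ->
    (0 < r)%R ->
    \int[mu]_y (`|f y * \1_(near j x) y|%:E `^ r) =
    \int[mu]_(y in near j x) (f y `^ r)%:E.
  move=> mf f0 r0; rewrite [in RHS]integral_indicE; apply: eq_integral => y _.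
  rewrite indicE; case: (y \in _); rewrite ?mulr1 ?mul1e ?mulr0 ?mul0e.
    by rewrite ger0_norm.
  by rewrite normr0 poweR0r// gt_eqF.
have mI : measurable_fun setT (\1_(near j x) : T -> R) by exact:
  measurable_indic.
have := hoelder mu (measurable_funM mu' mI) (measurable_funM mv mI) p0 p'0 pp'.
have NE (f : T -> R) r : (0 < r)%R -> 'N[mu]_r%:E[EFin \o f] = (\int[mu]_y (`|f
  y|%:E `^ r)) `^ r^-1.
  by move=> r0; rewrite unlock.
rewrite Lnorm1 !NE//= !trunc// => H.
have c0 : (0 <= pw V (-1) j :> R)%R by exact: pw_ge0.
rewrite /avg !poweRM ?lee_fin//; last 2 first.
- by apply: integral_ge0 => y _; rewrite lee_fin powR_ge0.
- by apply: integral_ge0 => y _; rewrite lee_fin powR_ge0.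
rewrite muleACA -poweRDp ?invr_gt0// pp' poweRe1 ?lee_fin//.
rewrite lee_wpmul2l ?lee_fin//; apply: le_trans H.
rewrite [leLHS]integral_indicE le_eqVlt; apply/orP; left; apply/eqP.
apply: eq_integral => y _; rewrite indicE /=.
case: (y \in _); rewrite ?mulr1 ?mul1e ?mulr0 ?mul0r ?mul0e ?normr0//.
by rewrite ger0_norm// mulr_ge0.
Qed.

Variables (a s q e eta : R).
Hypotheses (a0 : (0 < a)%R) (s1 : (1 < s)%R) (as1 : (a * s < 1)%R).
Hypotheses (q1 : (1 <= q)%R) (qs : (q < s)%R) (eE : e = (q^-1 - s^-1)%R).
Hypothesis eta1 : (1 < eta)%R.

Let s0 : (0 < s)%R. Proof. exact: lt_trans s1. Qed.
Let q0 : (0 < q)%R. Proof. exact: lt_le_trans q1. Qed.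
Let eta0 : (0 < eta)%R. Proof. exact: lt_trans eta1. Qed.
Let e0 : (0 < e)%R. Proof. by rewrite eE subr_gt0 ltf_pV2. Qed.

Section layers.
Variables (g w : T -> R).
Hypotheses (mg : measurable_fun setT g) (mw : measurable_fun setT w).
Hypotheses (g0 : forall x, (0 <= g x)%R) (w0 : forall x, (0 <= w x)%R).

Definition prod_fun (y : T) : \bar R := (g y * w y `^ e)%:E.

Definition prod_avg x j : \bar R := avg j prod_fun x.

Definition weight_avg x j : \bar R :=
  (avg j (fun y => (w y `^ eta)%:E) x) `^ eta^-1.

(** The supremum over the coarser generations makes the weight averages decreasing in j, as
    [layer_scale] requires, and still depends only on the cell of generation j. *)
Definition weight_sup x j : \bar R :=
  ereal_sup (range (fun i => if (j <= i)%R then weight_avg x i else 0)).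

Definition layer_fun k x : \bar R :=
  layer_sup V a q (prod_avg x) (weight_sup x) k.

Let mweta : measurable_fun setT (fun y => (w y `^ eta)%:E).
Proof. by apply/measurable_EFinP; exact: measurableT_comp (measurable_powR _)
  mw. Qed.

Let weta0 y : 0 <= (w y `^ eta)%:E :> \bar R.
Proof. by rewrite lee_fin powR_ge0. Qed.

Lemma measurable_prod_fun : measurable_fun setT prod_fun.
Proof.
apply/measurable_EFinP; apply: measurable_funM => //.
exact: measurableT_comp (measurable_powR _) mw.
Qed.

Lemma prod_fun_ge0 y : 0 <= prod_fun y.
Proof. by rewrite lee_fin mulr_ge0 ?powR_ge0. Qed.

Let mprod := measurable_prod_fun.
Let prod0 := prod_fun_ge0.

Lemma prod_avg_ge0 x j : 0 <= prod_avg x j.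
Proof. exact: avg_ge0. Qed.

Lemma weight_avg_ge0 x j : 0 <= weight_avg x j.
Proof. exact: poweR_ge0. Qed.

Lemma weight_sup_ge0 x j : 0 <= weight_sup x j.
Proof.
apply: le_trans (weight_avg_ge0 x j) _.
by apply: ereal_sup_ubound; exists j => //; rewrite lexx.
Qed.

Lemma weight_sup_decr x i j : (i <= j)%R -> weight_sup x j <= weight_sup x i.
Proof.
move=> ij; apply: ge_ereal_sup => _ [k _ <-].
case: ifP => jk; last exact: weight_sup_ge0.
by apply: ereal_sup_ubound; exists k => //; rewrite (le_trans ij jk).
Qed.

Lemma weight_avg_le_sup x j : weight_avg x j <= weight_sup x j.
Proof. by apply: ereal_sup_ubound; exists j => //; rewrite lexx. Qed.

Lemma weight_sup_le x k j :
  maxf (fun y => (w y `^ eta)%:E) x <= (pw 2 eta k)%:E ->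
  weight_sup x j <= (pw 2 1 k)%:E.
Proof.
move=> wk; apply: ge_ereal_sup => _ [i _ <-].
case: ifP => _; last by rewrite lee_fin pw_ge0.
rewrite /weight_avg.
have -> : (pw 2 1 k)%:E = (pw 2 eta k)%:E `^ eta^-1.
  by rewrite poweR_pw divff// gt_eqF.
rewrite le_poweR ?invr_ge0 ?(ltW eta0) ?avg_ge0//.
exact: le_trans (avg_le_maxf _ _ _ _ _ _) wk.
Qed.

Lemma measurable_prod_avg j : measurable_fun setT (prod_avg ^~ j).
Proof. exact: (measurable_avg G). Qed.

Lemma measurable_weight_sup j : measurable_fun setT (weight_sup ^~ j).
Proof.
apply: measurable_ereal_sup_int => i; case: (boolP (j <= i)%R) => // _.
exact/measurable_fun_poweR/(measurable_avg G).
Qed.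

Lemma measurable_tail J : measurable_fun setT (fun x => tail V a (prod_avg x)
  J).
Proof.
apply: emeasurable_fun_zsum => j; last first.
  by move=> x; case: ifP => // _; rewrite mule_ge0 ?lee_fin ?pw_ge0
    ?prod_avg_ge0.
case: (boolP (J <= j)%R) => // _.
exact/measurable_funeM/measurable_prod_avg.
Qed.

Lemma measurable_layer_val k j :
  measurable_fun setT (fun x => layer_val V a q (prod_avg x) (weight_sup x) k
    j).
Proof.
rewrite /layer_val; apply: measurable_fun_ifT => //; last first.
  apply: measurable_mine => //; exact/measurable_funeM/measurable_prod_avg.
apply: (measurable_fun_bool true); rewrite setTI.
rewrite (_ : _ @^-1` _ = [set x | weight_sup x j <= (pw 2 1 k)%:E] `&`
  ([set x | (pw 2 q^-1 (k - 1))%:E < tail V a (prod_avg x) j] `&`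
   ~` [set x | (pw 2 q^-1 k)%:E <= tail V a (prod_avg x) (j + 1)%R])).
  apply: measurableI; first exact/measurable_set_le/measurable_weight_sup.
  apply: measurableI; first exact/measurable_set_gt/measurable_tail.
  exact/measurableC/measurable_set_ge/measurable_tail.
apply/seteqP; split => x /=.
  by move=> /and3P[? ? ?]; split => //; split => //; apply/negP; rewrite -ltNge.
by move=> [? [? /negP]]; rewrite -ltNge => ?; apply/and3P.
Qed.

Lemma measurable_layer_fun k : measurable_fun setT (layer_fun k).
Proof. by apply: measurable_ereal_sup_int => j;
  exact: measurable_layer_val. Qed.

Lemma layer_fun_ge0 k x : 0 <= layer_fun k x.
Proof. by apply: layer_sup_ge0 => j; exact: prod_avg_ge0. Qed.

(** All ingredients involve generations from j on, and these do not separate x from y. *)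
Lemma layer_val_same k j x y : same j x y ->
  layer_val V a q (prod_avg x) (weight_sup x) k j =
  layer_val V a q (prod_avg y) (weight_sup y) k j.
Proof.
move=> xy.
have up i : (j <= i)%R -> same i x y by move=> ji;
  exact: same_up G _ _ _ _ ji xy.
have bE i : (j <= i)%R -> prod_avg x i = prod_avg y i.
  by move=> /up; exact: (avg_same G).
have tE i : (j <= i)%R -> tail V a (prod_avg x) i = tail V a (prod_avg y) i.
  move=> ji; apply: eq_zsum => m; case: ifP => // im.
  by rewrite bE// (le_trans ji).
have WE : weight_sup x j = weight_sup y j.
  rewrite /weight_sup (_ : (fun i => if _ then weight_avg x i else 0) =
    (fun i => if (j <= i)%R then weight_avg y i else 0))//.
  apply/funext => i; case: ifP => // /up xyi.
  by rewrite /weight_avg (avg_same G _ xyi).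
by rewrite /layer_val /layer WE !tE ?lerDl// bE.
Qed.

(** Hoelder exponent chosen so that (w^e)^r' = w^eta; r is its conjugate. *)
Let r' := (eta / e)%R.
Let r := ((1 - r'^-1)^-1)%R.

Let r'0 : (0 < r')%R. Proof. exact: divr_gt0. Qed.

(** Here eta > 1 enters: 1/r = 1 - e/eta > 1 - e >= 1/s, the last step by q >= 1. *)
Let rV : (s^-1 < r^-1)%R.
Proof.
rewrite /r invrK /r' invf_div ltrBrDl -ltrBrDr.
apply: (@lt_le_trans _ _ e); first by rewrite ltr_pdivrMr// ltr_pMr.
by rewrite eE lerD2r invf_le1.
Qed.

Let r0 : (0 < r)%R.
Proof. by rewrite -invr_gt0 (lt_trans _ rV)// invr_gt0. Qed.

Let rV0 : (0 <= r^-1)%R. Proof. by rewrite invr_ge0 ltW. Qed.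

Definition g_max x : \bar R := (maxf (fun y => (g y `^ r)%:E) x) `^ r^-1.

Let mgr : measurable_fun setT (fun y => (g y `^ r)%:E).
Proof. by apply/measurable_EFinP; exact: measurableT_comp (measurable_powR _)
  mg. Qed.

Let gr0 y : 0 <= (g y `^ r)%:E :> \bar R.
Proof. by rewrite lee_fin powR_ge0. Qed.

Lemma prod_avg_le_avg x j : prod_avg x j <=
  (avg j (fun y => (g y `^ r)%:E) x) `^ r^-1 * weight_sup x j `^ e.
Proof.
have mwd : measurable_fun setT (fun y => w y `^ e)%R.
  exact: measurableT_comp (measurable_powR _) mw.
have rr' : (r^-1 + r'^-1 = 1)%R by rewrite /r invrK subrK.
apply: le_trans (avg_hoelder j x mg mwd g0 _ r0 r'0 rr') _.
  by move=> y; exact: powR_ge0.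
rewrite lee_wpmul2l ?poweR_ge0//.
rewrite (_ : (fun y => _) = (fun y => (w y `^ eta)%:E)); last first.
  by apply/funext => y; rewrite -powRrM /r' mulrC divfK// gt_eqF.
rewrite /r' invf_div mulrC poweRrM.
by apply: le_poweR; [exact: ltW|exact: weight_avg_ge0|exact: weight_avg_le_sup].
Qed.

Lemma prod_avg_le x j : prod_avg x j <= g_max x * weight_sup x j `^ e.
Proof.
apply: le_trans (prod_avg_le_avg x j) _.
rewrite lee_wpmul2r ?poweR_ge0//; apply: le_poweR; first exact: rV0.
  exact: avg_ge0.
exact: avg_le_maxf.
Qed.

Lemma measurable_g_max : measurable_fun setT g_max.
Proof. exact/measurable_fun_poweR/(measurable_maxf G). Qed.

Lemma g_max_ge0 x : 0 <= g_max x. Proof. exact: poweR_ge0. Qed.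

(** The average of g^r, to the power 1/r, is at most a multiple of V^(-j/s) at generation j, and a s
    < 1 makes V^(aj) V^(-j/s) summable over coarse generations. This yields the starting generation
    J of [layer_sum_ge]. *)
Lemma tail_small x k : \int[mu]_y g_max y `^ s < +oo ->
  (forall j, weight_sup x j <= (pw 2 1 k)%:E) -> forall c : R, (0 < c)%R ->
  exists J, tail V a (prod_avg x) J <= c%:E.
Proof.
move=> gfin Wk c c0.
have G0 : 0 <= \int[mu]_y g_max y `^ s by apply: integral_ge0 => y _;
  exact: poweR_ge0.
have [B BE] : exists B : R, \int[mu]_y g_max y `^ s = B%:E.
  by exists (fine (\int[mu]_y g_max y `^ s)); rewrite fineK// ge0_fin_numE.
have B0 : (0 <= B)%R by rewrite -lee_fin -BE.
pose t := (s^-1 - a)%R.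
have t0 : (0 < t)%R by rewrite subr_gt0 -[X in (_ < X)%R]mul1r ltr_pdivlMr.
pose D := (B `^ s^-1 * pw 2 e k)%R.
have D0 : (0 <= D)%R by rewrite mulr_ge0 ?powR_ge0 ?pw_ge0.
have gt0' := geo_gt0 V1 t0.
have Dg1 : (0 < D * geo V t + 1)%R by rewrite ltr_wpDl// mulr_ge0// ltW.
have [|N hN] := @pw_small _ V t (c / (D * geo V t + 1)) V1 t0;
  first by rewrite divr_gt0.
exists N%:Z.
apply: le_trans (le_zsum_geo_ge (c := D%:E) (K := N%:Z) V1 t0 _ _) _.
- by rewrite lee_fin.
- move=> j _.
  have b1 : (avg j (fun y => (g y `^ r)%:E) x) `^ r^-1 <=
      ((pw V (-1) j * B)%:E) `^ s^-1.
    rewrite -(@poweR_ler _ s) ?poweR_ge0// poweRVK ?gt_eqF//; last first.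
      by rewrite lee_fin mulr_ge0 ?pw_ge0.
    rewrite EFinM -BE.
    apply: (cell_le_integral G (x := x)); rewrite ?(ltW s0) ?poweR_ge0//.
    - exact: measurable_g_max.
    - by move=> y; exact: g_max_ge0.
    - move=> y xy; rewrite (avg_same G _ xy); apply: le_poweR; first exact: rV0.
        exact: avg_ge0.
      exact: avg_le_maxf.
  apply: le_trans (lee_wpmul2l _ (prod_avg_le_avg x j)) _.
    by rewrite lee_fin pw_ge0.
  apply: le_trans (_ : (pw V a j)%:E * (((pw V (-1) j * B)%:E) `^ s^-1 *
      (pw 2 1 k)%:E `^ e) <= _).
    rewrite lee_wpmul2l ?lee_fin ?pw_ge0//.
    apply: lee_pmul; rewrite ?poweR_ge0//.
    by rewrite le_poweR ?(ltW e0) ?weight_sup_ge0.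
  rewrite poweR_pw mul1r poweR_EFin powRM ?pw_ge0// pw_powR -!EFinM lee_fin.
  rewrite /D /t opprB pwDt// mulN1r.
  by rewrite le_eqVlt; apply/orP; left; apply/eqP; ring.
rewrite -EFinM lee_fin pwNt -pwN.
have := ltW hN; rewrite ler_pdivlMr// => /(le_trans _); apply.
have := pw_ge0 V t (- N%:Z); move: (pw _ _ _) => p p0.
by rewrite mulrA [leLHS]mulrC ler_wpM2l// lerDl.
Qed.

(** The layer value of generation j is constant on the cell of that generation, so the average of
    [layer_fun] dominates it and the potential dominates the series of layer values. *)
Lemma layer_fun_pot k x : \int[mu]_y g_max y `^ s < +oo ->
  maxf (fun y => (w y `^ eta)%:E) x <= (pw 2 eta k)%:E ->
  (pw 2 q^-1 k)%:E < pot a prod_fun x ->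
  (1 - 2 `^ (- q^-1))%:E <= pot a (layer_fun k) x.
Proof.
move=> gfin /weight_sup_le Wk big.
have [J uJ] := tail_small gfin Wk (pw_gt0 q^-1 (k - 1) (ltr0n R 2)).
apply: le_trans (layer_sum_ge (q := q) V1 (prod_avg_ge0 x) Wk uJ big) _ => //.
apply: le_zsum => j; rewrite lee_wpmul2l ?lee_fin ?pw_ge0//.
apply: (avg_ge_cell G).
- exact: measurable_layer_fun.
- by move=> y; exact: layer_fun_ge0.
- by apply: layer_val_ge0; exact: prod_avg_ge0.
- move=> y /layer_val_same ->; apply: ereal_sup_ubound.
  by exists j.
Qed.

Lemma maximal_exponent_gt1 : (1 < s / r)%R.
Proof. by rewrite ltr_pdivlMr// mul1r -ltf_pV2 ?posrE. Qed.

Lemma g_max_poweR y : g_max y `^ s = maxf (fun y => (g y `^ r)%:E) y `^ (s / r).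
Proof. by rewrite /g_max -poweRrM mulrC. Qed.

Lemma g_poweR y : (g y `^ r)%:E `^ (s / r) = (g y `^ s)%:E.
Proof. by rewrite poweR_EFin -powRrM mulrC divfK// gt_eqF. Qed.

End layers.

Lemma integral_g_max : exists2 C : R, (0 < C)%R & forall g : T -> R,
  measurable_fun setT g -> (forall x, 0 <= g x)%R ->
  \int[mu]_x g_max g x `^ s <= C%:E * \int[mu]_x (g x `^ s)%:E.
Proof.
have [C C0 HC] := maximal_strong_type G maximal_exponent_gt1.
exists C => // g mg g0.
rewrite (eq_integral (fun x => maxf (fun y => (g y `^ (1 - (eta / e)^-1)^-1)%:E)
  x
    `^ (s / (1 - (eta / e)^-1)^-1))); last by move=> x _; exact: g_max_poweR.
apply: le_trans (HC _ _ _) _.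
- by apply/measurable_EFinP; exact: measurableT_comp (measurable_powR _) mg.
- by move=> x; rewrite lee_fin powR_ge0.
rewrite (eq_integral (fun x => (g x `^ s)%:E))// => x _.
exact: g_poweR.
Qed.

Lemma layer_bound : exists2 C : R, (0 < C)%R & forall g w : T -> R,
  measurable_fun setT g -> measurable_fun setT w ->
  (forall x, 0 <= g x)%R -> (forall x, 0 <= w x)%R ->
  zsum (fun k => (pw 2 1 k)%:E * \int[mu]_x layer_fun g w k x `^ s) <=
  C%:E * \int[mu]_x (g x `^ s)%:E.
Proof.
have [C C0 HC] := integral_g_max.
pose D := ((2 + (geo V a / (2 `^ (- q^-1) - (2 `^ (- q^-1)) ^+ 2)) `^ s) * geo 2
  1)%R.
have D0 : (0 < D)%R by rewrite mulr_gt0 ?geo_gt0 ?ltr1n// ltr_wpDr ?powR_ge0.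
exists (D * C)%R; first by rewrite mulr_gt0.
move=> g w mg mw g0 w0.
have ml k : measurable_fun setT (layer_fun g w k) by exact:
  measurable_layer_fun.
have l0 k x : 0 <= layer_fun g w k x by exact: layer_fun_ge0.
have mls k : measurable_fun setT (fun x => (pw 2 1 k)%:E * layer_fun g w k x `^
  s).
  exact/measurable_funeM/measurable_fun_poweR.
have ls0 k x : 0 <= (pw 2 1 k)%:E * layer_fun g w k x `^ s.
  by rewrite mule_ge0 ?lee_fin ?pw_ge0 ?poweR_ge0.
have mgm : measurable_fun setT (g_max g) by exact: measurable_g_max.
rewrite (eq_zsum (G := fun k => \int[mu]_x ((pw 2 1 k)%:E * layer_fun g w k x `^
  s))); last first.
  move=> k; rewrite ge0_integralZl ?lee_fin ?pw_ge0//.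
    exact: measurable_fun_poweR.
  by move=> x _; exact: poweR_ge0.
rewrite -(integral_zsum mu measurableT)//.
apply: le_trans (_ : \int[mu]_x (D%:E * g_max g x `^ s) <= _).
  apply: le_integral.
  - by move=> x; exact: zsum_ge0.
  - move=> x; apply: (zsum_layer_sup V1 a0 q0 s0 eE e0).
    + by move=> j; exact: prod_avg_ge0.
    + by move=> j; exact: weight_sup_ge0.
    + by move=> i j; exact: weight_sup_decr.
    + exact: g_max_ge0.
    + by move=> j; exact: prod_avg_le.
  - exact: emeasurable_fun_zsum.
  - exact/measurable_funeM/measurable_fun_poweR.
rewrite ge0_integralZl ?lee_fin ?(ltW D0)//; last 2 first.
- exact: measurable_fun_poweR.
- by move=> x _; exact: poweR_ge0.
by rewrite (EFinM D C) -muleA lee_wpmul2l ?lee_fin ?(ltW D0)// HC.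
Qed.

End dyadic_capacitary_inequality.

Section dyadic_theorem.
Local Open Scope ereal_scope.
Context d (T : measurableType d) (R : realType)
  (mu : {sigma_finite_measure set T -> \bar R}) (V K : R)
  (same near : int -> T -> set T) (G : dyadic_grid mu V K same near).

Local Notation pot := (pot mu V near).

Lemma dyadic_weighted_capacitary_inequality (a s q : R) :
  (0 < a)%R -> (1 < s)%R -> (a * s < 1)%R -> (1 <= q)%R -> (q < s)%R ->
  exists2 C : R, (0 < C)%R & forall (g w : T -> R) (h : int -> T -> \bar R),
    measurable_fun setT g -> measurable_fun setT w ->
    (forall x, 0 <= g x)%R -> (forall x, 0 <= w x)%R ->
    (forall k, measurable_fun setT (h k)) -> (forall k x, 0 <= h k x) ->
    (forall k x, (pw 2 1 k < w x)%R -> 1 <= pot a (h k) x) ->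
    \int[mu]_x (g x `^ s)%:E < +oo ->
  exists psi : int -> T -> \bar R,
    [/\ forall k, measurable_fun setT (psi k), forall k x, 0 <= psi k x,
     forall k x, (pw 2 q^-1 k)%:E <
       pot a (fun y => (g y * w y `^ (q^-1 - s^-1))%:E) x -> 1 <= pot a (psi k)
         x &
     zsum (fun k => (pw 2 1 k)%:E * \int[mu]_x psi k x `^ s) <=
     C%:E * (\int[mu]_x (g x `^ s)%:E +
             zsum (fun k => (pw 2 1 k)%:E * \int[mu]_x h k x `^ s))].
Proof.
move=> a0 s1 as1 q1 qs.
have s0 : (0 < s)%R by exact: lt_trans s1.
have q0 : (0 < q)%R by exact: lt_le_trans q1.
have [eta eta1 [C1 C10 HC1]] := capacity_maximal_power G a0 s1 as1.
have [C2 C20 HC2] := layer_bound G a0 s1 q1 qs (erefl (q^-1 - s^-1)%R) eta1.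
have [C3 C30 HC3] := integral_g_max G s1 q1 qs (erefl (q^-1 - s^-1)%R) eta1.
(* The lower bound of [layer_fun_pot]; dividing the layer function by it gives potential at least
   1. *)
pose c : R := (1 - 2 `^ (- q^-1))%R.
have c0 : (0 < c)%R.
  by rewrite subr_gt0 powRN invf_lt1 ?powR_gt0// powR_gt1 ?ltr1n ?invr_gt0.
pose D := (C1 + (c^-1) `^ s * C2)%R.
have cs0 : (0 < (c^-1) `^ s)%R by rewrite powR_gt0 ?invr_gt0.
exists D; first by rewrite addr_gt0 ?mulr_gt0.
move=> g w h mg mw g0 w0 mh h0 hw gfin.
have [psi [mpsi psi0 ppsi npsi]] := HC1 w h mw w0 mh h0 hw.
pose l k x := layer_fun mu V near a q (q^-1 - s^-1)%R eta g w k x.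
have ml k : measurable_fun setT (l k) by exact: (measurable_layer_fun G).
have l0 k x : 0 <= l k x by exact: layer_fun_ge0.
pose l' k x := (c^-1)%:E * l k x.
have ml' k : measurable_fun setT (l' k) by exact: measurable_funeM.
have cV0 : (0 <= c^-1)%R by rewrite invr_ge0 ltW.
have l'0 k x : 0 <= l' k x by rewrite mule_ge0.
pose f k x := maxe (psi k x) (l' k x).
have mf k : measurable_fun setT (f k) by exact: measurable_maxe.
have f0 k x : 0 <= f k x by rewrite le_max psi0.
exists f; split => //.
  move=> k x big.
  have [wk|wk] := ltP (pw 2 eta k)%:E (maxf mu V near (fun y => (w y `^ eta)%:E)
    x).
    apply: le_trans (ppsi _ _ wk) _.
    by apply: (le_pot G) => // y; rewrite /f le_max lexx.
  apply: (@le_trans _ _ (pot a (l' k) x)); last first.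
    by apply: (le_pot G) => // y; rewrite /f le_max lexx orbT.
  rewrite (potZl G)// [leLHS](_ : 1 = (c^-1)%:E * c%:E); last first.
    by rewrite -EFinM mulVf// gt_eqF.
  rewrite lee_wpmul2l//.
  have gmax : \int[mu]_x g_max mu V near (q^-1 - s^-1)%R eta g x `^ s < +oo.
    by apply: le_lt_trans (HC3 g mg g0) _; rewrite lte_mul_pinfty// lee_fin ltW.
  exact: (layer_fun_pot G s1 as1 q1 qs (erefl _) eta1 mg mw g0 gmax wk big).
pose A k := \int[mu]_x psi k x `^ s.
pose B k := \int[mu]_x l k x `^ s.
have A0 k : 0 <= A k by apply: integral_ge0 => x _; exact: poweR_ge0.
have B0 k : 0 <= B k by apply: integral_ge0 => x _; exact: poweR_ge0.
have I0 : 0 <= \int[mu]_x (g x `^ s)%:E.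
  by apply: integral_ge0 => x _; rewrite lee_fin powR_ge0.
set Z := zsum (fun k => (pw 2 1 k)%:E * \int[mu]_x h k x `^ s) in npsi *.
have Z0 : 0 <= Z.
  apply: zsum_ge0 => k; rewrite mule_ge0 ?lee_fin ?pw_ge0//.
  by apply: integral_ge0 => x _; exact: poweR_ge0.
have fAB k : \int[mu]_x f k x `^ s <= A k + (c^-1 `^ s)%:E * B k.
  apply: le_trans (_ : \int[mu]_x (psi k x `^ s + l' k x `^ s) <= _).
    apply: le_integral.
    - by move=> x; exact: poweR_ge0.
    - by move=> x; exact: poweR_max_le.
    - exact: measurable_fun_poweR.
    - by apply: emeasurable_funD; exact: measurable_fun_poweR.
  rewrite ge0_integralD//; last 4 first.
  - by move=> x _; exact: poweR_ge0.
  - exact: measurable_fun_poweR.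
  - by move=> x _; exact: poweR_ge0.
  - exact: measurable_fun_poweR.
  rewrite leeD2l// /B -ge0_integralZl ?lee_fin ?powR_ge0//; last 2 first.
  - exact: measurable_fun_poweR.
  - by move=> x _; exact: poweR_ge0.
  rewrite le_eqVlt; apply/orP; left; apply/eqP; apply: eq_integral => x _.
  by rewrite poweRM ?lee_fin.
apply: le_trans (_ : zsum (fun k => (pw 2 1 k)%:E * A k) +
    (c^-1 `^ s)%:E * zsum (fun k => (pw 2 1 k)%:E * B k) <= _).
  have pk0 k : 0 <= (pw 2 1 k)%:E :> \bar R by rewrite lee_fin pw_ge0.
  rewrite -zsumZl ?lee_fin ?powR_ge0//; last by move=> k; rewrite mule_ge0.
  rewrite -zsumD; last 2 first.
  - by move=> k; rewrite mule_ge0.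
  - by move=> k; rewrite mule_ge0 ?lee_fin ?powR_ge0// mule_ge0.
  apply: le_zsum => k; apply: le_trans (lee_wpmul2l (pk0 k) (fAB k)) _.
  by rewrite ge0_muleDr ?mule_ge0 ?lee_fin ?powR_ge0// muleCA.
apply: le_trans (leeD npsi (lee_wpmul2l _ (HC2 g w mg mw g0 w0))) _.
  by rewrite lee_fin powR_ge0.
rewrite muleA -EFinM /D EFinD ge0_muleDl ?lee_fin ?(ltW C10) ?mulr_ge0 ?(ltW
  cs0) ?(ltW C20)//.
apply: leeD; rewrite lee_wpmul2l ?lee_fin ?(ltW C10) ?mulr_ge0 ?(ltW cs0) ?(ltW
  C20)//.
  by rewrite leeDr.
by rewrite leeDl.
Qed.

End dyadic_theorem.

(** * The dyadic grid of R^n and the Riesz potential *)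

Section lebesgue_Rn_sigma_finite.
Context (R : realType) (n : nat).
Local Notation Rn := (Rspace R n).

Lemma measurable_Rspace (A : set (n.-tuple (measurableTypeR R))) :
  measurable A -> measurable (A : set Rn).
Proof. by move=> mA; apply: sub_caratheodory; exact: sub_sigma_algebra. Qed.

Lemma lebesgue_RnE (A : set (n.-tuple (measurableTypeR R))) :
  measurable A -> lebesgue_Rn R n A = borel_lebesgue R n A.
Proof. by move=> mA; rewrite -[RHS]measurable_mu_extE. Qed.

Lemma lebesgue_Rn_sigma_finite : sigma_finite [set: Rn] (lebesgue_Rn R n).
Proof. exact/completed_measure_extension_sigma_finite/sigma_finiteT. Qed.

HB.instance Definition _ := Measure_isSigmaFinite.Build _ _ _
  (@completed_measure_extension _ _ _ (borel_lebesgue R n))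
  lebesgue_Rn_sigma_finite.

End lebesgue_Rn_sigma_finite.

(* Locked, since unification would otherwise unfold the construction of the
   measure. *)
HB.lock Definition lebesgue_Rn_sf (R : realType) (n : nat) :
    {sigma_finite_measure set (Rspace R n) -> \bar R} :=
  @completed_measure_extension _ _ _ (borel_lebesgue R n).

Section grid_of_Rn.
Context (R : realType) (n : nat).
Local Notation Rn := (Rspace R n).

Lemma lebesgue_Rn_sfE (A : set Rn) : lebesgue_Rn_sf R n A = lebesgue_Rn R n A.
Proof. by rewrite lebesgue_Rn_sf.unlock. Qed.

Lemma integral_lebesgue_Rn (D : set Rn) (f : Rn -> \bar R) :
  (\int[lebesgue_Rn R n]_(x in D) f x = \int[lebesgue_Rn_sf R n]_(x in D) f
    x)%E.
Proof. by rewrite lebesgue_Rn_sf.unlock. Qed.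

Lemma measurable_coord (i : 'I_n) : measurable_fun setT (fun x : Rn => coord x
  i).
Proof.
move=> _ Y mY; rewrite setTI; apply: measurable_Rspace.
by rewrite -[X in measurable X]setTI; exact: measurable_tnth.
Qed.

(** Index of the half-open dyadic interval of length 2^j containing t. *)
Definition level (j : int) (t : R) : int := Num.floor (t / pw 2 1 j).

Let p0 j : 0 < pw 2 1 j :> R. Proof. exact: pw_gt0. Qed.

Lemma level_ge j t (m : int) : (m <= level j t) = (m%:~R * pw 2 1 j <= t).
Proof. by rewrite /level Num.Theory.floor_ge_int ler_pdivlMr. Qed.

Lemma level_lt j t (m : int) : (level j t < m) = (t < m%:~R * pw 2 1 j).
Proof. by rewrite /level Num.Theory.floor_lt_int ltr_pdivrMr. Qed.

Lemma level_up j t : (2 * level (j + 1) t <= level j t)%R /\ (level j t < 2 *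
  level (j + 1) t + 2)%R.
Proof.
have pS : pw 2 1 (j + 1) = pw 2 1 j * 2 :> R by rewrite pwS// powRr1.
split.
  rewrite level_ge intrM -mulrA [2%:~R * _]mulrC -mulrA -pS mulrC.
  have := lexx (level (j + 1) t); rewrite {1}level_ge.
  by rewrite mulrC.
rewrite level_lt.
have : (level (j + 1) t < level (j + 1) t + 1)%R by rewrite ltrDl.
rewrite level_lt pS; congr (_ < _); rewrite !intrD intrM; ring.
Qed.

Definition same_cell (j : int) (x y : Rn) : Prop :=
  forall i, level j (coord x i) = level j (coord y i).

Definition near_cell (j : int) (x y : Rn) : Prop :=
  forall i, (level j (coord x i) <= level j (coord y i) + 1)%R /\
            (level j (coord y i) <= level j (coord x i) + 1)%R.

Lemma measurable_coord_set (i : 'I_n) (A : set R) : measurable A ->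
  measurable [set x : Rn | A (coord x i)].
Proof.
move=> mA; rewrite -[X in measurable X]setTI.
by have := measurable_coord i measurableT mA.
Qed.

Lemma levelE j (m : int) :
  [set t : R | level j t = m] = `[m%:~R * pw 2 1 j, (m + 1)%:~R * pw 2 1
    j[%classic.
Proof.
apply/seteqP; split => t /=; rewrite in_itv/= -level_ge -level_lt; lia.
Qed.

Lemma level_nearE j (m : int) :
  [set t : R | (m <= level j t + 1)%R /\ (level j t <= m + 1)%R] =
  `[(m - 1)%:~R * pw 2 1 j, (m + 2)%:~R * pw 2 1 j[%classic.
Proof.
apply/seteqP; split => t /=; rewrite in_itv/= -level_ge -level_lt; lia.
Qed.

(** Coordinate by coordinate, the relation is a countable union of rectangles on which both levels
    are fixed. *)
Lemma measurable_level_rel (P : int -> int -> Prop) j :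
  measurable [set xy : Rn * Rn |
    forall i, P (level j (coord xy.1 i)) (level j (coord xy.2 i))].
Proof.
rewrite (_ : [set xy | _] = \bigcap_(i in [set: 'I_n]) \bigcup_(m : int)
   ([set x : Rn | level j (coord x i) = m] `*`
    \bigcup_(m' : int) (if pselect (P m m') then [set y : Rn | level j (coord y
      i) = m'] else set0))).
  apply: fin_bigcap_measurable => // i _.
  have ml (m : int) : measurable [set x : Rn | level j (coord x i) = m].
    have := @measurable_coord_set i [set t | level j t = m]; apply.
    by rewrite levelE; exact: measurable_itv.
  apply: countable_bigcupT_measurable; first exact: countableP.
  move=> m; apply: measurableX => //.
  apply: countable_bigcupT_measurable; first exact: countableP.
  by move=> m'; case: pselect => _ /=; [exact: ml|exact: measurable0].
apply/seteqP; split => -[x y] /=.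
  move=> h i _; exists (level j (coord x i)) => //; split => //=.
  by exists (level j (coord y i)) => //; case: pselect => //=.
move=> h i; have [m _ [/= -> [m' _]]] := h i I.
by case: pselect => //= Pmm' ->.
Qed.

Lemma measure_box (a b : 'I_n -> R) (l : R) :
  (forall i, 0 <= l /\ b i = a i + l) ->
  lebesgue_Rn R n [set x : Rn | forall i, coord x i \in `[a i, b i[ ] = (l ^+
    n)%:E.
Proof.
move=> ab; have := @borel_lebesgue_box R n (fun i => `[a i, b i[%classic : set
  R).
have mI i : measurable (`[a i, b i[%classic : set R) by exact: measurable_itv.
move=> /(_ mI); rewrite -lebesgue_RnE.
  move=> ->.
  rewrite (eq_bigr (fun=> l%:E)).
    by rewrite prodEFin prodr_const card_ord.
  move=> i _; have [l0 bE] := ab i.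
  rewrite lebesgue_measure_itv/= lte_fin bE.
  case: ltP => [_|h]; first by rewrite -EFinB addrAC subrr add0r.
  suff -> : l = 0 by [].
  by apply/eqP; rewrite eq_le l0 andbT; move: h; rewrite gerDl.
rewrite (_ : [set _ | _] = \bigcap_(i in [set: 'I_n])
    ((fun t : n.-tuple (measurableTypeR R) => tnth t i) @^-1` `[a i, b
      i[%classic)).
  apply: fin_bigcap_measurable => // i _.
  by rewrite -[X in measurable X]setTI; exact: measurable_tnth.
by apply/seteqP; split=> t /= h i; [move=> _; exact: h|exact: (h i I)].
Qed.

Lemma pw_pow j : (pw 2 1 j ^+ n : R) = pw (2 ^+ n) 1 j.
Proof.
rewrite !pwE !mul1r -powR_mulrn ?powR_ge0// -powRrM mulrC powRrM powR_mulrn//.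
Qed.

Lemma int_half_eq (a b c d : int) : 2 * a <= b /\ b < 2 * a + 2 ->
  2 * c <= d /\ d < 2 * c + 2 -> d = b -> c = a.
Proof. lia. Qed.

(** Two steps between indices of one generation amount to at most one step in the next; this gives
    [near_comp]. *)
Lemma int_half_near (a b c d e : int) : 2 * a <= b /\ b < 2 * a + 2 ->
  2 * c <= d /\ d < 2 * c + 2 -> d <= e + 1 /\ e <= d + 1 -> e <= b + 1 /\ b <=
    e + 1 ->
  c <= a + 1 /\ a <= c + 1.
Proof. lia. Qed.

Lemma Rn_grid : (1 <= n)%N ->
  dyadic_grid (lebesgue_Rn_sf R n) (2 ^+ n) (3 ^+ n) same_cell near_cell.
Proof.
move=> n1; split.
- by rewrite exprn_egt1 ?ltr1n// -lt0n.
- by rewrite exprn_ege1// ler1n.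
- by move=> j; exact: (measurable_level_rel eq).
- move=> j; exact: (measurable_level_rel (fun m m' => (m <= m' + 1)%R /\ (m' <=
    m + 1)%R)).
- by [].
- by move=> j x y xy i; rewrite xy.
- by move=> j x y z xy yz i; rewrite xy yz.
- move=> i j x y ij; have -> : j = (i + `|j - i|%N%:Z)%R by lia.
  elim: `|j - i|%N => [|m IH]; first by rewrite addr0.
  have -> : (i + m.+1%:Z = i + m%:Z + 1)%R by lia.
  move=> /IH xy k.
  exact: int_half_eq (level_up (i + m%:Z) (coord y k)) (level_up (i + m%:Z)
    (coord x k)) (xy k).
- by move=> j x y xy i; have [] := xy i; split.
- by move=> j x y xy i; rewrite xy; split; rewrite lerDl.
- by move=> j x y z xy yz i; rewrite -yz.
- move=> j x y z xy yz i.
  exact: int_half_near (level_up j (coord z i)) (level_up j (coord x i)) (xy i)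
    (yz i).
- move=> j x; rewrite [LHS]lebesgue_Rn_sfE -pw_pow -(@measure_box
    (fun i => (level j (coord x i))%:~R * pw 2 1 j)
    (fun i => (level j (coord x i) + 1)%:~R * pw 2 1 j)); last first.
    by move=> i; rewrite pw_ge0 intrD mulrDl mul1r.
  congr (lebesgue_Rn R n _); apply/seteqP; split => y xy i.
    have : [set t : R | level j t = level j (coord x i)] (coord y i) by rewrite
      /= xy.
    by rewrite levelE.
  by have := xy i; have := levelE j (level j (coord x i));
    move=> /seteqP[_ h] /h.
- move=> j x; rewrite [leLHS]lebesgue_Rn_sfE -pw_pow -exprMn -(@measure_box
    (fun i => (level j (coord x i) - 1)%:~R * pw 2 1 j)
    (fun i => (level j (coord x i) + 2)%:~R * pw 2 1 j)); last first.
    move=> i; rewrite mulr_ge0 ?pw_ge0//; split => //.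
    by rewrite !intrD -mulrDl; congr (_ * _); ring.
  rewrite le_eqVlt; apply/orP; left; apply/eqP.
  congr (lebesgue_Rn R n _); apply/seteqP; split => y xy i.
    have := level_nearE j (level j (coord x i)); move=> /seteqP[h _].
    by have := h (coord y i) (xy i).
  by have := xy i; have := level_nearE j (level j (coord x i));
    move=> /seteqP[_ h] /h.
Qed.

End grid_of_Rn.

(** * Comparison of the Riesz kernel with the dyadic kernel *)

Section near_kernel.
Local Open Scope ereal_scope.
Context d (T : measurableType d) (R : realType)
  (mu : {sigma_finite_measure set T -> \bar R}) (V K : R)
  (same near : int -> T -> set T) (G : dyadic_grid mu V K same near).

(** In the exponent a - 1, the -1 is the normalisation of the averages. *)
Lemma integral_near_zsum (a : R) f x :
  measurable_fun setT f -> (forall y, 0 <= f y) ->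
  \int[mu]_y (zsum (fun j => (pw V (a - 1) j)%:E * (\1_(near j x) y)%:E) * f y)
    =
  pot mu V near a f x.
Proof.
move=> mf f0.
have p0 j y : 0 <= (pw V (a - 1) j)%:E * (\1_(near j x) y)%:E.
  by rewrite mule_ge0// lee_fin ?pw_ge0.
have mI j : measurable_fun setT (fun y => (\1_(near j x) y)%:E * f y).
  by apply: measurable_indic_mule => //; exact: measurable_near G _ _.
pose F j y := (pw V (a - 1) j)%:E * ((\1_(near j x) y)%:E * f y).
transitivity (\int[mu]_y zsum (F ^~ y)).
  apply: eq_integral => y _; rewrite muleC -zsumZl//.
  by apply: eq_zsum => j; rewrite muleC -muleA.
rewrite (integral_zsum mu measurableT).
- apply: eq_zsum => j; rewrite ge0_integralZl//.
  + rewrite -integral_indicE /avg muleA -EFinM -[in RHS]pwDt//.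
    exact: grid_V0 G.
  + by move=> y _; rewrite mule_ge0// lee_fin.
  + by rewrite lee_fin pw_ge0.
- by move=> j; apply: measurable_funeM.
- by move=> j y; rewrite !mule_ge0 ?lee_fin ?pw_ge0.
Qed.

Lemma le_integral_kernel (k1 k2 f : T -> \bar R) (c : R) : (0 <= c)%R ->
  measurable_fun setT k1 -> measurable_fun setT k2 -> measurable_fun setT f ->
  (forall y, 0 <= k1 y) -> (forall y, 0 <= k2 y) -> (forall y, 0 <= f y) ->
  (forall y, k1 y <= c%:E * k2 y) ->
  \int[mu]_y (k1 y * f y) <= c%:E * \int[mu]_y (k2 y * f y).
Proof.
move=> c0 m1 m2 mf k10 k20 f0 k12; rewrite -ge0_integralZl//.
- apply: le_integral => //.
  + by move=> y; rewrite mule_ge0.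
  + by move=> y; rewrite muleA; apply: lee_wpmul2r.
  + exact: emeasurable_funM.
  + by apply: measurable_funeM; exact: emeasurable_funM.
- exact: emeasurable_funM.
- by move=> y _; rewrite mule_ge0.
Qed.

End near_kernel.

Section riesz_kernel.
Context (R : realType) (n : nat).
Local Notation Rn := (Rspace R n).
Implicit Types (x y : Rn) (j : int).

Lemma eucl_dist_ge0 x y : 0 <= eucl_dist x y.
Proof. exact: sqrtr_ge0. Qed.

Lemma measurable_eucl_dist x : measurable_fun setT (eucl_dist x).
Proof.
apply: (measurableT_comp (f := @Num.sqrt R)).
  by apply: continuous_measurable_fun; exact: sqrt_continuous.
apply: (@measurable_sum _ _ _ setT 'I_n (index_enum 'I_n)
  (fun i y => (coord x i - coord y i) ^+ 2)) => i.
apply: measurable_funX; apply: measurable_funB; first exact: measurable_cst.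
exact: measurable_coord.
Qed.

Lemma coord_le_eucl_dist x y i : `|coord x i - coord y i| <= eucl_dist x y.
Proof.
rewrite -sqrtr_sqr ler_sqrt; last by apply: sumr_ge0 => k _; exact: sqr_ge0.
by rewrite (bigD1 i)//= lerDl; apply: sumr_ge0 => k _; exact: sqr_ge0.
Qed.

Lemma eucl_dist_le x y (l : R) : 0 <= l ->
  (forall i, `|coord x i - coord y i| <= l) -> eucl_dist x y <= n%:R * l.
Proof.
move=> l0 xy; rewrite -[leRHS]ger0_norm ?mulr_ge0// -sqrtr_sqr.
rewrite ler_sqrt ?sqr_ge0//.
have [n0|n0] := posnP n.
  move: x y xy; rewrite n0 => x y xy.
  by rewrite big_ord0 mul0r expr0n.
apply: (@le_trans _ _ (\sum_(i < n) l ^+ 2)).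
  apply: ler_sum => i _; rewrite -(real_normK (num_real _)).
  by rewrite ler_sqr// nnegrE.
rewrite sumr_const card_ord -[leLHS]mulr_natl exprMn.
apply: ler_wpM2r; first exact: sqr_ge0.
by rewrite expr2 ler_peMl ?ler1n.
Qed.

Lemma near_cell_dist j x y : near_cell j x y ->
  eucl_dist x y <= n%:R * (2 * pw 2 1 j).
Proof.
move=> xy; apply: eucl_dist_le; first by rewrite mulr_ge0 ?pw_ge0.
have p0 : 0 < pw 2 1 j :> R by exact: pw_gt0.
suff h (u v : R) : (level j u <= level j v + 1)%R -> u - v <= 2 * pw 2 1 j.
  move=> i; have [h1 h2] := xy i; rewrite ler_norml h// andbT.
  by rewrite lerNl opprB h.
move=> uv; have : level j u < level j v + 2 by lia.
rewrite level_lt intrD mulrDl.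
have := lexx (level j v); rewrite {1}level_ge; lra.
Qed.

Lemma dist_near_cell j x y : eucl_dist x y <= pw 2 1 j -> near_cell j x y.
Proof.
move=> xy i; have := le_trans (coord_le_eucl_dist x y i) xy.
move: (coord x i) (coord y i) => u v; rewrite ler_norml => /andP[uv1 uv2].
have h (s t : R) : s - t <= pw 2 1 j -> (level j s <= level j t + 1)%R.
  move=> st; have : (level j t + 1 < level j s)%R = false; last by lia.
  apply/negbTE/negP => ts; have : (level j t + 2 <= level j s)%R by lia.
  rewrite level_ge intrD mulrDl; have : (level j t < level j t + 1)%R by lia.
  rewrite level_lt intrD mulrDl; lra.
by split; apply: h; lra.
Qed.

End riesz_kernel.

Section riesz_pot.
Local Open Scope ereal_scope.
Context (R : realType) (n : nat) (n1 : (1 <= n)%N) (alpha : R).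
Hypotheses (alpha0 : (0 < alpha)%R) (alphan : (alpha < n%:R)%R).
Local Notation Rn := (Rspace R n).
Implicit Types (x y : Rn) (j : int).

Definition kern x y : \bar R := epow (eucl_dist x y)%:E (alpha - n%:R)%R.

Local Notation V := (2 ^+ n : R)%R.
Local Notation a := (alpha / n%:R)%R.

Definition dyadic_kern x y : \bar R :=
  zsum (fun j => (pw 2 (alpha - n%:R) j)%:E * (\1_(@near_cell R n j x) y)%:E).

Let n0 : (0 < n%:R :> R)%R. Proof. by rewrite ltr0n. Qed.

Lemma pw_expn (t : R) j : pw V (t / n%:R) j = pw 2 t j.
Proof.
rewrite !pwE -powR_mulrn// -powRrM; congr (_ `^ _)%R.
by rewrite mulrA [(n%:R * _)%R]mulrC divfK// gt_eqF.
Qed.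

Lemma kernE x y : kern x y =
  if (eucl_dist x y == 0)%R then +oo else (eucl_dist x y `^ (alpha - n%:R))%:E.
Proof.
rewrite /kern /epow subr_lt0 alphan poweR_EFin inver powR_eq0.
rewrite opprB subr_eq0 [_ == alpha]gt_eqF// andbT.
by case: eqP => // _; rewrite -powRN opprB.
Qed.

Lemma kern_ge0 x y : 0 <= kern x y.
Proof. by rewrite kernE; case: ifP => // _; rewrite lee_fin powR_ge0. Qed.

Lemma measurable_kern x : measurable_fun setT (kern x).
Proof.
rewrite (_ : kern x = fun y => if (eucl_dist x y == 0)%R then +oo
  else (eucl_dist x y `^ (alpha - n%:R))%:E); last by apply/funext => y;
    exact: kernE.
apply: measurable_fun_ifT.
- by apply: measurable_fun_eqr; [exact: measurable_eucl_dist|exact: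
    measurable_cst].
- exact: measurable_cst.
- apply/measurable_EFinP; apply: (measurableT_comp (f := @powR R ^~ _)).
    exact: measurable_powR.
  exact: measurable_eucl_dist.
Qed.

Lemma dyadic_kern_term_ge0 x y j :
  0 <= (pw 2 (alpha - n%:R) j)%:E * (\1_(@near_cell R n j x) y)%:E.
Proof. by rewrite mule_ge0// lee_fin ?pw_ge0. Qed.

(** If 2^j < |x - y| <= 2^(j+1), generation j + 1 alone suffices. At distance 0 every generation
    contributes and the dyadic kernel is infinite as well. *)
Lemma kern_le_dyadic x y : kern x y <= (2 `^ (n%:R - alpha))%:E * dyadic_kern x
  y.
Proof.
have c0 : (0 < 2 `^ (n%:R - alpha) :> R)%R by exact: powR_gt0.
have pn : (0 < n%:R - alpha)%R by rewrite subr_gt0.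
rewrite kernE; case: eqP => [xy|/eqP xy].
  suff -> : dyadic_kern x y = +oo by rewrite gt0_muley.
  apply: (pw_ub_eqy pn) => k; rewrite -[k]opprK pwN -pwNt opprB.
  apply: le_trans (zsum_ge (- k)%R (dyadic_kern_term_ge0 x y)).
  rewrite indicE mem_set ?mule1//; apply: dist_near_cell.
  by rewrite xy pw_ge0.
have xy0 : (0 < eucl_dist x y)%R by rewrite lt0r xy eucl_dist_ge0.
have [j /andP[j1 j2]] : exists j, (pw 2 1 j < eucl_dist x y <= pw 2 1 (j +
  1))%R.
  by apply: pw_level => //; rewrite ltr1n.
apply: (@le_trans _ _ ((2 `^ (n%:R - alpha))%:E * (pw 2 (alpha - n%:R) (j +
  1))%:E)).
  rewrite pwS// -EFinM lee_fin mulrCA -powRD; last by rewrite pnatr_eq0 implybT.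
  rewrite addrA subrK subrr powRr0 mulr1 -[(alpha - n%:R)%R]opprB pwNt powRN.
  rewrite lef_pV2 ?posrE ?pw_gt0 ?powR_gt0// -[X in pw _ X]mul1r -pw_powR.
  by rewrite ge0_ler_powR ?nnegrE ?pw_ge0 ?ltW.
apply: lee_wpmul2l; first by rewrite lee_fin powR_ge0.
apply: le_trans (zsum_ge (j + 1)%R (dyadic_kern_term_ge0 x y)).
by rewrite indicE mem_set ?mule1//; exact: dist_near_cell.
Qed.

(** Only generations with |x - y| <= 2 n 2^i have y in the neighbourhood of x, and over these the
    powers 2^((alpha - n) i) form a geometric sum dominated by the first. *)
Lemma dyadic_le_kern : exists2 C : R, (0 < C)%R &
  forall x y, dyadic_kern x y <= C%:E * kern x y.
Proof.
have pn : (0 < n%:R - alpha)%R by rewrite subr_gt0.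
have g0 : (0 < geo 2 (n%:R - alpha) :> R)%R by apply: geo_gt0 => //;
  rewrite ltr1n.
have c0 : (0 < 2 `^ (n%:R - alpha) :> R)%R by exact: powR_gt0.
have d0 : (0 < (n%:R * 2) `^ (n%:R - alpha) :> R)%R.
  by rewrite powR_gt0// mulr_gt0.
exists (geo 2 (n%:R - alpha) * 2 `^ (n%:R - alpha) * (n%:R * 2) `^ (n%:R -
  alpha))%R.
  by rewrite !mulr_gt0.
move=> x y; rewrite kernE; case: eqP => [_|/eqP xy].
  by rewrite gt0_muley ?leey// lte_fin !mulr_gt0.
have xy0 : (0 < eucl_dist x y)%R by rewrite lt0r xy eucl_dist_ge0.
have e0 : (0 < eucl_dist x y / (n%:R * 2))%R by rewrite divr_gt0// mulr_gt0.
have [j /andP[j1 j2]] : exists j,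
    (pw 2 1 j < eucl_dist x y / (n%:R * 2) <= pw 2 1 (j + 1))%R.
  by apply: pw_level => //; rewrite ltr1n.
apply: (@le_trans _ _ (zsum (fun i => if (j <= i)%R then (pw 2 (- (n%:R -
  alpha)) i)%:E else 0))).
  apply: le_zsum => i; rewrite indicE.
  have [xyi|] := boolP (y \in _); last by rewrite mule0; case: ifP => // _;
    rewrite lee_fin pw_ge0.
  rewrite mule1 opprB; case: ifP => // /negbT; rewrite -ltNge => ij.
  have : (eucl_dist x y <= n%:R * (2 * pw 2 1 i))%R.
    by apply: near_cell_dist; move: xyi; rewrite inE.
  rewrite mulrA mulrC -ler_pdivrMr; last by rewrite mulr_gt0.
  move=> /(lt_le_trans j1).
  by rewrite ltNge ler_pw// ?ler1n// ltW.
apply: le_trans (zsum_geo_ge _ _ pn) _; first by rewrite ltr1n.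
rewrite -EFinM lee_fin -!mulrA; apply: ler_wpM2l; first exact: ltW.
have -> : pw 2 (- (n%:R - alpha)) j = (2 `^ (n%:R - alpha) * pw 2 (- (n%:R -
  alpha)) (j + 1))%R :> R.
  by rewrite pwS// mulrCA powRN divff ?mulr1// gt_eqF.
apply: ler_wpM2l; first exact: ltW.
rewrite pwNt -[(alpha - n%:R)%R]opprB powRN.
rewrite ler_pdivlMr ?powR_gt0// ler_pdivrMl ?pw_gt0//.
rewrite -[X in pw _ X]mul1r -pw_powR mulrC -powRM ?pw_ge0 ?mulr_ge0//.
apply: ge0_ler_powR; rewrite ?nnegrE ?mulr_ge0 ?pw_ge0 ?(ltW pn) ?(ltW xy0)//.
by rewrite -ler_pdivrMl ?mulr_gt0// mulrC.
Qed.

Local Notation mu := (lebesgue_Rn_sf R n).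
Local Notation near := (@near_cell R n).
Local Notation pot := (pot mu V near a).
Let G := @Rn_grid R n n1.

Lemma integral_dyadic_kern f x : measurable_fun setT f -> (forall y, 0 <= f y)
  ->
  \int[mu]_y (dyadic_kern x y * f y) = pot f x.
Proof.
move=> mf f0; rewrite -(integral_near_zsum G (alpha / n%:R)%R x mf f0).
apply: eq_integral => y _; congr (_ * _); apply: eq_zsum => j.
by rewrite -pw_expn mulrBl divff ?gt_eqF.
Qed.

Lemma measurable_dyadic_kern x : measurable_fun setT (dyadic_kern x).
Proof.
apply: emeasurable_fun_zsum => [j|j y]; last exact: dyadic_kern_term_ge0.
apply: measurable_funeM; apply/measurable_EFinP; apply: measurable_indic.
exact: measurable_near G _ _.
Qed.

Lemma riesz_sim_pot : (0 < riesz_const n alpha)%R ->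
  exists c1 c2 : R, [/\ (0 < c1)%R, (0 < c2)%R &
    forall f x, measurable_fun setT f -> (forall y, 0 <= f y) ->
      c1%:E * pot f x <= riesz alpha f x /\ riesz alpha f x <= c2%:E * pot f x].
Proof.
move=> g0; have [C C0 le_kern] := dyadic_le_kern.
have D0 : (0 < 2 `^ (n%:R - alpha) :> R)%R by exact: powR_gt0.
exists (riesz_const n alpha * C^-1)%R, (riesz_const n alpha * 2 `^ (n%:R -
  alpha))%R.
split; [by rewrite mulr_gt0 ?invr_gt0|by rewrite mulr_gt0|].
move=> f x mf f0; have md := measurable_dyadic_kern x;
  have mk := measurable_kern x.
have d0 y : 0 <= dyadic_kern x y by apply: zsum_ge0 => j;
  exact: dyadic_kern_term_ge0.
have k0 := kern_ge0 x.
have rc0 : 0 <= (riesz_const n alpha)%:E by rewrite lee_fin ltW.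
rewrite /riesz integral_lebesgue_Rn; split.
- rewrite EFinM -muleA; apply: lee_wpmul2l => //.
  rewrite -lee_pdivlMl ?invr_gt0// invrK -(integral_dyadic_kern x mf f0).
  exact: (le_integral_kernel _ (ltW C0) md mk mf d0 k0 f0 (le_kern x)).
- rewrite [(_ * 2 `^ _)%:E]EFinM -muleA; apply: lee_wpmul2l => //.
  rewrite -(integral_dyadic_kern x mf f0).
  exact: (le_integral_kernel _ (ltW D0) mk md mf k0 d0 f0 (kern_le_dyadic x)).
Qed.

End riesz_pot.

(** * Capacity and Choquet integrals *)

Section dyadic_integral.
Local Open Scope ereal_scope.
Context (R : realType) (phi : R -> \bar R).
Hypotheses (phi0 : forall t, 0 <= phi t)
  (phi_ni : forall t u, (t <= u)%R -> phi u <= phi t).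
Local Notation leb := (@lebesgue_measure R).

Lemma measurable_nonincreasing : measurable_fun [set: measurableTypeR R] phi.
Proof.
apply: measurable_fun_gtP => c; apply: is_interval_measurable => t u /= _ uc z.
by move=> /andP[_ zu]; apply: lt_le_trans uc _; exact: phi_ni.
Qed.

Let dyadic_itv (c : R) k : set R := [set` `](c * pw 2 1 k)%R, (c * pw 2 1 (k +
  1))%R] ].

Lemma integral_dyadic (c : R) : (0 < c)%R ->
  \int[leb]_(t in `]0%R, +oo[) phi t =
  zsum (fun k => \int[leb]_(t in dyadic_itv c k) phi t).
Proof.
move=> c0; have mp := measurable_nonincreasing.
have mI k : measurable (dyadic_itv c k : set (measurableTypeR R)) by exact:
  measurable_itv.
rewrite integral_indicE.
rewrite (eq_zsum (fun k => integral_indicE _ _ _)).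
rewrite -(integral_zsum _ measurableT); last 2 first.
- by move=> k; exact: (measurable_indic_mule (mI k) mp).
- by move=> k t; rewrite mule_ge0// lee_fin.
apply: eq_integral => t _.
have [t0|t0] := ltP 0%R t; last first.
  rewrite (@zsum_unique _ _ 0%R); rewrite ?mule_ge0 ?lee_fin//.
    rewrite !indicE !memNset ?mul0e// /dyadic_itv/= in_itv/= ?andbT; apply/negP;
      rewrite -?ltNge -?leNgt//.
    by rewrite negb_and -leNgt (le_trans t0)// mulr_ge0 ?pw_ge0// ltW.
  move=> i _; rewrite indicE memNset ?mul0e// /dyadic_itv/= in_itv/=;
    apply/negP.
  by rewrite negb_and -leNgt (le_trans t0)// mulr_ge0 ?pw_ge0// ltW.
have [k /andP[k1 k2]] : exists k, (pw 2 1 k < t / c <= pw 2 1 (k + 1))%R.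
  by apply: pw_level; rewrite ?ltr1n// divr_gt0.
rewrite (@zsum_unique _ _ k).
- rewrite !indicE !mem_set// /dyadic_itv /= in_itv/= ?t0//.
  by rewrite mulrC -ltr_pdivlMr// k1 mulrC -ler_pdivrMr.
- by rewrite mule_ge0// lee_fin.
- move=> i ik; rewrite indicE memNset ?mul0e// /dyadic_itv/= in_itv/=.
  rewrite ![(c * _)%R]mulrC -ltr_pdivlMr// -ler_pdivrMr// => /andP[i1 i2].
  apply: ik; apply/eqP; rewrite eq_le -!ltzD1; apply/andP; split; rewrite ltNge;
    apply/negP.
    move=> ki; have := lt_le_trans i1 k2; rewrite ltNge ler_pw ?ler1n//.
  move=> ki; have := lt_le_trans k1 i2; rewrite ltNge ler_pw ?ler1n//.
Qed.

Let dyadic_itv_len (c : R) k : (0 < c)%R ->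
  leb (dyadic_itv c k) = (c * pw 2 1 k)%:E.
Proof.
move=> c0; rewrite lebesgue_measure_itv/= lte_fin ltr_pM2l// ltr_pw ?ltr1n
  ?ltrDl//.
by rewrite -EFinB pwS// powRr1// -mulrBr mulr_natr mulr2n addrK.
Qed.

Lemma le_integral_dyadic (c : R) : (0 < c)%R ->
  \int[leb]_(t in `]0%R, +oo[) phi t <=
  c%:E * zsum (fun k => (pw 2 1 k)%:E * phi (c * pw 2 1 k)%R).
Proof.
move=> c0; rewrite (integral_dyadic c0) -zsumZl ?lee_fin ?(ltW c0)//;
  last first.
  by move=> k; rewrite mule_ge0// lee_fin pw_ge0.
apply: le_zsum => k; rewrite muleA -EFinM -dyadic_itv_len// muleC.
rewrite -integral_cst; last exact: measurable_itv.
apply: ge0_le_integral => //; first exact: measurable_itv.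
- by apply: measurable_funTS; exact: measurable_nonincreasing.
- move=> t; rewrite /dyadic_itv/= in_itv/= => /andP[t1 _]; exact/phi_ni/ltW.
Qed.

(** On ]c 2^k, c 2^(k+1)] the function is at least its value at the right end point; indexing by
    that end point costs the factor 2. *)
Lemma ge_integral_dyadic (c : R) : (0 < c)%R ->
  c%:E * zsum (fun k => (pw 2 1 k)%:E * phi (c * pw 2 1 k)%R) <=
  2%:E * \int[leb]_(t in `]0%R, +oo[) phi t.
Proof.
move=> c0; rewrite (integral_dyadic c0) -zsumZl ?lee_fin ?(ltW c0)//;
  last first.
  by move=> k; rewrite mule_ge0// lee_fin pw_ge0.
rewrite (zsum_shift _ 1) -zsumZl//; last by move=> k; exact: integral_ge0.
apply: le_zsum => k.
rewrite {1}pwS// powRr1// muleA -EFinM mulrA [(_ * 2)%R]mulrC EFinM -muleA.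
apply: lee_wpmul2l => //.
rewrite -dyadic_itv_len// muleC -integral_cst; last exact: measurable_itv.
apply: ge0_le_integral => //; first exact: measurable_itv.
- by move=> t _; exact: phi0.
- by apply: measurable_funTS; exact: measurable_nonincreasing.
- by move=> t; rewrite /dyadic_itv/= in_itv/= => /andP[_ t2]; exact: phi_ni.
Qed.

End dyadic_integral.

(** * Capacity and measure: sets of capacity zero are negligible *)

Section potential_measure.
Local Open Scope ereal_scope.
Context d (T : measurableType d) (R : realType)
  (mu : {sigma_finite_measure set T -> \bar R}) (V K : R)
  (same near : int -> T -> set T) (G : dyadic_grid mu V K same near).
Variables (a s : R).
Hypotheses (a0 : (0 < a)%R) (s1 : (1 < s)%R) (as1 : (a * s < 1)%R).
Local Notation avg := (avg mu V near).
Local Notation maxf := (maxf mu V near).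
Local Notation pot := (pot mu V near a).

Let s0 : (0 < s)%R := lt_trans ltr01 s1.

Lemma avg_le_poweR : exists2 C : R, (0 < C)%R &
  forall h j x, measurable_fun setT h -> (forall y, 0 <= h y) ->
    avg j h x <= C%:E * (pw V (- s^-1) j)%:E * (\int[mu]_y h y `^ s) `^ s^-1.
Proof.
have [C C0 strong] := maximal_strong_type G s1.
have V0 := grid_V0 G.
exists (C `^ s^-1)%R => [|h j x mh h0]; first by rewrite powR_gt0.
have I0 : 0 <= \int[mu]_y h y `^ s by apply: integral_ge0 => y _;
  exact: poweR_ge0.
have := cell_le_integral G (f := maxf h) (j := j) (x := x)
  (c := avg j h x) (ltW s0) (measurable_maxf G mh h0) (maxf_ge0 mu V near h0)
    (avg_ge0 mu V near h0 j x).
have hc y : same j x y -> avg j h x <= maxf h y.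
  by move=> xy; rewrite (avg_same G h xy); exact: avg_le_maxf.
move=> /(_ hc) le_avg_s.
have /(le_trans le_avg_s) : (pw V (-1) j)%:E * \int[mu]_y maxf h y `^ s <=
    (pw V (-1) j)%:E * (C%:E * \int[mu]_y h y `^ s).
  by apply: lee_wpmul2l; [rewrite lee_fin pw_ge0|exact: strong].
move=> /(le_poweR (r := s^-1)); rewrite invr_ge0 (ltW s0) poweR_ge0 => /(_ isT
  isT).
rewrite poweRK ?gt_eqF//; last exact: (avg_ge0 mu V near h0).
rewrite poweRM ?lee_fin ?pw_ge0//; last by rewrite mule_ge0// lee_fin ltW.
rewrite poweRM ?lee_fin ?(ltW C0)// poweR_pw mulN1r poweR_EFin.
by rewrite muleA [_%:E * (C `^ _)%:E]muleC.
Qed.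

(** A splitting in the manner of Hedberg, at generation 0: the finer generations are bounded by the
    maximal function, the coarser ones by the L^s norm, whose decay V^(-j/s) beats V^(aj) because a
    s < 1. *)
Lemma pot_le_maxf : exists2 C : R, (0 < C)%R &
  forall h x, measurable_fun setT h -> (forall y, 0 <= h y) ->
    pot h x <= C%:E * (maxf h x + (\int[mu]_y h y `^ s) `^ s^-1).
Proof.
have [C C0 avg_le] := avg_le_poweR; have V1 := grid_V G; have V0 := grid_V0 G.
have b0 : (0 < s^-1 - a)%R by rewrite subr_gt0 -[(s^-1)%R]div1r ltr_pdivlMr.
pose g1 : R := geo V a; pose g2 : R := geo V (s^-1 - a).
have g10 : (0 < g1)%R by exact: geo_gt0.
have g20 : (0 < g2)%R by exact: geo_gt0.
exists (g1 + C * g2)%R => [|h x mh h0]; first by rewrite addr_gt0// mulr_gt0.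
have M0 := maxf_ge0 mu V near h0 x.
have t0 j : 0 <= (pw V a j)%:E * avg j h x.
  by rewrite mule_ge0 ?lee_fin ?pw_ge0// (avg_ge0 mu V near h0).
set I := (_ `^ s^-1); have I0 : 0 <= I by exact: poweR_ge0.
apply: (@le_trans _ _ (zsum (fun j => (if (j <= 0)%R then (pw V a j)%:E * avg j
  h x else 0) +
    (if (0 <= j)%R then (pw V a j)%:E * avg j h x else 0)))).
  apply: le_zsum => j; have [j0|j0] := leP j 0%R; first by rewrite leeDl//;
    case: ifP.
  by rewrite add0e (ltW j0).
rewrite zsumD; last 2 first.
- by move=> j; case: ifP.
- by move=> j; case: ifP.
apply: (@le_trans _ _ (g1%:E * maxf h x + (C * g2)%:E * I)).
  apply: leeD.
  - apply: le_trans (le_zsum_geo_le (c := maxf h x) V1 a0 _ _) _ => //.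
      move=> j _; rewrite muleC; apply: lee_wpmul2r;
        first by rewrite lee_fin pw_ge0.
      exact: avg_le_maxf.
    by rewrite pw0 mulr1 muleC.
  - apply: le_trans (le_zsum_geo_ge (c := C%:E * I) V1 b0 _ _) _.
    + by rewrite mule_ge0// lee_fin ltW.
    + move=> j _; apply: le_trans (lee_wpmul2l _ (avg_le h j x mh h0)) _.
        by rewrite lee_fin pw_ge0.
      by rewrite -/I muleA muleCA -muleA -EFinM -pwDt// opprB -muleA [I *
        _]muleC.
    + by rewrite pw0 mulr1 [(C * g2)%:E]EFinM -!muleA [I * _]muleC.
rewrite ge0_muleDr//; apply: leeD; apply: lee_wpmul2r => //; rewrite lee_fin.
  by rewrite lerDl mulr_ge0// ltW.
by rewrite lerDr ltW.
Qed.

(** A small norm accounts for at most half of the potential, so the maximal function is at least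
    1/(2C) on the set, and Markov's inequality with the strong type applies. *)
Lemma measure_pot_ge1 : exists2 C : R, (0 < C)%R &
  forall h, measurable_fun setT h -> (forall y, 0 <= h y) ->
    C%:E * \int[mu]_y h y `^ s <= 1 ->
    mu [set x | 1 <= pot h x] <= C%:E * \int[mu]_y h y `^ s.
Proof.
have [C C0 le_pot] := pot_le_maxf; have [D D0 strong] :=
  maximal_strong_type G s1.
pose E : R := ((2 * C) `^ s)%R.
have C20 : (0 < 2 * C)%R by rewrite mulr_gt0.
have E0 : (0 < E)%R by rewrite powR_gt0.
exists (E * (D + 1))%R => [|h mh h0 I1]; first by rewrite mulr_gt0// addr_gt0.
set I := (\int[mu]_y _) in I1 *.
have I0 : 0 <= I by apply: integral_ge0 => y _; exact: poweR_ge0.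
have Is : (2 * C)%:E * I `^ s^-1 <= 1.
  have : E%:E * I <= 1.
    apply: le_trans I1; apply: lee_wpmul2r => //.
    by rewrite lee_fin ler_peMr ?(ltW E0)// lerDr ltW.
  move=> /(le_poweR (r := s^-1)); rewrite invr_ge0 (ltW s0) mule_ge0 ?lee_fin
    ?(ltW E0)//.
  move=> /(_ isT isT); rewrite poweRM ?lee_fin ?(ltW E0)// -poweR_EFin poweRK
    ?gt_eqF//.
    by rewrite poweR_EFin powR1.
  by rewrite lee_fin ltW.
have sub : [set x | 1 <= pot h x] `<=` [set x | (E^-1)%:E <= maxf h x `^ s].
  move=> x /= /le_trans /(_ (le_pot h x mh h0)); rewrite -/I => ge1.
  have M0 := maxf_ge0 mu V near h0 x.
  suff le1 : 1 <= (2 * C)%:E * maxf h x.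
    have := le_poweR (ltW s0) lee01 le1.
    rewrite poweR_EFin powR1 poweRM ?lee_fin ?(ltW C20)// poweR_EFin -/E => EM.
    by rewrite -[leLHS]mule1 lee_pdivrMl.
  have [//|] := leP 1 ((2 * C)%:E * maxf h x); move=> lt1.
  have : (2 * C)%:E * maxf h x + (2 * C)%:E * I `^ s^-1 < 1 + 1.
    by apply: lte_leD => //; rewrite ?ge0_fin_numE ?mule_ge0 ?lee_fin ?(ltW
      C20)// ?poweR_ge0//; apply: le_lt_trans Is (ltry _).
  rewrite -ge0_muleDr ?poweR_ge0// [(2 * C)%:E]EFinM -muleA => lt2.
  have : 2%:E * (1 : \bar R) <= 2%:E * (C%:E * (maxf h x + I `^ s^-1)).
    by apply: lee_wpmul2l => //; rewrite lee_fin.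
  by move=> /le_lt_trans/(_ lt2); rewrite mule1 -EFinD ltxx.
have mM : measurable_fun setT (fun x => maxf h x `^ s).
  exact/measurable_fun_poweR/(measurable_maxf G mh h0).
apply: (@le_trans _ _ (mu [set x | (E^-1)%:E <= maxf h x `^ s])).
  apply: le_measure => //; rewrite inE.
    exact/measurable_set_ge/(measurable_pot G mh h0).
  exact: measurable_set_ge.
have : (E^-1)%:E * mu [set x | (E^-1)%:E <= maxf h x `^ s] <= D%:E * I.
  apply: le_trans (strong h mh h0).
  by apply: markov_ge => //; [move=> x; exact: poweR_ge0|rewrite invr_ge0 ltW].
rewrite lee_pdivrMl// => /le_trans; apply.
by rewrite EFinM -muleA; apply: lee_wpmul2l; rewrite ?lee_fin ?(ltW E0)//;
  apply: lee_wpmul2r => //; rewrite lee_fin lerDl.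
Qed.

End potential_measure.

Section capacity.
Local Open Scope ereal_scope.
Context d (T : measurableType d) (R : realType)
  (mu : {sigma_finite_measure set T -> \bar R}) (V K : R)
  (same near : int -> T -> set T) (G : dyadic_grid mu V K same near).
Variables (a s : R).
Hypotheses (a0 : (0 < a)%R) (s1 : (1 < s)%R) (as1 : (a * s < 1)%R).
Local Notation pot := (pot mu V near a).
Variables (rz : (T -> \bar R) -> T -> \bar R) (c1 c2 : R).
Hypotheses (c10 : (0 < c1)%R) (c20 : (0 < c2)%R)
  (rz_pot : forall f x, measurable_fun setT f -> (forall y, 0 <= f y) ->
    c1%:E * pot f x <= rz f x /\ rz f x <= c2%:E * pot f x).

Let s0 : (0 < s)%R := lt_trans ltr01 s1.

(** The capacity of an abstract operator [rz] comparable with the dyadic potential; [capE]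
    identifies it with [cap] for the Riesz potential. *)
Definition rcap (E : set T) : \bar R :=
  ereal_inf [set \int[mu]_x f x `^ s | f in
    [set f | [/\ measurable_fun setT f, forall x, 0 <= f x &
                 forall x, E x -> 1 <= rz f x]]].

Definition rchoquet (D : set T) (g : T -> \bar R) : \bar R :=
  \int[lebesgue_measure]_(t in `]0%R, +oo[) rcap (D `&` [set x | t%:E < g x]).

Lemma rcap_ge0 E : 0 <= rcap E.
Proof.
apply: le_ereal_inf_tmp => _ [f _ <-]; apply: integral_ge0 => x _;
  exact: poweR_ge0.
Qed.

Lemma le_rcap A B : A `<=` B -> rcap A <= rcap B.
Proof.
move=> AB; apply: ereal_inf_le_tmp => _ [f [mf f0 fB] <-]; exists f => //.
by split => // x /AB /fB.
Qed.

Lemma rcap_set0 : rcap set0 = 0.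
Proof.
apply/eqP; rewrite eq_le rcap_ge0 andbT; apply: ereal_inf_lbound.
exists (cst 0); first by split.
by rewrite integral0_eq// => x _; rewrite poweR0r// gt_eqF.
Qed.

Lemma rcap_le_test E psi : measurable_fun setT psi -> (forall x, 0 <= psi x) ->
  (forall x, E x -> 1 <= pot psi x) ->
  rcap E <= (c1 `^ (- s))%:E * \int[mu]_x psi x `^ s.
Proof.
move=> mpsi psi0 psiE; apply: ereal_inf_lbound.
have ci0 : (0 <= c1^-1)%R by rewrite invr_ge0 ltW.
exists (fun x => (c1^-1)%:E * psi x).
  have mc : measurable_fun setT (fun x => (c1^-1)%:E * psi x) by exact:
    measurable_funeM.
  have c0 x : 0 <= (c1^-1)%:E * psi x by rewrite mule_ge0// lee_fin.
  split => // x Ex; have [+ _] := rz_pot x mc c0.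
  rewrite (potZl G)// muleA -EFinM divff ?gt_eqF// mul1e; apply: le_trans.
  exact: psiE.
rewrite -ge0_integralZl//.
- apply: eq_integral => x _; rewrite poweRM ?lee_fin//.
  by rewrite poweR_EFin -powR_inv1 ?ltW// -powRrM mulN1r.
- exact: measurable_fun_poweR.
- by move=> x _; exact: poweR_ge0.
- by rewrite lee_fin powR_ge0.
Qed.

Lemma rcap_test E (e : R) : (0 < e)%R -> rcap E < +oo -> exists h,
  [/\ measurable_fun setT h, forall x, 0 <= h x,
     forall x, E x -> 1 <= pot h x &
     \int[mu]_x h x `^ s <= (c2 `^ s)%:E * (rcap E + e%:E)].
Proof.
move=> e0 Efin; have fin : rcap E \is a fin_num by rewrite ge0_fin_numE
  ?rcap_ge0.
have [_ [f [mf f0 fE] <-] lt] := lb_ereal_inf_adherent e0 fin.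
have cc0 : 0 <= c2%:E by rewrite lee_fin ltW.
exists (fun x => c2%:E * f x); split.
- exact: measurable_funeM.
- by move=> x; rewrite mule_ge0.
- move=> x Ex; rewrite (potZl G) ?(ltW c20)//.
  have [_] := rz_pot x mf f0; apply: le_trans; exact: fE.
- rewrite (_ : (fun x => _) = (fun x => (c2 `^ s)%:E * f x `^ s)); last first.
    by apply/funext => x; rewrite poweRM// poweR_EFin.
  rewrite ge0_integralZl//.
  + by apply: lee_wpmul2l; [rewrite lee_fin powR_ge0|exact: ltW].
  + exact: measurable_fun_poweR.
  + by move=> x _; exact: poweR_ge0.
  + by rewrite lee_fin powR_ge0.
Qed.

Lemma le_rchoquet_dyadic D g (c : R) : (0 < c)%R ->
  rchoquet D g <= c%:E *
    zsum (fun k => (pw 2 1 k)%:E * rcap (D `&` [set x | (c * pw 2 1 k)%:E < g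
      x])).
Proof.
move=> c0; apply: (le_integral_dyadic (phi :=
  fun t => rcap (D `&` [set x | t%:E < g x]))) => //.
  by move=> t; exact: rcap_ge0.
move=> t u tu; apply: le_rcap => x [Dx /= ug]; split => //=.
by apply: le_lt_trans ug; rewrite lee_fin.
Qed.

Lemma dyadic_le_rchoquet D g (c : R) : (0 < c)%R ->
  c%:E *
    zsum (fun k => (pw 2 1 k)%:E * rcap (D `&` [set x | (c * pw 2 1 k)%:E < g
      x])) <=
  2%:E * rchoquet D g.
Proof.
move=> c0; apply: (ge_integral_dyadic (phi :=
  fun t => rcap (D `&` [set x | t%:E < g x]))) => //.
  by move=> t; exact: rcap_ge0.
move=> t u tu; apply: le_rcap => x [Dx /= ug]; split => //=.
by apply: le_lt_trans ug; rewrite lee_fin.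
Qed.

(** The sets where the potentials of test functions of arbitrarily small norm are at least 1 are
    measurable, contain N and have arbitrarily small measure; N lies in their intersection. *)
Lemma rcap0_negligible N : rcap N = 0 -> mu.-negligible N.
Proof.
move=> N0; have [C C0 le_mu] := measure_pot_ge1 G a0 s1 as1.
have k0 : (0 < C * c2 `^ s)%R by rewrite mulr_gt0// powR_gt0.
pose e (m : nat) : R := ((C * c2 `^ s)^-1 / m.+1%:R)%R.
have e0 m : (0 < e m)%R by rewrite divr_gt0// invr_gt0.
have test m : exists h, [/\ measurable_fun setT h, forall x, 0 <= h x,
     forall x, N x -> 1 <= pot h x & C%:E * \int[mu]_x h x `^ s <=
       (m.+1%:R^-1)%:E].
  have [|h [mh h0 hN hI]] := @rcap_test N (e m) (e0 m); first by rewrite N0.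
  exists h; split => //.
  apply: (@le_trans _ _ (C%:E * ((c2 `^ s)%:E * (rcap N + (e m)%:E)))).
    by apply: lee_wpmul2l => //; rewrite lee_fin ltW.
  by rewrite N0 add0e muleA -!EFinM lee_fin /e mulrA divff ?mul1r// gt_eqF.
have /choice[h hP] := test.
exists (\bigcap_m [set x | 1 <= pot (h m) x]).
have mA m : measurable [set x | 1 <= pot (h m) x].
  have [mh h0 _ _] := hP m; exact/measurable_set_ge/(measurable_pot G mh h0).
split; first exact: bigcapT_measurable.
- apply/eqP; rewrite eq_le measure_ge0 andbT; apply/lee_addgt0Pr => eps eps0.
  rewrite add0e; have [m /ltW em] := ltr_add_invr eps0.
  rewrite add0r in em.
  have [mh h0 _ hI] := hP m.
  apply: (@le_trans _ _ (mu [set x | 1 <= pot (h m) x])).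
    by apply: le_measure; rewrite ?inE//; [exact: bigcapT_measurable|move=> x;
      apply].
  apply: le_trans (le_mu _ mh h0 _) _.
    by apply: le_trans hI _; rewrite lee_fin invf_le1// ler1n.
  by apply: le_trans hI _; rewrite lee_fin.
- by move=> x Nx m _ /=; have [_ _ + _] := hP m; exact.
Qed.

End capacity.

(** * Negative powers of extended reals and almost everywhere equality *)

Section negative_powers.
Local Open Scope ereal_scope.
Context {R : realType}.
Implicit Types (x y : \bar R) (r c : R).

Lemma epowN x r : (r < 0)%R -> epow x r = (x `^ (- r))^-1.
Proof. by rewrite /epow => ->. Qed.

Lemma epow_ge0 x r : 0 <= epow x r.
Proof. by rewrite /epow; case: ifP; rewrite ?inve_ge0 poweR_ge0. Qed.

Lemma epow_EFin c r : (0 < c)%R -> epow c%:E r = (c `^ r)%:E.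
Proof.
move=> c0; rewrite /epow; case: ifP => // r0.
by rewrite poweR_EFin inver gt_eqF ?powR_gt0// powRN invrK.
Qed.

Lemma epow0 r : (r < 0)%R -> epow (0 : \bar R) r = +oo.
Proof. by move=> r0; rewrite epowN// poweR0r ?oppr_eq0 ?lt_eqF// inve0. Qed.

Lemma epowy r : (r < 0)%R -> epow (+oo : \bar R) r = 0.
Proof. by move=> r0; rewrite epowN// poweRyr ?oppr_eq0 ?lt_eqF// invey. Qed.

Lemma le_epow x y r : (r < 0)%R -> 0 <= x -> x <= y -> epow y r <= epow x r.
Proof.
move=> r0 x0 xy; rewrite !epowN// lee_pV2 ?inE ?poweR_ge0//.
by apply: le_poweR => //; rewrite oppr_ge0 ltW.
Qed.

Lemma epowMl c x r : (r < 0)%R -> (0 < c)%R -> 0 <= x ->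
  epow (c%:E * x) r = (c `^ r)%:E * epow x r.
Proof.
move=> r0 c0; have cr0 : (0 < c `^ r)%R by rewrite powR_gt0.
case: x => [x| |//] x0.
  rewrite lee_fin le_eqVlt in x0; case/orP: x0 => [/eqP<-|x0].
    by rewrite mule0 epow0// gt0_muley.
  by rewrite -EFinM !epow_EFin ?mulr_gt0// powRM ?ltW.
by rewrite gt0_muley ?lte_fin// epowy// mule0.
Qed.

Lemma measurable_epow d (T : measurableType d) (f : T -> \bar R) r :
  measurable_fun setT f -> (forall t, 0 <= f t) ->
  measurable_fun setT (fun t => epow (f t) r).
Proof.
move=> mf f0; rewrite /epow; case: (r < 0)%R; last exact: measurable_fun_poweR.
have mp := measurable_fun_poweR (- r) mf.
(* Where the power is +oo, [fine] returns 0 and the real power of 0 with exponent -1 is 0, in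
   agreement with the inverse of +oo. *)
rewrite (_ : (fun t => _) = fun t => if f t `^ (- r) == 0 then +oo else
   (fine (f t `^ (- r)) `^ (-1))%:E).
  apply: measurable_fun_ifT => //; first exact: measurable_fun_eqe.
  apply/measurable_EFinP; apply: (measurableT_comp (f := @powR R ^~ (-1)%R)).
    exact: measurable_powR.
  by apply: measurableT_comp.
apply/funext => t; have := poweR_ge0 (f t) (- r); case: (f t `^ (- r)) => //=.
  by move=> y y0; rewrite inver eqe powR_inv1.
by move=> _; rewrite invey powR0// oppr_eq0 oner_eq0.
Qed.

End negative_powers.

Section potential_ae.
Local Open Scope ereal_scope.
Context d (T : measurableType d) (R : realType)
  (mu : {sigma_finite_measure set T -> \bar R}) (V K : R)
  (same near : int -> T -> set T) (G : dyadic_grid mu V K same near).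

Lemma eq_pot_ae (a : R) f f' x N : mu.-negligible N ->
  measurable_fun setT f -> measurable_fun setT f' ->
  (forall y, 0 <= f y) -> (forall y, 0 <= f' y) ->
  (forall y, ~ N y -> f y = f' y) -> pot mu V near a f x = pot mu V near a f' x.
Proof.
move=> NN mf mf' f0 f'0 ff'; apply: eq_zsum => j; congr (_ * (_ * _)).
apply: ge0_ae_eq_integral => //.
- exact: measurable_near G _ _.
- exact: measurable_funTS.
- exact: measurable_funTS.
- apply: negligibleS NN => y /=; apply: contra_notP => Ny _; exact: ff'.
Qed.

Lemma negligible_integral_lty (E : set T) f : measurable E ->
  measurable_fun setT f -> (forall x, 0 <= f x) ->
  \int[mu]_(x in E) f x < +oo -> mu.-negligible [set x | E x /\ f x = +oo].
Proof.
move=> mE mf f0 If; have : mu.-integrable E f.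
  apply/integrableP; split; first exact: measurable_funTS.
  by under eq_integral do rewrite gee0_abs//.
move=> /(integrable_ae mE); apply: negligibleS => x /= [Ex fx] /(_ Ex).
by rewrite fx.
Qed.

End potential_ae.

(** * The Choquet integral of a potential against an admissible weight *)

Section weighted_bound_of_choquet.
Local Open Scope ereal_scope.
Context d (T : measurableType d) (R : realType)
  (mu : {sigma_finite_measure set T -> \bar R}) (V K : R)
  (same near : int -> T -> set T) (G : dyadic_grid mu V K same near).
Variables (a s q : R).
Hypotheses (a0 : (0 < a)%R) (s1 : (1 < s)%R) (as1 : (a * s < 1)%R)
  (q1 : (1 <= q)%R) (qs : (q < s)%R).
Local Notation pot := (pot mu V near a).
Variables (rz : (T -> \bar R) -> T -> \bar R) (c1 c2 : R).
Hypotheses (c10 : (0 < c1)%R) (c20 : (0 < c2)%R)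
  (rz_pot : forall f x, measurable_fun setT f -> (forall y, 0 <= f y) ->
    c1%:E * pot f x <= rz f x /\ rz f x <= c2%:E * pot f x).
Local Notation rcap := (rcap mu s rz).
Local Notation rchoquet := (rchoquet mu s rz).

Let s0 : (0 < s)%R := lt_trans ltr01 s1.
Let q0 : (0 < q)%R := lt_le_trans ltr01 q1.

Let qs0 : (q - s < 0)%R. Proof. by rewrite subr_lt0. Qed.

Let sq0 : (s^-1 - q^-1 != 0)%R.
Proof.
by rewrite subr_eq0; apply/eqP => /(congr1 GRing.inv); rewrite !invrK => sq;
  move: qs; rewrite sq ltxx.
Qed.

(** Bounds the total error of the nearly optimal test functions of all levels, after multiplication
    by 2^k. *)
Lemma pw_opp_abs_summable :
  exists2 H : R, (0 < H)%R & zsum (fun k => (pw 2 1 (- `|k|))%:E) <= H%:E :>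
    \bar R.
Proof.
have g0 : (0 < geo 2 1 :> R)%R by apply: geo_gt0; rewrite ?ltr1n.
exists (geo 2 1 + geo 2 1)%R; first by rewrite addr_gt0.
have pp (k : int) : 0 <= (pw 2 1 k)%:E :> \bar R by rewrite lee_fin pw_ge0.
have pm (k : int) : 0 <= (pw 2 (-1) k)%:E :> \bar R by rewrite lee_fin pw_ge0.
apply: (@le_trans _ _ (zsum (fun k => (if (k <= 0)%R then (pw 2 1 k)%:E else 0)
  +
    (if (0 <= k)%R then (pw 2 (-1) k)%:E else 0)))).
  apply: le_zsum => k; have [k0|k0] := leP k 0%R.
    by rewrite ler0_norm// opprK leeDl//; case: ifP.
  by rewrite gtr0_norm// add0e (ltW k0) pwN pwNt.
rewrite zsumD; last 2 first.
- by move=> k; case: ifP.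
- by move=> k; case: ifP.
rewrite EFinD; apply: leeD.
- by apply: le_trans (zsum_geo_le _ _ _) _; rewrite ?ltr1n// pw0 mulr1.
- by apply: le_trans (zsum_geo_ge _ _ _) _; rewrite ?ltr1n// pw0 mulr1.
Qed.

Let weighted_bound (C : R) := forall (g w : T -> R) (h : int -> T -> \bar R),
  measurable_fun setT g -> measurable_fun setT w ->
  (forall x, 0 <= g x)%R -> (forall x, 0 <= w x)%R ->
  (forall k, measurable_fun setT (h k)) -> (forall k x, 0 <= h k x) ->
  (forall k x, (pw 2 1 k < w x)%R -> 1 <= pot (h k) x) ->
  \int[mu]_x (g x `^ s)%:E < +oo ->
  exists psi : int -> T -> \bar R,
    [/\ forall k, measurable_fun setT (psi k), forall k x, 0 <= psi k x,
     forall k x, (pw 2 q^-1 k)%:E <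
       pot (fun y => (g y * w y `^ (q^-1 - s^-1))%:E) x -> 1 <= pot (psi k) x &
     zsum (fun k => (pw 2 1 k)%:E * \int[mu]_x psi k x `^ s) <=
     C%:E * (\int[mu]_x (g x `^ s)%:E +
             zsum (fun k => (pw 2 1 k)%:E * \int[mu]_x h k x `^ s))].

Section admissible.
Variables (D : set T) (f W : T -> \bar R) (eps : R).
Hypotheses (mD : measurable D) (D0 : mu.-negligible (~` D))
  (mf : measurable_fun setT f) (f0 : forall x, 0 <= f x)
  (mW : measurable_fun setT W) (W0 : forall x, 0 <= W x)
  (capW : zsum (fun k => (pw 2 1 k)%:E *
     rcap (D `&` [set x | (pw 2 1 k)%:E < W x `^ q])) <= 2%:E)
  (eps0 : (0 < eps)%R)
  (fW : \int[mu]_(x in D `&` [set x | f x != 0]) (f x `^ s * epow (W x) (q - s))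
    <=
        (eps `^ s)%:E).

(** The real-valued data of the dyadic inequality: w is W^q, and g is f / eps times w^(1/s - 1/q),
    so that g^s integrates to at most 1. Where W = +oo, [fine] gives 0; by [cap_Wy] this happens in
    D only on a set of capacity zero. *)
Let w x : R := (\1_D x * fine (W x `^ q))%R.
Let g x : R := (fine (f x) / eps * w x `^ (s^-1 - q^-1))%R.

Let w0 x : (0 <= w x)%R.
Proof. by rewrite mulr_ge0// fine_ge0// poweR_ge0. Qed.

Let g0 x : (0 <= g x)%R.
Proof. by rewrite mulr_ge0 ?powR_ge0// divr_ge0 ?fine_ge0// ltW. Qed.

Let mw : measurable_fun setT w.
Proof.
apply: measurable_funM; first exact: measurable_indic.
by apply: (measurableT_comp (f := fine)) => //; exact: measurable_fun_poweR.
Qed.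

Let mg : measurable_fun setT g.
Proof.
apply: measurable_funM.
  by apply: measurable_funM => //; exact: measurableT_comp.
by apply: (measurableT_comp (f := @powR R ^~ _)) => //; exact: measurable_powR.
Qed.

Let mfW : measurable_fun setT (fun x => f x `^ s * epow (W x) (q - s)).
Proof.
by apply: emeasurable_funM; [exact: measurable_fun_poweR|exact:
  measurable_epow].
Qed.

Let mDf : measurable (D `&` [set x | f x != 0]).
Proof.
apply: measurableI => //; rewrite (_ : [set x | _] = [set x | 0 < f x]).
  exact: measurable_set_gt.
by apply/seteqP; split => x /=; rewrite lt0e f0 andbT.
Qed.

Let fW0 x : 0 <= f x `^ s * epow (W x) (q - s).
Proof. by rewrite mule_ge0 ?poweR_ge0 ?epow_ge0. Qed.

Let w_eq0_g x : w x = 0%R -> g x = 0%R.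
Proof. by rewrite /g => ->; rewrite powR0// mulr0. Qed.

Let integral_g : \int[mu]_x (g x `^ s)%:E <= 1.
Proof.
have e0 : 0 <= (eps `^ (- s))%:E by rewrite lee_fin powR_ge0.
apply: (@le_trans _ _ (\int[mu]_x ((eps `^ (- s))%:E *
   ((\1_(D `&` [set x | f x != 0]) x)%:E * (f x `^ s * epow (W x) (q - s)))))).
  have r0 x : 0 <= (eps `^ (- s))%:E *
   ((\1_(D `&` [set x | f x != 0]) x)%:E * (f x `^ s * epow (W x) (q - s))).
    by rewrite mule_ge0// mule_ge0// lee_fin.
  apply: le_integral.
  - by move=> x; rewrite lee_fin powR_ge0.
  - move=> x; have [wx|wx] := eqVneq (w x) 0%R.
      by rewrite (w_eq0_g wx) powR0// gt_eqF.
    have gx0 : g x = 0%R -> (g x `^ s)%:E <= (eps `^ (- s))%:E *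
        ((\1_(D `&` [set x | f x != 0]) x)%:E * (f x `^ s * epow (W x) (q -
          s))).
      by move=> ->; rewrite powR0// gt_eqF.
    have Dx : D x by apply: contrapT => Dx; move: wx;
      rewrite /w indicE memNset// mul0r eqxx.
    have wE : w x = fine (W x `^ q) by rewrite /w indicE mem_set// mul1r.
    move: wx; rewrite wE; case WE : (W x) => [r| |]; last 2 first.
    + have fy : fine (+oo `^ q : \bar R) = 0%R by rewrite poweRyr // gt_eqF.
      by rewrite fy eqxx.
    + by have := W0 x; rewrite WE.
    rewrite poweR_EFin/= => rq0; have r0' : (0 < r)%R.
      rewrite lt0r; have := W0 x; rewrite WE lee_fin => ->; rewrite andbT.
      by apply: contra rq0 => /eqP ->; rewrite powR0// gt_eqF.
    have [fx|fx] := eqVneq (f x) 0.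
      by rewrite -WE; apply: gx0; rewrite /g fx !mul0r.
    case fE : (f x) fx => [u| |] fx; last 2 first.
    + by rewrite -WE -fE; apply: gx0; rewrite /g fE !mul0r.
    + by move: (f0 x); rewrite fE.
    have u0 : (0 <= u)%R by have := f0 x; rewrite fE.
    rewrite indicE mem_set; last by split => //=; rewrite fE.
    rewrite mul1e epow_EFin// poweR_EFin -!EFinM lee_fin /g fE wE WE
      poweR_EFin/=.
    rewrite powRM ?powR_ge0 ?divr_ge0 ?(ltW eps0)//.
    rewrite powRM ?invr_ge0 ?(ltW eps0)// -powR_inv1 ?(ltW eps0)// -!powRrM
      mulN1r.
    rewrite (_ : (q * ((s^-1 - q^-1) * s)) = q - s)%R.
      by rewrite mulrA [(u `^ s * _)%R]mulrC.
    by field; rewrite !gt_eqF.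
  - by apply/measurable_EFinP; apply: (measurableT_comp (f :=
      @powR R ^~ _)) => //; exact: measurable_powR.
  - by apply: measurable_funeM; exact: measurable_indic_mule.
rewrite ge0_integralZl//; last 2 first.
- exact: measurable_indic_mule.
- by move=> x _; rewrite mule_ge0// lee_fin.
rewrite -integral_indicE.
apply: le_trans (lee_wpmul2l e0 fW) _.
by rewrite -EFinM powRN mulVf// gt_eqF// powR_gt0.
Qed.

Let f' y := (g y * w y `^ (q^-1 - s^-1))%:E.

Let mf' : measurable_fun setT f'.
Proof.
apply/measurable_EFinP; apply: measurable_funM => //.
by apply: (measurableT_comp (f := @powR R ^~ _)) => //; exact: measurable_powR.
Qed.

Let f'0 y : 0 <= f' y.
Proof. by rewrite lee_fin mulr_ge0// powR_ge0. Qed.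

(** This set lies in every level set, so 2^k times its capacity is at most 2 for all k. *)
Let cap_Wy : rcap (D `&` [set x | W x = +oo]) = 0.
Proof.
have le2 k : (pw 2 1 k)%:E * rcap (D `&` [set x | W x = +oo]) <= 2%:E.
  apply: le_trans capW; apply: le_trans (zsum_ge k _); last first.
    by move=> j; rewrite mule_ge0 ?rcap_ge0// lee_fin pw_ge0.
  apply: lee_wpmul2l; first by rewrite lee_fin pw_ge0.
  by apply: le_rcap => x [Dx /= ->]; rewrite poweRyr ?gt_eqF//=; split => //=;
    exact: ltry.
apply/eqP; rewrite eq_le rcap_ge0 andbT.
have := rcap_ge0 mu s rz (D `&` [set x | W x = +oo]).
case: (rcap _) le2 => [c le2| le2|//] c0.
- rewrite leNgt lte_fin; apply/negP => c00.
  have [j] := @pw_unbounded R 2 1 (2 / c) (ltr1n _ 2) ltr01.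
  by rewrite ltNge ler_pdivlMr// -lee_fin EFinM le2.
- by have := le2 0%R; rewrite gt0_muley ?lte_fin ?pw_gt0.
Qed.

(** Besides the complement of D and {W = +oo}, the set where the integrand is infinite is removed. A
    remaining point with f <> 0 has f and W finite and positive, since W = 0 or f = +oo would make
    the integrand infinite, and the powers of w cancel. *)
Let ae_f : exists2 N, mu.-negligible N & forall y, ~ N y -> f y = eps%:E * f' y.
Proof.
exists (~` D `|` (D `&` [set x | W x = +oo]) `|`
  [set x | (D `&` [set x | f x != 0]) x /\ f x `^ s * epow (W x) (q - s) =
    +oo]).
  apply: negligibleU; first apply: negligibleU => //.
    exact: (rcap0_negligible G a0 s1 as1 c20 rz_pot).
  apply: negligible_integral_lty => //; apply: le_lt_trans fW _; exact: ltry.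
move=> y /not_orP[/not_orP[/contrapT Dy Wy] fWy].
have [fy0|fy0] := eqVneq (f y) 0.
  by rewrite /f' /g fy0 !mul0r mule0.
have fWfin : f y `^ s * epow (W y) (q - s) <> +oo by move=> fWE; apply: fWy.
case WE : (W y) => [r| |]; last 2 first.
- by exfalso; apply: Wy; split.
- by have := W0 y; rewrite WE.
have r0 : (0 < r)%R.
  rewrite lt0r; have := W0 y; rewrite WE lee_fin => ->; rewrite andbT.
  apply/eqP => r0; apply: fWfin; rewrite WE r0 epow0// gt0_muley// poweR_gt0//.
  by rewrite lt0e fy0 f0.
case fE : (f y) fy0 => [u| |] fy0; last 2 first.
- exfalso; apply: fWfin; rewrite WE fE epow_EFin// poweRyr ?gt_eqF//.
  by rewrite gt0_mulye// lte_fin powR_gt0.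
- by have := f0 y; rewrite fE.
have wy : (0 < w y)%R by rewrite /w indicE mem_set// mul1r WE poweR_EFin/=
  powR_gt0.
rewrite /f' /g fE/= -!EFinM -!mulrA -powRD; last by rewrite (gt_eqF wy) implybT.
rewrite addrA subrK subrr powRr0 mulr1; congr (_%:E).
by rewrite mulrCA divff ?mulr1// gt_eqF.
Qed.

Let tests (H : R) : zsum (fun k => (pw 2 1 (- `|k|))%:E) <= H%:E ->
  exists h : int -> T -> \bar R,
    [/\ forall k, measurable_fun setT (h k), forall k x, 0 <= h k x,
     forall k x, (pw 2 1 k < w x)%R -> 1 <= pot (h k) x &
     zsum (fun k => (pw 2 1 k)%:E * \int[mu]_x h k x `^ s) <=
     (c2 `^ s * (2 + H))%:E].
Proof.
move=> sumH; pose E k := D `&` [set x | (pw 2 1 k)%:E < W x `^ q].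
have pE0 k : 0 <= (pw 2 1 k)%:E * rcap (E k).
  by rewrite mule_ge0 ?rcap_ge0// lee_fin pw_ge0.
have Efin k : rcap (E k) < +oo.
  have := le_trans (zsum_ge k pE0) capW.
  rewrite ltNge leye_eq; apply: contraTN => /eqP ->.
  by rewrite gt0_muley ?lte_fin ?pw_gt0.
(* Multiplied by 2^k, this error becomes the summable 2^(-|k|). *)
pose e (k : int) : R := (pw 2 1 (- k) * pw 2 1 (- `|k|))%R.
have e0 k : (0 < e k)%R by rewrite mulr_gt0 ?pw_gt0.
have /choice[h hP] := fun k => rcap_test G c20 rz_pot (e0 k) (Efin k).
exists h; split.
- by move=> k; have [] := hP k.
- by move=> k; have [] := hP k.
- move=> k x kw; have [_ _ + _] := hP k; apply.
  have wx : w x != 0%R by apply/eqP => wx; move: kw; rewrite wx ltNge pw_ge0.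
  have Dx : D x by apply: contrapT => Dx; move: wx;
    rewrite /w indicE memNset// mul0r eqxx.
  split => //=; move: kw; rewrite /w indicE mem_set// mul1r.
  have := poweR_ge0 (W x) q; case: (W x `^ q) => [r| |]//= _ _.
  by rewrite ltry.
- apply: (@le_trans _ _ (zsum (fun k => (c2 `^ s)%:E *
      ((pw 2 1 k)%:E * rcap (E k) + (pw 2 1 (- `|k|))%:E)))).
    apply: le_zsum => k; have [_ _ _ hI] := hP k.
    apply: le_trans (lee_wpmul2l _ hI) _; first by rewrite lee_fin pw_ge0.
    rewrite muleCA; apply: lee_wpmul2l; first by rewrite lee_fin powR_ge0.
    rewrite ge0_muleDr ?rcap_ge0 ?lee_fin ?(ltW (e0 k))//.
    rewrite -EFinM /e pwN mulrA divff ?mul1r// gt_eqF// pw_gt0//.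
  have pp (k : int) : 0 <= (pw 2 1 (- `|k|))%:E :> \bar R by rewrite lee_fin
    pw_ge0.
  rewrite zsumZl ?lee_fin ?powR_ge0//; last by move=> k; rewrite adde_ge0.
  rewrite EFinM; apply: lee_wpmul2l; first by rewrite lee_fin powR_ge0.
  by rewrite zsumD// EFinD; apply: leeD.
Qed.

Lemma rchoquet_admissible (C H : R) : (0 < C)%R -> weighted_bound C ->
  zsum (fun k => (pw 2 1 (- `|k|))%:E) <= H%:E ->
  rchoquet setT (fun x => rz f x `^ q) <=
  (c2 `^ q * c1 `^ (- s) * (C * (1 + c2 `^ s * (2 + H))) * eps `^ q)%:E.
Proof.
move=> C0 model sumH; have [h [mh h0 hw hI]] := tests sumH.
have gI : \int[mu]_x (g x `^ s)%:E < +oo by apply: le_lt_trans integral_g _;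
  exact: ltry.
have [psi [mpsi psi0 psiE psiI]] := model g w h mg mw g0 w0 mh h0 hw gI.
have [N NN fN] := ae_f.
have ce0 : (0 < c2 * eps)%R by rewrite mulr_gt0.
have potE x : pot f x = eps%:E * pot f' x.
  rewrite -(potZl G)// ?(ltW eps0)//; apply: (eq_pot_ae G _ _ NN) => //.
    exact: measurable_funeM.
  by move=> y; rewrite mule_ge0// lee_fin ltW.
apply: (@le_trans _ _ (((c2 * eps) `^ q)%:E * zsum (fun k => (pw 2 1 k)%:E *
    ((c1 `^ (- s))%:E * \int[mu]_x psi k x `^ s)))).
  have cq0 : (0 < (c2 * eps) `^ q)%R by rewrite powR_gt0.
  (* With levels (c2 eps)^q 2^k, a level set of (rz f)^q lies in the set where the potential of f /
     eps exceeds 2^(k/q). *)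
  apply: le_trans (le_rchoquet_dyadic _ _ _ _ _ cq0) _.
  apply: lee_wpmul2l; first by rewrite lee_fin ltW.
  apply: le_zsum => k; apply: lee_wpmul2l; first by rewrite lee_fin pw_ge0.
  apply: (rcap_le_test G s c10 rz_pot) => // x [_ /= ltk]; apply: psiE.
  rewrite ltNge; apply/negP => le_pot'; move: ltk; rewrite ltNge => /negP;
    apply.
  have [rz_ge rz_le] := rz_pot x mf f0.
  have rz0 : 0 <= rz f x.
    apply: le_trans rz_ge; rewrite mule_ge0 ?lee_fin ?(ltW c10)//.
    exact: (pot_ge0 mu V near f0).
  rewrite -[X in pw _ X _](mulVf (_ : q != 0)%R) ?gt_eqF// -pw_powR.
  rewrite -powRM ?pw_ge0 ?(ltW ce0)// -poweR_EFin.
  apply: le_poweR => //; first exact: ltW.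
  apply: le_trans rz_le _; rewrite potE muleA -EFinM [leRHS]EFinM.
  by apply: lee_wpmul2l => //; rewrite lee_fin ltW.
have I0 k : 0 <= \int[mu]_x psi k x `^ s by apply: integral_ge0 => x _;
  exact: poweR_ge0.
rewrite (eq_zsum (G := fun k => (c1 `^ (- s))%:E * ((pw 2 1 k)%:E * \int[mu]_x
  psi k x `^ s)));
  last by move=> k; rewrite muleCA.
rewrite zsumZl ?lee_fin ?powR_ge0//; last first.
  by move=> k; rewrite mule_ge0// lee_fin pw_ge0.
apply: (@le_trans _ _ (((c2 * eps) `^ q)%:E * ((c1 `^ (- s))%:E *
    (C%:E * (1 + (c2 `^ s * (2 + H))%:E))))).
  apply: lee_wpmul2l; first by rewrite lee_fin powR_ge0.
  apply: lee_wpmul2l; first by rewrite lee_fin powR_ge0.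
  apply: le_trans psiI _; apply: lee_wpmul2l; first by rewrite lee_fin ltW.
  exact: leeD.
rewrite -EFinD -!EFinM lee_fin powRM ?(ltW c20) ?(ltW eps0)//.
by rewrite le_eqVlt; apply/orP; left; apply/eqP; ring.
Qed.

End admissible.

(** Admissibility is expressed by a dyadic sum of capacities, a form that fits both a weight cut off
    to D and a multiple of the potential of f. *)
Theorem rchoquet_weighted_bound : exists2 B : R, (0 < B)%R &
  forall (D : set T) (f W : T -> \bar R) (eps : R),
    measurable D -> mu.-negligible (~` D) ->
    measurable_fun setT f -> (forall x, 0 <= f x) ->
    measurable_fun setT W -> (forall x, 0 <= W x) ->
    zsum (fun k => (pw 2 1 k)%:E *
      rcap (D `&` [set x | (pw 2 1 k)%:E < W x `^ q])) <= 2%:E ->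
    (0 < eps)%R ->
    \int[mu]_(x in D `&` [set x | f x != 0]) (f x `^ s * epow (W x) (q - s)) <=
      (eps `^ s)%:E ->
    rchoquet setT (fun x => rz f x `^ q) <= (B * eps `^ q)%:E.
Proof.
have [C C0 model] := dyadic_weighted_capacitary_inequality G a0 s1 as1 q1 qs.
have [H H0 sumH] := pw_opp_abs_summable.
exists (c2 `^ q * c1 `^ (- s) * (C * (1 + c2 `^ s * (2 + H))))%R.
  by rewrite !mulr_gt0 ?powR_gt0// addr_gt0// mulr_gt0 ?powR_gt0// addr_gt0.
move=> D f W eps mD D0 mf f0 mW W0 capW eps0 fW.
exact: (rchoquet_admissible mD D0 mf f0 mW W0 capW eps0 fW C0 model sumH).
Qed.

End weighted_bound_of_choquet.

(** * Both inequalities for an operator comparable with the dyadic potential *)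

Section conclusions.
Local Open Scope ereal_scope.
Context d (T : measurableType d) (R : realType)
  (mu : {sigma_finite_measure set T -> \bar R}) (V K : R)
  (same near : int -> T -> set T) (G : dyadic_grid mu V K same near).
Variables (a s q : R).
Hypotheses (a0 : (0 < a)%R) (s1 : (1 < s)%R) (as1 : (a * s < 1)%R)
  (q1 : (1 <= q)%R) (qs : (q < s)%R).
Local Notation pot := (pot mu V near a).
Variables (rz : (T -> \bar R) -> T -> \bar R) (c1 c2 : R).
Hypotheses (c10 : (0 < c1)%R) (c20 : (0 < c2)%R)
  (rz_pot : forall f x, measurable_fun setT f -> (forall y, 0 <= f y) ->
    c1%:E * pot f x <= rz f x /\ rz f x <= c2%:E * pot f x)
  (measurable_rz : forall f, measurable_fun setT f -> (forall y, 0 <= f y) ->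
    measurable_fun setT (rz f)).
Local Notation rcap := (rcap mu s rz).
Local Notation rchoquet := (rchoquet mu s rz).

Let s0 : (0 < s)%R := lt_trans ltr01 s1.
Let q0 : (0 < q)%R := lt_le_trans ltr01 q1.

Let qs0 : (q - s < 0)%R. Proof. by rewrite subr_lt0. Qed.

Lemma rchoquet_ge0 D g : 0 <= rchoquet D g.
Proof. by apply: integral_ge0 => t _; exact: rcap_ge0. Qed.

(** D is measurable because its complement, of capacity zero, is negligible and the measure is
    complete; w is measurable on D because it is integrable over the pieces of a countable cover. *)
Theorem rchoquet_le_weighted (ball : nat -> set T) :
  (forall N, mu.-negligible N -> measurable N) ->
  (forall k, measurable (ball k)) -> \bigcup_k ball k = setT ->
  exists2 B : R, (0 < B)%R & forall (D : set T) (w f : T -> \bar R) (eps : R),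
    rcap (~` D) = 0 -> (forall x, D x -> 0 <= w x) ->
    (forall k, mu.-integrable (D `&` ball k) w) ->
    rchoquet D (fun x => `|w x| `^ q) `^ q^-1 <= 1 ->
    measurable_fun setT f -> (forall x, 0 <= f x) -> (0 < eps)%R ->
    \int[mu]_(x in D `&` [set x | f x != 0]) (`|f x| `^ s * epow (w x) (q - s))
      <=
      (eps `^ s)%:E ->
    rchoquet setT (fun x => rz f x `^ q) <= (B * eps `^ q)%:E.
Proof.
move=> compl mball cover.
have [B B0 bound] := rchoquet_weighted_bound G a0 s1 as1 q1 qs c10 c20 rz_pot.
exists B => // D w f eps D0 w0 wint wq mf f0 eps0 fw.
have DN : mu.-negligible (~` D) by exact: (rcap0_negligible G a0 s1 as1 c20
  rz_pot).
have mD : measurable D by rewrite -[D]setCK; apply: measurableC; exact: compl.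
have mw : measurable_fun D w.
  rewrite -[D]setIT -cover setI_bigcupr; apply/measurable_fun_bigcup.
    by move=> k; apply: measurableI.
  by move=> k; have /integrableP[] := wint k.
have wE x : D x -> (w \_ D) x = w x by move=> Dx; rewrite patchE mem_set.
apply: (bound D f (w \_ D) eps) => //.
- by have [h _] := measurable_restrictT w mD; exact: h.
- by move=> x; rewrite patchE; case: ifP => // /set_mem /w0.
- apply: (@le_trans _ _ (2%:E * rchoquet D (fun x => `|w x| `^ q))).
    apply: le_trans (dyadic_le_rchoquet _ _ _ _ _ ltr01); rewrite mul1e.
    apply: le_zsum => k; apply: lee_wpmul2l; first by rewrite lee_fin pw_ge0.
    by apply: le_rcap => x [Dx /=]; rewrite wE// mul1r gee0_abs ?w0.
  rewrite -[leRHS]mule1; apply: lee_wpmul2l => //.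
  move: wq => /(le_poweR (r := q)); rewrite (ltW q0) poweR_ge0 => /(_ isT isT).
  by rewrite poweRVK ?gt_eqF ?rchoquet_ge0// poweR1r.
- rewrite (eq_integral (fun x => `|f x| `^ s * epow (w x) (q - s)))//.
  by move=> x /set_mem[Dx _]; rewrite wE// gee0_abs.
Qed.

(** Let nu be the left-hand side. The function W = c1 nu^(-1/q) pot f is at most nu^(-1/q) rz f,
    whose q-th power has Choquet integral 1. The weighted bound becomes nu <= B' nu^(1 - q/s)
    J^(q/s); finiteness of nu allows division by the power of nu. *)
Theorem rchoquet_le_self : exists2 A : R, (0 < A)%R & forall f : T -> \bar R,
  measurable_fun setT f -> (forall x, 0 <= f x) ->
  rchoquet setT (fun x => rz f x `^ q) < +oo ->
  rchoquet setT (fun x => rz f x `^ q) <=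
  A%:E * \int[mu]_(x in [set x | f x != 0]) (f x `^ s * epow (rz f x) (q - s)).
Proof.
have [B B0 bound] := rchoquet_weighted_bound G a0 s1 as1 q1 qs c10 c20 rz_pot.
pose rho : R := (c1 / c2)%R; have rho0 : (0 < rho)%R by rewrite divr_gt0.
pose B' : R := (B * rho `^ ((q - s) * (q / s)))%R.
have B'0 : (0 < B')%R by rewrite mulr_gt0// powR_gt0.
exists (B' `^ (s / q))%R; first by rewrite powR_gt0.
move=> f mf f0; have rz0 x : 0 <= rz f x.
  have [+ _] := rz_pot x mf f0; apply: le_trans.
  by rewrite mule_ge0 ?lee_fin ?(ltW c10)// (pot_ge0 mu V near f0).
have A0 : (0 < B' `^ (s / q))%R by rewrite powR_gt0.
set N := rchoquet _ _; set I := \int[mu]_(x in _) _ => Noo.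
have I0 : 0 <= I by apply: integral_ge0 => x _;
  rewrite mule_ge0 ?poweR_ge0 ?epow_ge0.
have N0 : 0 <= N by exact: rchoquet_ge0.
case NE : N N0 Noo => [nu| |]// N0 _.
case IE : I I0 => [iota| |]// I0; last by rewrite gt0_muley ?leey// lte_fin.
rewrite !lee_fin in N0 I0.
move: N0; rewrite le_eqVlt => /orP[/eqP <-|nu0].
  by rewrite -EFinM lee_fin mulr_ge0// ltW.
rewrite -EFinM lee_fin.
(* A number J above the integral, which might be 0, keeps eps positive. *)
suff key (J : R) : (iota < J)%R -> (nu <= B' `^ (s / q) * J)%R.
  apply/ler_addgt0Pr => e e0.
  have := key (iota + e / B' `^ (s / q))%R; rewrite ltrDl divr_gt0// => /(_
    isT).
  by rewrite mulrDr mulrCA divff ?mulr1// gt_eqF.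
move=> iJ; have J0 : (0 < J)%R by exact: le_lt_trans iJ.
pose c := (c1 * nu `^ (- q^-1))%R; have c0 : (0 < c)%R by rewrite mulr_gt0//
  powR_gt0.
have kap0 : (0 < c / c2)%R by rewrite divr_gt0.
(* Since W >= (c / c2) rz f and q - s < 0, the weighted integral with W is at most (c / c2)^(q - s)
   times the integral with rz f. *)
pose eps := (((c / c2) `^ (q - s) * J) `^ s^-1)%R.
have eps0 : (0 < eps)%R by rewrite powR_gt0// mulr_gt0// powR_gt0.
have epsE : (eps `^ s = (c / c2) `^ (q - s) * J)%R.
  by rewrite -powRrM mulVf ?gt_eqF// powRr1// mulr_ge0 ?powR_ge0// ltW.
pose W x := c%:E * pot f x.
have mW : measurable_fun setT W by apply: measurable_funeM;
  exact: (measurable_pot G mf f0).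
have W0 x : 0 <= W x by rewrite mule_ge0 ?lee_fin ?(ltW c0)// (pot_ge0 mu V near
  f0).
have mf0 : measurable [set x | f x != 0].
  rewrite (_ : [set x | _] = [set x | 0 < f x]); first exact: measurable_set_gt.
  by apply/seteqP; split => x /=; rewrite lt0e f0 andbT.
have : N <= (B * eps `^ q)%:E.
  apply: (bound setT f W eps) => //.
  - by rewrite setCT; exact: negligible_set0.
  - have := dyadic_le_rchoquet mu s rz setT (fun x => rz f x `^ q) nu0.
    rewrite -/N NE [2%:E * _]muleC => le2.
    have : zsum (fun k => (pw 2 1 k)%:E * rcap ([set: T] `&`
        [set x | (nu * pw 2 1 k)%:E < rz f x `^ q])) <= 2%:E.
      have nuK : (nu^-1)%:E * (nu%:E * 2%:E) = 2%:E :> \bar R.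
        by rewrite -!EFinM mulKf// gt_eqF.
      by move: le2; rewrite -lee_pdivlMl// nuK.
    apply: le_trans; apply: le_zsum => k; apply: lee_wpmul2l.
      by rewrite lee_fin pw_ge0.
    apply: le_rcap => x [_ /= kW]; split => //=.
    have : W x `^ q <= (nu^-1)%:E * rz f x `^ q.
      have [+ _] := rz_pot x mf f0 => rz_ge.
      have : W x <= (nu `^ (- q^-1))%:E * rz f x.
        rewrite /W /c mulrC EFinM -muleA; apply: lee_wpmul2l => //.
        by rewrite lee_fin powR_ge0.
      move=> /(le_poweR (r := q)) => /(_ (ltW q0) (W0 x)).
      rewrite poweRM ?lee_fin ?powR_ge0// poweR_EFin -powRrM mulNr mulVf
        ?gt_eqF//.
      by rewrite powR_inv1// ltW.
    by move=> /(lt_le_trans kW); rewrite EFinM -lte_pdivlMl// => /lt_le_trans;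
      apply.
  - rewrite setTI epsE EFinM.
    apply: (@le_trans _ _ (((c / c2) `^ (q - s))%:E * I)); last first.
      by apply: lee_wpmul2l; rewrite ?lee_fin ?powR_ge0// IE lee_fin ltW.
    have mR := measurable_rz mf f0.
    have mR' : measurable_fun setT (fun x => f x `^ s * epow (rz f x) (q - s)).
      by apply: emeasurable_funM; [exact: measurable_fun_poweR|exact:
        measurable_epow].
    have R0 x : 0 <= f x `^ s * epow (rz f x) (q - s).
      by rewrite mule_ge0 ?poweR_ge0 ?epow_ge0.
    rewrite /I -ge0_integralZl//; last 2 first.
    + exact: measurable_funTS.
    + by rewrite lee_fin powR_ge0.
    apply: ge0_le_integral => //.
    + by move=> x _; rewrite mule_ge0 ?poweR_ge0 ?epow_ge0.
    + apply: measurable_funTS; apply: emeasurable_funM;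
        first exact: measurable_fun_poweR.
      exact: measurable_epow.
    + by apply: measurable_funTS; exact: measurable_funeM.
    + move=> x _; rewrite muleCA; apply: lee_wpmul2l; first exact: poweR_ge0.
      rewrite -epowMl//; apply: le_epow => //.
        by rewrite mule_ge0// lee_fin ltW.
      have [_ rz_le] := rz_pot x mf f0.
      apply: (@le_trans _ _ ((c / c2)%:E * (c2%:E * pot f x))).
        by apply: lee_wpmul2l => //; rewrite lee_fin ltW.
      by rewrite muleA -EFinM divfK// gt_eqF.
rewrite NE lee_fin => nule.
have epsq : (eps `^ q = rho `^ ((q - s) * (q / s)) * nu `^ (1 - q / s) * J `^ (q
  / s))%R.
  have -> : (eps `^ q = (eps `^ s) `^ (q / s))%R.
    by rewrite -powRrM mulrCA divff ?mulr1// gt_eqF.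
  rewrite epsE powRM ?powR_ge0 ?(ltW J0)// -powRrM.
  congr (_ * _)%R; rewrite /c mulrAC -/rho powRM ?powR_ge0 ?(ltW rho0)//.
  congr (_ * _)%R; rewrite -powRrM; congr (_ `^ _)%R.
  by field; rewrite !gt_eqF.
have : (nu `^ (q / s) <= B' * J `^ (q / s))%R.
  rewrite -(@ler_pM2l _ (nu `^ (1 - q / s)))%R ?powR_gt0//.
  rewrite -powRD; last by rewrite subrK oner_eq0.
  rewrite subrK powRr1 ?(ltW nu0)//; apply: le_trans nule _.
  by rewrite epsq /B' le_eqVlt; apply/orP; left; apply/eqP; ring.
move=> /(@ge0_ler_powR _ (s / q)%R).
have sq0 : (0 <= s / q)%R by rewrite divr_ge0 ?ltW.
rewrite sq0 !nnegrE powR_ge0 mulr_ge0 ?powR_ge0 ?(ltW B'0)// => /(_ isT isT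
  isT).
rewrite powRM ?powR_ge0 ?(ltW B'0)// -!powRrM.
have -> : (q / s * (s / q) = 1)%R by field; rewrite !gt_eqF.
by rewrite !powRr1 ?(ltW nu0) ?(ltW J0).
Qed.

End conclusions.

(** * The Euclidean space *)

Lemma measurable_kernel_integral d (T : measurableType d) (R : realType)
    (mu : {sigma_finite_measure set T -> \bar R}) (k : T -> T -> \bar R) f :
  measurable_fun setT (fun p : T * T => k p.1 p.2) -> measurable_fun setT f ->
  (forall x y, 0 <= k x y)%E -> (forall x, 0 <= f x)%E ->
  measurable_fun setT (fun x => \int[mu]_y (k x y * f y))%E.
Proof.
move=> mk mf k0 f0.
apply: (@measurable_fun_fubini_tonelli_F _ _ T T R mu (fun p => k p.1 p.2 * f
  p.2)%E).
- by apply: emeasurable_funM => //; exact: measurableT_comp.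
- by move=> p; rewrite mule_ge0.
Qed.

Section euclidean_space.
Local Open Scope ereal_scope.
Context (R : realType) (n : nat).
Local Notation Rn := (Rspace R n).
Local Notation mu := (lebesgue_Rn_sf R n).

Lemma measurable_eucl_dist2 :
  measurable_fun setT (fun p : Rn * Rn => eucl_dist p.1 p.2).
Proof.
apply: (measurableT_comp (f := @Num.sqrt R)).
  by apply: continuous_measurable_fun; exact: sqrt_continuous.
apply: (@measurable_sum _ _ _ setT 'I_n (index_enum 'I_n)
  (fun i (p : Rn * Rn) => (coord p.1 i - coord p.2 i) ^+ 2)%R) => i.
apply: measurable_funX; apply: measurable_funB.
  exact: (measurableT_comp (measurable_coord i) measurable_fst).
exact: (measurableT_comp (measurable_coord i) measurable_snd).
Qed.

Lemma measurable_kern2 (alpha : R) : (alpha < n%:R)%R ->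
  measurable_fun setT (fun p : Rn * Rn => kern alpha p.1 p.2).
Proof.
move=> alphan; apply: (measurable_epow (f := fun p : Rn * Rn => (eucl_dist p.1
  p.2)%:E)).
  by apply/measurable_EFinP; exact: measurable_eucl_dist2.
by move=> p; rewrite lee_fin eucl_dist_ge0.
Qed.

Lemma measurable_riesz (alpha : R) (f : Rn -> \bar R) : (alpha < n%:R)%R ->
  measurable_fun setT f -> (forall x, 0 <= f x) ->
  measurable_fun setT (riesz alpha f).
Proof.
move=> alphan mf f0; apply: measurable_funeM.
rewrite (_ : (fun x => _) = fun x => \int[mu]_y (kern alpha x y * f y)).
  apply: measurable_kernel_integral => //; first exact: measurable_kern2.
  by move=> x y; exact: kern_ge0.
by apply/funext => x; rewrite integral_lebesgue_Rn.
Qed.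

Lemma capE (alpha s : R) E : (0 < s)%R -> cap alpha s E = rcap mu s (@riesz R n
  alpha) E.
Proof.
move=> s0; rewrite /cap /rcap; congr ereal_inf; apply/seteqP;
  split => _ [f [mf f0 fE] <-].
  exists f => //; rewrite Lnorm.unlock/= poweRVK ?gt_eqF//; last first.
    by apply: integral_ge0 => x _; exact: poweR_ge0.
  by rewrite integral_lebesgue_Rn; apply: eq_integral => x _; rewrite gee0_abs.
exists f => //; rewrite Lnorm.unlock/= poweRVK ?gt_eqF//; last first.
  by apply: integral_ge0 => x _; exact: poweR_ge0.
by rewrite integral_lebesgue_Rn; apply: eq_integral => x _; rewrite gee0_abs.
Qed.

Lemma choquet_integralE (alpha s : R) D g : (0 < s)%R ->
  choquet_integral alpha s D g = rchoquet mu s (@riesz R n alpha) D g.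
Proof. by move=> s0; apply: eq_integral => t _; rewrite capE. Qed.

Lemma lebesgue_Rn_sf_complete N : mu.-negligible N -> measurable N.
Proof.
rewrite lebesgue_Rn_sf.unlock; exact: measure_is_complete_caratheodory.
Qed.

Lemma integrable_lebesgue_Rn D f :
  (lebesgue_Rn R n).-integrable D f -> mu.-integrable D f.
Proof. by rewrite lebesgue_Rn_sf.unlock. Qed.

Lemma Gamma_ge0 (t : R) : (0 <= Gamma t)%R.
Proof. by apply: Rintegral_ge0 => x _; rewrite mulr_ge0 ?powR_ge0 ?expR_ge0.
  Qed.

Lemma riesz_const_ge0 (alpha : R) : (0 <= riesz_const n alpha)%R.
Proof. by rewrite divr_ge0 ?Gamma_ge0// !mulr_ge0 ?powR_ge0 ?Gamma_ge0. Qed.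

Definition cball (k : nat) : set Rn :=
  [set x | (eucl_dist ([tuple of nseq n 0%R] : Rn) x <= k%:R)%R].

Lemma measurable_cball k : measurable (cball k).
Proof.
rewrite /cball; have := measurable_eucl_dist ([tuple of nseq n 0%R] : Rn).
move=> /(_ measurableT _ (measurable_itv `]-oo, k%:R])); rewrite setTI.
by rewrite (_ : _ @^-1` _ = cball k)//; apply/seteqP; split => x /=;
  rewrite in_itv.
Qed.

Lemma bigcup_cball : \bigcup_k cball k = setT.
Proof.
rewrite -subTset => x _.
exists (Num.truncn (eucl_dist ([tuple of nseq n 0%R] : Rn) x)).+1 => //.
by rewrite /cball/= ltW// truncnS_gt.
Qed.

End euclidean_space.

(** * The two inequalities for the Riesz potential *)

Section conclusion.
Local Open Scope ereal_scope.
Context (R : realType) (n : nat) (alpha s q : R).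
Hypotheses (n_ge1 : (1 <= n)%N) (alpha_gt0 : (0 < alpha)%R) (alpha_ltn : (alpha
  < n%:R)%R)
  (s_lt : (s < n%:R / alpha)%R) (q_ge1 : (1 <= q)%R) (q_lts : (q < s)%R).
Local Notation Rn := (Rspace R n).

Let s1 : (1 < s)%R := le_lt_trans q_ge1 q_lts.
Let s0 : (0 < s)%R := lt_trans ltr01 s1.
Let q0 : (0 < q)%R := lt_le_trans ltr01 q_ge1.
Let n0 : (0 < n%:R :> R)%R. Proof. by rewrite ltr0n. Qed.
Let a0 : (0 < alpha / n%:R)%R. Proof. by rewrite divr_gt0. Qed.
Let as1 : (alpha / n%:R * s < 1)%R.
Proof. by rewrite mulrAC ltr_pdivrMr// mul1r mulrC -ltr_pdivlMr. Qed.

Local Notation N f := (choquet_integral alpha s [set: Rn] (fun x => riesz alpha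
  f x `^ q)).

(* This case cannot be ignored: Gamma would take the junk value 0 if its
   integral diverged. *)
Lemma choquet_riesz_const0 (f : Rn -> \bar R) : riesz_const n alpha = 0%R -> N f
  = 0.
Proof.
move=> c0; apply: integral0_eq => t; rewrite /= in_itv/= andbT => t0.
rewrite (_ : _ `&` _ = set0) ?capE ?rcap_set0//.
rewrite -subset0 => x [_ /=]; rewrite /riesz c0 mul0e poweR0r ?gt_eqF//.
by rewrite lte_fin ltNge (ltW t0).
Qed.

(** The infimum defining the quasi-norm may fail to be attained, so the bound is used for every eps
    above it and passed to the limit after taking q-th roots. *)
Lemma choquet_le_tildeO (B : R) (f : Rn -> \bar R) : (0 < B)%R ->
  tildeO_norm alpha s q f < +oo ->
  (forall eps : R, tildeO_norm alpha s q f < eps%:E -> N f <= (B * eps `^ q)%:E)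
    ->
  N f <= B%:E * tildeO_norm alpha s q f `^ q.
Proof.
move=> B0; have t0 : 0 <= tildeO_norm alpha s q f.
  by apply: le_ereal_inf_tmp => _ [Dw _ <-]; exact: poweR_ge0.
case: (tildeO_norm _ _ _ _) t0 => [t| |]// t0 _ bound.
have N0 : 0 <= N f by rewrite choquet_integralE// rchoquet_ge0.
have : N f < +oo.
  have := bound (t + 1)%R; rewrite lte_fin ltrDl => /(_ ltr01) /le_lt_trans;
    apply.
  exact: ltry.
case: (N f) N0 bound => [m| |]// m0 bound _.
rewrite poweR_EFin -EFinM lee_fin -ler_pdivrMl//.
have mB : (0 <= B^-1 * m)%R by rewrite mulr_ge0 ?invr_ge0 ?(ltW B0).
have -> : (B^-1 * m = (B^-1 * m) `^ q^-1 `^ q)%R.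
  by rewrite -powRrM mulVf ?gt_eqF// powRr1.
apply: ge0_ler_powR; rewrite ?nnegrE ?powR_ge0 ?(ltW q0)//.
apply/ler_addgt0Pr => e e0.
have te : (0 <= t + e)%R by rewrite addr_ge0 ?(ltW e0).
have := bound (t + e)%R; rewrite lte_fin ltrDl => /(_ e0).
rewrite lee_fin -ler_pdivrMl// => /(@ge0_ler_powR _ q^-1%R).
rewrite invr_ge0 (ltW q0) !nnegrE mB powR_ge0 => /(_ isT isT isT).
by rewrite -powRrM divff ?gt_eqF// powRr1.
Qed.

Lemma choquet_riesz_bound : exists2 B : R, (0 < B)%R &
  forall f : Rn -> \bar R, (forall x, 0 <= f x) -> tildeO alpha s q f ->
    N f <= B%:E * tildeO_norm alpha s q f `^ q.
Proof.
have [c0|c0] := eqVneq (riesz_const n alpha : R) 0%R.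
  exists 1%R => // f f0 _; rewrite choquet_riesz_const0//.
  by rewrite mule_ge0 ?poweR_ge0.
have rc0 : (0 < riesz_const n alpha)%R by rewrite lt0r c0 riesz_const_ge0.
have [c1 [c2 [c10 c20 rz_pot]]] := riesz_sim_pot n_ge1 alpha_ltn rc0.
have [B B0 bound] := rchoquet_le_weighted (Rn_grid R n_ge1) a0 s1 as1 q_ge1
  q_lts c10 c20
  rz_pot (@lebesgue_Rn_sf_complete R n) (@measurable_cball R n) (@bigcup_cball R
    n).
exists B => // f f0 [mf foo]; apply: choquet_le_tildeO => // eps.
move=> /ereal_inf_lt[_ [[D w] /= [D0 [w0 wint] wq] <-] lteps].
have eps0 : (0 < eps)%R.
  by rewrite -lte_fin; apply: le_lt_trans lteps; exact: poweR_ge0.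
rewrite choquet_integralE//; apply: (bound D w f eps) => //.
- by rewrite -capE.
- by move=> k; apply: integrable_lebesgue_Rn; exact: wint.
- by move: wq; rewrite /Lq_cap_norm choquet_integralE.
- move: lteps => /ltW /(le_poweR (r := s)).
  rewrite (ltW s0) poweR_ge0 poweRVK ?gt_eqF//.
    by move=> /(_ isT isT); rewrite integral_lebesgue_Rn.
  by apply: integral_ge0 => x _; rewrite mule_ge0 ?poweR_ge0 ?epow_ge0.
Qed.

Lemma choquet_riesz_self_bound : exists2 A : R, (0 < A)%R &
  forall f : Rn -> \bar R, (forall x, 0 <= f x) -> tildeO alpha s q f ->
    N f <= A%:E * \int[lebesgue_Rn R n]_(x in [set x | f x != 0])
                    (f x `^ s * epow (riesz alpha f x) (q - s)).
Proof.
have [c0|c0] := eqVneq (riesz_const n alpha : R) 0%R.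
  exists 1%R => // f f0 _; rewrite choquet_riesz_const0//.
  by rewrite mule_ge0//; apply: integral_ge0 => x _;
    rewrite mule_ge0 ?poweR_ge0 ?epow_ge0.
have rc0 : (0 < riesz_const n alpha)%R by rewrite lt0r c0 riesz_const_ge0.
have [c1 [c2 [c10 c20 rz_pot]]] := riesz_sim_pot n_ge1 alpha_ltn rc0.
have [B B0 finite] := choquet_riesz_bound.
have [A A0 bound] := rchoquet_le_self (Rn_grid R n_ge1) a0 s1 as1 q_ge1 q_lts
  c10 c20
  rz_pot (fun f => measurable_riesz alpha_ltn).
(* The first inequality supplies the finiteness of the Choquet integral that [rchoquet_le_self]
   assumes. *)
exists A => // f f0 tf; have Noo := finite f f0 tf; have [mf foo] := tf.
move: Noo; rewrite choquet_integralE// integral_lebesgue_Rn => Noo.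
apply: bound => //; apply: le_lt_trans Noo _.
by rewrite lte_mul_pinfty// ?lee_fin ?(ltW B0)// poweR_lty.
Qed.

End conclusion.

Theorem theorem1p2 (R : realType) (n : nat) (alpha s q : R)
    (n_ge1 : (1 <= n)%N)
    (alpha_gt0 : 0 < alpha) (alpha_ltn : alpha < n%:R)
    (s_gt0 : 0 < s) (s_lt : s < n%:R / alpha)
    (q_ge1 : 1 <= q) (q_lts : q < s) :
  (exists B : R, 0 < B /\
    forall f : Rspace R n -> \bar R,
      (forall x, (0 <= f x)%E) -> tildeO alpha s q f ->
      (choquet_integral alpha s [set: Rspace R n]
         (fun x => riesz alpha f x `^ q)
       <= B%:E * tildeO_norm alpha s q f `^ q)%E) /\
  (exists A : R, 0 < A /\
    forall f : Rspace R n -> \bar R,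
      (forall x, (0 <= f x)%E) -> tildeO alpha s q f ->
      (choquet_integral alpha s [set: Rspace R n]
         (fun x => riesz alpha f x `^ q)
       <= A%:E * \int[lebesgue_Rn R n]_(x in [set x | f x != 0])
                   (f x `^ s * epow (riesz alpha f x) (q - s)))%E).
Proof.
have [B B0 bB] := choquet_riesz_bound n_ge1 alpha_gt0 alpha_ltn s_lt q_ge1
  q_lts.
have [A A0 bA] := choquet_riesz_self_bound n_ge1 alpha_gt0 alpha_ltn s_lt q_ge1
  q_lts.
by split; [exists B|exists A].
Qed.
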